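(* Let $\Bbbk$ be a field of characteristic zero and $\mathfrak g_\circ=\bigoplus_{i=1}^6L_i$ the $14$-dimensional graded Lie algebra of the regular quartic pencil, with bracket $\mu$ (explicitly defined in the context). Let $S$ be an effective miniversal graded slice at $\mathfrak g_\circ$. Then $$S\simeq\operatorname{Spf}\Bbbk[[t_1,\dots,t_{11}]],\qquad K:=\operatorname{Stab}_{\mathrm{eff}}(\mathfrak g_\circ)\simeq V_4.$$ There is a $K$-equivariant formally smooth map $$\Theta:S\longrightarrow\widehat E_{\mathrm{top},0},\qquad E_{\mathrm{top}}=\operatorname{Hom}(L_2\otimes L_4,L_6)\oplus\operatorname{Hom}(\Lambda^2L_3,L_6),$$ of relative dimension three. Its zero fiber is the scheme-theoretic metabelian locus of $S$ and is the formal binary-pencil germ $\operatorname{Spf}\Bbbk[[p_1,p_2,p_3]]$. Moreover, $$\mathrm d\Theta:H^2_0(\mathfrak g_\circ;\mathfrak g_\circ)\twoheadrightarrow E_{\mathrm{top}}$$ is surjective with kernel the pencil-motion tangent $P$. Thus the effective graded tangent decomposes into three metabelian and eight transverse directions.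
   Context: The algebra $\mathfrak g_\circ$. It has homogeneous basis $X,Y\in L_1$; $Z_0\in L_2$; $Z_x,Z_y\in L_3$; $Z_{x^2},Z_{xy},Z_{y^2}\in L_4$; $Z_{x^3},Z_{x^2y},Z_{xy^2},Z_{y^3}\in L_5$; $T_0,T_1\in L_6$. The bracket $\mu$ is $[X,Y]=Z_0$, $[X,Z_p]=Z_{xp}$, $[Y,Z_p]=Z_{yp}$ for monomials $p$ in $x,y$ of degree $\le3$ (with $Z_1=Z_0$), where in degree four $Z_{x^4}=Z_{y^4}=T_0$, $Z_{x^3y}=Z_{xy^3}=T_1$, $Z_{x^2y^2}=0$; $L_6$ is central and $\bigoplus_{j\ge2}L_j$ is abelian. (It is attached to the pencil of binary quartics spanned by $S^4+T^4$ and $4S^3T+4ST^3$.) Cohomology: $H^q_0(\mathfrak g_\circ;\mathfrak g_\circ)$ is degree-zero adjoint Chevalley–Eilenberg cohomology; $Z^2_0,B^2_0$ are degree-zero cocycles and coboundaries. Pencil-motion tangent: $P=\operatorname{span}\{[\psi_0],[\psi_1],[\psi_2]\}\subset H^2_0$, where the degree-zero 2-cocycles $\psi_i$ have only the nonzero values (up to antisymmetry) $\psi_0(X,Z_{x^3})=T_0$; $\psi_1(X,Z_{x^2y})=\psi_1(Y,Z_{x^3})=T_0$; $\psi_2(X,Z_{xy^2})=\psi_2(Y,Z_{x^2y})=T_0$. The brackets $\mu+\sum_ip_{i+1}\psi_i$ form an affine family of Lie brackets (pencil motion); the formal binary-pencil germ is its formal parameter germ at $0$, mapped into $S$ by the classifying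 map. Slice: let $V=\bigoplus_{i=1}^6L_i$ as graded vector space, $\mathcal X$ the affine scheme of degree-zero (graded) Lie laws on $V$, $\mathcal H=\prod_i\operatorname{GL}(L_i)$ acting on $\mathcal X$ by change of basis, $T_{\mathrm{Car}}=\{(\lambda^i\mathrm{id}_{L_i})_i\}\subset\mathcal H$ the Carnot torus (acting trivially on $\mathcal X$), $\overline{\mathcal H}=\mathcal H/T_{\mathrm{Car}}$, and $K=\operatorname{Stab}_{\mathrm{eff}}(\mathfrak g_\circ)=\operatorname{Stab}_{\overline{\mathcal H}}(\mu)$. An effective miniversal graded slice is a $K$-stable formal subscheme $S\subset\widehat{\mathcal X}_\mu$ with $T_\mu S$ a complement of $B^2_0$ in $Z^2_0=T_\mu\mathcal X$ (so $T_\mu S\simeq H^2_0$), such that the action map $\widehat{\overline{\mathcal H}}_e\times S\to\widehat{\mathcal X}_\mu$ is an isomorphism. $V_4$ is the Klein four-group. $\widehat E_{\mathrm{top},0}$ is the formal completion of the affine space $E_{\mathrm{top}}$ at $0$, on which $K$ acts by push-forward through graded automorphisms ($T_{\mathrm{Car}}$ acts trivially). The metabelian locus of $S$ is the closed formal subscheme of laws $\nu$ satisfying $\nu(\nu(a,b),\nu(c,e))=0$. *)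

(* Defs.v *)
From HB Require Import structures.
From mathcomp Require Import all_boot all_order all_algebra.
From mathcomp Require Import qpoly ring.

Set Implicit Arguments.
Unset Strict Implicit.
Unset Printing Implicit Defensive.

Import GRing.Theory.
Local Open Scope ring_scope.

(* Formal k-schemes are handled through their functors of points on local    *)
(* Artinian k-algebras with residue field k.                                 *)

Definition nilp (R : nzRingType) (x : R) : Prop := exists n : nat, x ^+ n = 0.

(* The maximal ideal of such an algebra consists of its nilpotent elements.  *)
Record artAlg (k : fieldType) := ArtAlg {
  art_sort :> comUnitAlgType k;
  art_findim : exists s : seq art_sort, forall x : art_sort,
    exists c : 'I_(size s) -> k, x = \sum_i c i *: s`_i;
  art_local : forall x : art_sort, exists c : k, nilp (x - c%:A) }.

Section DualNumbers.
Variable k : fieldType.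

Local Notation D := {poly %/ ('X^2 : {poly k})}.

Lemma mk_monicX2 : mk_monic ('X^2 : {poly k}) = 'X^2.
Proof. by rewrite /mk_monic monicXn size_polyXn. Qed.

Lemma dual_findim : exists s : seq D, forall x : D,
  exists c : 'I_(size s) -> k, x = \sum_i c i *: s`_i.
Proof.
exists [:: 1; 'qX] => x; exists (fun i => (x : {poly k})`_i).
apply: val_inj => /=; rewrite !big_ord_recl big_ord0 /= addr0.
have -> : Pdiv.CommonRing.rmodp 'X (mk_monic ('X^2 : {poly k})) = 'X.
  by rewrite mk_monicX2 -Pdiv.IdomainMonic.modpE ?monicXn // modp_small
             ?size_polyXn ?size_polyX.
apply/polyP=> -[|[|i]]; rewrite !coefE /= ?mulr0 ?mulr1 ?addr0 ?add0r //.
apply: nth_default; apply: leq_trans (size_npoly x) _.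
by rewrite mk_monicX2 size_polyXn.
Qed.

Lemma dual_local (x : D) : exists c : k, nilp (x - c%:A).
Proof.
exists (x : {poly k})`_0; exists 2%N; apply: val_inj.
set z := x - _; rewrite (expr2 z) /=; set y := (X in X * X).
rewrite mk_monicX2 -Pdiv.IdomainMonic.modpE ?monicXn //.
have /factor_theorem[q ->] : root y 0.
  by rewrite /root horner_coef0 !coefE mulr1 subrr.
by rewrite subr0 mulrACA -expr2 modp_mull.
Qed.

(* k[e]/(e^2), with e = 'qX *)
Definition dual : artAlg k := ArtAlg dual_findim dual_local.
Definition eps : dual := 'qX%qT.

End DualNumbers.

(* A functor on [artAlg k] with values in subsets ([pts]) of an ambient      *)
(* functor.                                                                  *)
Record formal (k : fieldType) := Formal {
  amb : artAlg k -> Type;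
  fmap : forall A B : artAlg k, {lrmorphism A -> B} -> amb A -> amb B;
  pts : forall A : artAlg k, amb A -> Prop }.
Arguments fmap {k} f {A B} _ _ : rename.
Arguments pts {k} f {A} _ : rename.

Section Formal.
Variable k : fieldType.
Implicit Types F G : formal k.

Definition functorial F : Prop :=
  forall (A B : artAlg k) (f : {lrmorphism A -> B}) (x : amb F A),
    pts F x -> pts F (fmap F f x).

Definition morphism F G (Phi : forall A, amb F A -> amb G A) : Prop :=
  (forall A (x : amb F A), pts F x -> pts G (Phi A x)) /\
  (forall (A B : artAlg k) (f : {lrmorphism A -> B}) (x : amb F A),
     pts F x -> Phi B (fmap F f x) = fmap G f (Phi A x)).

Definition isomorphism F G (Phi : forall A, amb F A -> amb G A) : Prop :=
  morphism Phi /\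
  (forall A (y : amb G A), pts G y -> exists! x, pts F x /\ Phi A x = y).

(* Infinitesimal lifting criterion *)
Definition formally_smooth F G (Phi : forall A, amb F A -> amb G A) : Prop :=
  forall (A B : artAlg k) (f : {lrmorphism A -> B}),
    (forall b : B, exists a : A, f a = b) ->
  forall (x : amb F B) (y : amb G A),
    pts F x -> pts G y -> fmap G f y = Phi B x ->
  exists x' : amb F A, [/\ pts F x', fmap F f x' = x & Phi A x' = y].

(* Spf k[[t_1, ..., t_n]] *)
Definition Spf_series (n : nat) : formal k :=
  @Formal k (fun A => 'cV[A]_n) (fun A B f t => map_mx f t)
    (fun A t => forall i, nilp (t i 0)).

End Formal.

(* Basis of V = L_1 + ... + L_6 *)
Definition bX   := 0%N.  Definition bY   := 1%N.
Definition bZ0  := 2%N.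
Definition bZx  := 3%N.  Definition bZy  := 4%N.
Definition bZx2 := 5%N.  Definition bZxy := 6%N.  Definition bZy2 := 7%N.
Definition bZx3 := 8%N.  Definition bZx2y := 9%N.
Definition bZxy2 := 10%N. Definition bZy3 := 11%N.
Definition bT0  := 12%N. Definition bT1  := 13%N.

Definition deg (i : 'I_14) : nat :=
  nth 0%N [:: 1; 1; 2; 3; 3; 4; 4; 4; 5; 5; 5; 5; 6; 6]%N i.

(* Bilinear maps V x V -> V with coefficients in R, by their values on basis *)
(* vectors.                                                                  *)
Notation bilin R := {ffun 'I_14 * 'I_14 -> 'cV[R]_14}.

Definition bas (R : nzRingType) (i : 'I_14) : 'cV[R]_14 := delta_mx i 0.
Arguments bas {R} i.

Definition bval (R : comNzRingType) (b : bilin R) (u v : 'cV[R]_14) : 'cV[R]_14 :=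
  \sum_(i < 14) \sum_(j < 14) (u i 0 * v j 0) *: b (i, j).

Definition bmap (R R' : Type) (f : R -> R') (b : bilin R) : bilin R' :=
  [ffun p => map_mx f (b p)].

(* (i, j, l) in the table: [e_i, e_j] = e_l and [e_j, e_i] = - e_l *)
Definition of_table (t : seq (nat * nat * nat)) (R : nzRingType) : bilin R :=
  [ffun p : 'I_14 * 'I_14 => \col_(l < 14)
     (((p.1 : nat, p.2 : nat, l : nat) \in t)%:R
      - ((p.2 : nat, p.1 : nat, l : nat) \in t)%:R)].

Definition mu := of_table
  [:: (bX, bY, bZ0);
      (bX, bZ0, bZx); (bY, bZ0, bZy);
      (bX, bZx, bZx2); (bX, bZy, bZxy);
      (bY, bZx, bZxy); (bY, bZy, bZy2);
      (bX, bZx2, bZx3); (bX, bZxy, bZx2y); (bX, bZy2, bZxy2);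
      (bY, bZx2, bZx2y); (bY, bZxy, bZxy2); (bY, bZy2, bZy3);
      (bX, bZx3, bT0); (bX, bZx2y, bT1); (bX, bZy3, bT1);
      (bY, bZx3, bT1); (bY, bZxy2, bT1); (bY, bZy3, bT0)].
Arguments mu {R}.

Definition psi0 := of_table [:: (bX, bZx3, bT0)].
Definition psi1 := of_table [:: (bX, bZx2y, bT0); (bY, bZx3, bT0)].
Definition psi2 := of_table [:: (bX, bZxy2, bT0); (bY, bZx2y, bT0)].
Arguments psi0 {R}. Arguments psi1 {R}. Arguments psi2 {R}.

Definition pencil_motion (R : comNzRingType) (p : 'cV[R]_3) : bilin R :=
  [ffun q => mu q + p 0 0 *: psi0 q + p 1 0 *: psi1 q + p 2 0 *: psi2 q].

Section Laws.
Variable R : comUnitRingType.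
Implicit Types (b : bilin R) (h : 'M[R]_14).

(* Hom_0(Lambda^2 V, V); 2 is invertible throughout, so that skew-symmetric  *)
(* and alternating agree.                                                    *)
Definition graded_alt b : Prop :=
  (forall i j, b (i, j) = - b (j, i)) /\
  (forall i j l, deg l != (deg i + deg j)%N -> b (i, j) l 0 = 0).

Definition jacobi b : Prop := forall u v w : 'cV[R]_14,
  bval b u (bval b v w) + bval b v (bval b w u) + bval b w (bval b u v) = 0.

Definition graded_law b : Prop := graded_alt b /\ jacobi b.

Definition metabelian b : Prop := forall u v w z : 'cV[R]_14,
  bval b (bval b u v) (bval b w z) = 0.

Definition top_pair (d e : nat) : bool :=
  (d, e) \in [:: (2, 4); (4, 2); (3, 3)]%N.

(* Hom(L_2 (x) L_4, L_6) + Hom(Lambda^2 L_3, L_6), as a direct summand of    *)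
(* Hom_0(Lambda^2 V, V).                                                     *)
Definition in_top b : Prop :=
  graded_alt b /\
  (forall i j, ~~ top_pair (deg i) (deg j) -> b (i, j) = 0).

(* H(R) = prod_i GL(L_i)(R) *)
Definition grGL h : Prop :=
  h \in unitmx /\ (forall i j, deg i != deg j -> h i j = 0).

Definition carnot (c : R) : 'M[R]_14 := diag_mx (\row_i c ^+ deg i).

(* Equality in (H / T_Car)(R), for R local *)
Definition eq_modT (h h' : 'M[R]_14) : Prop :=
  exists2 c : R, c \is a GRing.unit & h' = carnot c *m h.

Definition act h b : bilin R :=
  [ffun p => h *m bval b (invmx h *m bas p.1) (invmx h *m bas p.2)].

Definition stab h : Prop := grGL h /\ act h mu = mu.

(* R-points of the formal completion of H at the identity, for R in [artAlg] *)
Definition hatH h : Prop :=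
  grGL h /\ (forall i j, nilp ((h - 1%:M) i j)).

Definition hatX b : Prop :=
  graded_law b /\ (forall p l, nilp ((b p - mu p) l 0)).

Definition hat_top b : Prop :=
  in_top b /\ (forall p l, nilp (b p l 0)).

End Laws.

Section Cohomology.
Variable k : fieldType.

Definition sym_part (b : bilin k) : bilin k :=
  [ffun p => b p + b (p.2, p.1)].

Definition part_outside (s : nat -> nat -> nat -> bool) (b : bilin k) : bilin k :=
  [ffun p => \col_l (b p l 0 *+ ~~ s (deg p.1) (deg p.2) (deg l))].

Definition offdeg (f : 'M[k]_14) : 'M[k]_14 :=
  \matrix_(i, j) (f i j *+ (deg i != deg j)).

Definition ce1 (f : 'M[k]_14) : bilin k :=
  [ffun p => bval mu (bas p.1) (f *m bas p.2) - bval mu (bas p.2) (f *m bas p.1)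
             - f *m mu p].

Definition ce2 (b : bilin k) : {ffun 'I_14 * 'I_14 * 'I_14 -> 'cV[k]_14} :=
  [ffun t => let u := bas t.1.1 in let v := bas t.1.2 in let w := bas t.2 in
     bval mu u (bval b v w) - bval mu v (bval b u w) + bval mu w (bval b u v)
     - bval b (bval mu u v) w + bval b (bval mu u w) v - bval b (bval mu v w) u].

Lemma bval_linear_fun (u v : 'cV[k]_14) : linear (fun b : bilin k => bval b u v).
Proof.
move=> c b b'; rewrite /bval scaler_sumr -big_split; apply: eq_bigr => i _.
rewrite scaler_sumr -big_split; apply: eq_bigr => j _ /=.
by rewrite !ffunE scalerDr !scalerA mulrC.
Qed.

Lemma bval_linear_r (b : bilin k) (u : 'cV[k]_14) : linear (bval b u).
Proof.
move=> c v w; rewrite /bval scaler_sumr -big_split; apply: eq_bigr => i _.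
rewrite scaler_sumr -big_split; apply: eq_bigr => j _ /=.
by rewrite !mxE mulrDr scalerDl scalerA mulrCA.
Qed.

Lemma linear3 c (x y z x' y' z' : 'cV[k]_14) :
  c *: x + x' - (c *: y + y') - (c *: z + z') = c *: (x - y - z) + (x' - y' - z').
Proof. by apply/colP=> l; rewrite !mxE; ring. Qed.

Lemma linear6 c (x y z u v w x' y' z' u' v' w' : 'cV[k]_14) :
  c *: x + x' - (c *: y + y') + (c *: z + z')
  - (c *: u + u') + (c *: v + v') - (c *: w + w')
  = c *: (x - y + z - u + v - w) + (x' - y' + z' - u' + v' - w').
Proof. by apply/colP=> l; rewrite !mxE; ring. Qed.

Lemma sym_part_is_linear : linear sym_part.
Proof.
by move=> c b b'; apply/ffunP=> p; rewrite !ffunE scalerDr addrACA.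
Qed.
HB.instance Definition _ :=
  GRing.isLinear.Build k (bilin k) (bilin k) *:%R sym_part sym_part_is_linear.

Lemma part_outside_is_linear s : linear (part_outside s).
Proof.
move=> c b b'; apply/ffunP=> p; apply/colP=> l.
by rewrite !(ffunE, mxE) mulrnDl mulrnAr.
Qed.
HB.instance Definition _ s :=
  GRing.isLinear.Build k (bilin k) (bilin k) *:%R (part_outside s)
    (part_outside_is_linear s).

Lemma offdeg_is_linear : linear offdeg.
Proof. by move=> c f g; apply/matrixP=> i j; rewrite !mxE mulrnDl mulrnAr. Qed.
HB.instance Definition _ :=
  GRing.isLinear.Build k 'M[k]_14 'M[k]_14 *:%R offdeg offdeg_is_linear.

Lemma ce1_is_linear : linear ce1.
Proof.
move=> c f g; apply/ffunP=> p; rewrite !ffunE !mulmxDl -!scalemxAl.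
rewrite !bval_linear_r; exact: linear3.
Qed.
HB.instance Definition _ :=
  GRing.isLinear.Build k 'M[k]_14 (bilin k) *:%R ce1 ce1_is_linear.

Lemma ce2_is_linear : linear ce2.
Proof.
move=> c b b'; apply/ffunP=> t; rewrite !ffunE /=.
rewrite !bval_linear_fun !bval_linear_r; exact: linear6.
Qed.
HB.instance Definition _ :=
  GRing.isLinear.Build k (bilin k) {ffun 'I_14 * 'I_14 * 'I_14 -> 'cV[k]_14}
    *:%R ce2 ce2_is_linear.

Definition C1_0 : {vspace 'M[k]_14} := lker (linfun offdeg).

Definition C2_0 : {vspace bilin k} :=
  (lker (linfun sym_part) :&:
   lker (linfun (part_outside (fun d e l => l == (d + e)%N))))%VS.

Definition Z2_0 : {vspace bilin k} := (C2_0 :&: lker (linfun ce2))%VS.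

Definition B2_0 : {vspace bilin k} := (linfun ce1 @: C1_0)%VS.

Definition E_top : {vspace bilin k} :=
  (C2_0 :&: lker (linfun (part_outside (fun d e _ => top_pair d e))))%VS.

(* The preimage in Z^2_0 of the pencil-motion tangent P in H^2_0 *)
Definition P_B2 : {vspace bilin k} := (<<[:: psi0; psi1; psi2]>> + B2_0)%VS.

Lemma C1_0P (f : 'M[k]_14) :
  f \in C1_0 <-> (forall i j, deg i != deg j -> f i j = 0).
Proof.
rewrite memv_ker lfunE /=; split=> [/eqP/matrixP e i j d|e].
  by have := e i j; rewrite !mxE d.
by apply/eqP/matrixP=> i j; rewrite !mxE; case: eqVneq => // /e ->.
Qed.

Lemma C2_0P (b : bilin k) : b \in C2_0 <-> graded_alt b.
Proof.
rewrite memv_cap !memv_ker !lfunE /=; split.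
  case/andP=> /eqP/ffunP s /eqP/ffunP g; split=> [i j|i j l d].
    by apply/eqP; rewrite -addr_eq0; have /= := s (i, j); rewrite !ffunE => ->.
  by have /colP/(_ l) := g (i, j); rewrite !(ffunE, mxE) /= d.
case=> s g; apply/andP; split; apply/eqP/ffunP=> -[i j]; rewrite !ffunE /=.
  by rewrite s addNr.
by apply/colP=> l; rewrite !mxE; case: eqVneq => // /g ->.
Qed.

Lemma E_topP (b : bilin k) : b \in E_top <-> in_top b.
Proof.
rewrite memv_cap; split.
  case/andP=> /C2_0P s; rewrite memv_ker lfunE => /eqP/ffunP g; split=> // i j d.
  by apply/colP=> l; have /colP/(_ l) := g (i, j); rewrite !(ffunE, mxE) /= d.
case=> /C2_0P -> g; rewrite memv_ker lfunE; apply/eqP/ffunP=> -[i j].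
apply/colP=> l; rewrite !(ffunE, mxE) /=.
by case: (boolP (top_pair _ _)) => // /g ->; rewrite mxE.
Qed.

Lemma Z2_0P (b : bilin k) : b \in Z2_0 <-> graded_alt b /\ ce2 b = 0.
Proof.
rewrite memv_cap memv_ker lfunE; split=> [/andP[/C2_0P ? /eqP]|] //.
by case=> /C2_0P -> /= ->.
Qed.

Lemma B2_0P (b : bilin k) :
  b \in B2_0 <-> exists2 f : 'M[k]_14, (forall i j, deg i != deg j -> f i j = 0) & b = ce1 f.
Proof.
split=> [/memv_imgP[f /C1_0P fd ->]|[f /C1_0P fd ->]].
  by exists f; rewrite ?lfunE.
by apply/memv_imgP; exists f; rewrite ?lfunE.
Qed.

End Cohomology.
Arguments C1_0 {k}. Arguments C2_0 {k}. Arguments Z2_0 {k}. Arguments B2_0 {k}.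
Arguments E_top {k}. Arguments P_B2 {k}.

Section Slice.
Variable k : fieldType.

Definition subfunctor := forall A : artAlg k, bilin A -> Prop.

Definition locus (S : subfunctor) : formal k :=
  @Formal k (fun A => bilin A) (fun A B f b => bmap f b) S.

Definition Ehat : formal k := locus (fun A b => hat_top b).

Definition eps_part (phi : bilin k) : bilin (dual k) :=
  bmap (fun c : k => c *: eps k) phi.

Definition first_order (phi : bilin k) : bilin (dual k) := mu + eps_part phi.

Definition tangent (S : subfunctor) (phi : bilin k) : Prop :=
  S (dual k) (first_order phi).

(* K-stability is required for all points of the group scheme K.  That S is  *)
(* a closed formal subscheme need not be assumed: by [slice_action] it is    *)
(* the fibre at e of a morphism from hatX_mu to the completion of H / T_Car. *)
Record effective_slice (S : subfunctor) : Prop := {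
  slice_sub : forall (A : artAlg k) (b : bilin A), S A b -> hatX b;
  slice_functorial : functorial (locus S);
  slice_stable : forall (A : artAlg k) (h : 'M[A]_14) (b : bilin A),
    stab h -> S A b -> S A (act h b);
  slice_tangent : exists U : {vspace bilin k},
    [/\ forall phi, phi \in U <-> tangent S phi,
        (U + B2_0)%VS = Z2_0 & (U :&: B2_0)%VS = 0%VS];
  slice_action : forall (A : artAlg k) (b : bilin A), hatX b ->
    exists (h : 'M[A]_14) (s : bilin A),
      [/\ hatH h, S A s, act h s = b &
          forall (h' : 'M[A]_14) (s' : bilin A),
            hatH h' -> S A s' -> act h' s' = b -> eq_modT h h' /\ s' = s] }.

Definition is_local (A : unitRingType) : Prop :=
  forall x : A, x \is a GRing.unit \/ 1 - x \is a GRing.unit.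

(* The group scheme K = Stab_(H / T_Car)(mu) is the constant group V_4: on   *)
(* local k-algebras A one has (H / T_Car)(A) = H(A) / T_Car(A), and the      *)
(* A-points of the constant group are the elements of V_4.                   *)
Definition stab_eff_V4 : Prop :=
  exists sigma : 'Z_2 * 'Z_2 -> 'M[k]_14,
    [/\ forall g, stab (sigma g),
        forall g g', eq_modT (sigma g *m sigma g') (sigma (g + g')) &
        forall A : comUnitAlgType k, is_local A ->
          forall h : 'M[A]_14, stab h ->
            exists! g, eq_modT (map_mx (in_alg A) (sigma g)) h].

Section Theta.
Variables (S : subfunctor) (Theta : forall A : artAlg k, bilin A -> bilin A).
Arguments Theta {A} _.

Definition zero_fiber : subfunctor := fun A b => S b /\ Theta b = 0.

Definition metabelian_locus : subfunctor := fun A b => S b /\ metabelian b.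

Definition equivariant : Prop :=
  forall (A : artAlg k) (h : 'M[A]_14) (b : bilin A),
    stab h -> S b -> Theta (act h b) = act h (Theta b).

(* For a formally smooth morphism, the dimension of the relative tangent     *)
(* space at the closed point.                                                *)
Definition relative_dimension (n : nat) : Prop :=
  exists2 U : {vspace bilin k}, \dim U = n &
    forall phi, phi \in U <-> tangent S phi /\ Theta (first_order phi) = 0.

(* The classifying map sends p to the slice component of the law             *)
(* mu + p_1 psi0 + p_2 psi1 + p_3 psi2.                                      *)
Definition classifying_map (cl : forall A : artAlg k, 'cV[A]_3 -> bilin A) : Prop :=
  morphism (F := Spf_series k 3) (G := locus S) cl /\
  (forall (A : artAlg k) (p : 'cV[A]_3), (forall i, nilp (p i 0)) ->
     exists2 h : 'M[A]_14, hatH h & act h (cl A p) = pencil_motion p).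

(* [D] restricted to Z^2_0 induces the tangent map of Theta on               *)
(* H^2_0 = Z^2_0 / B^2_0, identified with the tangent space of S.            *)
Definition differential (D : 'Hom(bilin k, bilin k)) : Prop :=
  (forall phi, tangent S phi -> Theta (first_order phi) = eps_part (D phi)) /\
  (forall phi, phi \in B2_0 -> D phi = 0).

End Theta.
End Slice.

(* Main.v *)
(** A law near mu is put in normal form by keeping its brackets into L_2, L_3, L_4
    and those of X and Y with L_5 equal to those of mu.  Since (ad X, ad Y) identifies
    L_5 with Hom(L_1, L_6), the Jacobi identities then become linear and are solved
    by an explicit family [fam t = mu + pert t], t in affine 11-space, which is stable
    under the Klein four-group.  At first order [pert] spans a complement of B^2_0 in Z^2_0.
    Lifting along small extensions of Artinian algebras, every law in the formal
    neighbourhood of mu is carried by the formal group to exactly one member of the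
    family, so t is a system of coordinates on any slice S.

    Theta sends a point of S to the Hom(L_2 (x) L_4, L_6) + Hom(Lambda^2 L_3, L_6)
    part of its normal form, not of the point itself: in the coordinates t it is the
    projection onto the last eight, whence smoothness; it is equivariant because the
    family is stable.  The zero fibre, with coordinates q = (t_1, t_2, t_3), consists
    of the metabelian laws and is gauge equivalent to the pencil motion with p_0 (1 - q_0) = 2 q_0,
    p_1 (1 - q_0) = 2 q_1, p_2 (1 - q_0) = q_2.

    An automorphism is determined by its restriction to L_1, which preserves the
    pencil of quartics; over a local ring with 2 invertible this leaves a scalar
    times one of (x, y), (-x, y), (y, x), (y, -x). *)
Require Import Defs.
From HB Require Import structures.
From mathcomp Require Import all_boot all_order all_algebra.
From mathcomp Require Import qpoly perm ring.
From Stdlib Require Import Classical ClassicalEpsilon.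
Import GRing.Theory.
Local Open Scope ring_scope.

Set Implicit Arguments.
Unset Strict Implicit.
Unset Printing Implicit Defensive.

(** That [pert] spans a complement of B^2_0 is obtained by a count rather than by reducing a general
    cocycle. A cocycle is determined by 48 of its coordinates; the degree-zero endomorphisms form a
    space of dimension 38, on which the coboundary map kills only the multiples of the grading
    derivation; and 11 + (38 - 1) = 48.

    The quartic relations are derived once, over any commutative ring, for maps from mu to a
    metabelian member of the family. At q = 0 over a local ring they classify the automorphisms.
    Over the dual numbers they show that no nonzero metabelian direction is a coboundary and that
    the infinitesimal automorphisms are the multiples of the grading derivation.

    This last fact shapes the uniqueness argument: the normalising group element is defined only up
    to the Carnot torus, so at each small extension it is corrected by a torus element before the
    induction goes on. *)

Local Notation nilp := Defs.nilp.

(** * Bilinear brackets and tables of structure constants *)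

Section Bilinear.
Variable R : comNzRingType.
Implicit Types (b : bilin R) (u v w : 'cV[R]_14).

Lemma bval_is_linear b u : linear (bval b u).
Proof.
move=> c v w; rewrite /bval scaler_sumr -big_split; apply: eq_bigr => i _.
rewrite scaler_sumr -big_split; apply: eq_bigr => j _ /=.
by rewrite !mxE mulrDr scalerDl scalerA mulrCA.
Qed.
HB.instance Definition _ b u :=
  GRing.isLinear.Build R _ _ _ (bval b u) (bval_is_linear b u).

Lemma bval_linearl b v : linear (bval b ^~ v).
Proof.
move=> c u w; rewrite /bval scaler_sumr -big_split; apply: eq_bigr => i _.
rewrite scaler_sumr -big_split; apply: eq_bigr => j _ /=.
by rewrite !mxE mulrDl scalerDl scalerA mulrA.
Qed.

Lemma bvalDl b u w v : bval b (u + w) v = bval b u v + bval b w v.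
Proof. by have := bval_linearl b v 1 u w; rewrite !scale1r. Qed.

Lemma bvalZl b c u v : bval b (c *: u) v = c *: bval b u v.
Proof.
have h0: bval b 0 v = 0.
  by apply: (addrI (bval b 0 v)); rewrite -bvalDl !addr0.
by have := bval_linearl b v c u 0; rewrite /= h0 !addr0.
Qed.

Lemma bval0l b v : bval b 0 v = 0.
Proof. by have := bvalZl b 0 0 v; rewrite !scale0r. Qed.

Lemma bilinDE b b' p : (b + b') p = b p + b' p.
Proof. by rewrite ffunE. Qed.

Lemma bilinZE c b p : (c *: b) p = c *: b p.
Proof. by rewrite ffunE. Qed.

Lemma bvalZf c b u v : bval (c *: b) u v = c *: bval b u v.
Proof.
rewrite /bval !scaler_sumr; apply: eq_bigr => i _; rewrite scaler_sumr.
by apply: eq_bigr => j _; rewrite bilinZE !scalerA mulrC.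
Qed.

Lemma bval_addf b b' u v : bval (b + b') u v = bval b u v + bval b' u v.
Proof.
rewrite /bval -big_split; apply: eq_bigr => i _.
by rewrite -big_split; apply: eq_bigr => j _ /=; rewrite ffunE scalerDr.
Qed.

Lemma bval_bas b i j : bval b (bas i) (bas j) = b (i, j).
Proof.
rewrite /bval (bigD1 i) //= (bigD1 j) //= !mxE !eqxx mulr1 scale1r.
rewrite big1 ?addr0 => [|j' /negPf ne].
  rewrite big1 ?addr0 // => i' /negPf ne; rewrite big1 // => j' _.
  by rewrite mxE ne mul0r scale0r.
by rewrite !mxE ne mulr0 scale0r.
Qed.

Lemma col_bas u : u = \sum_i u i 0 *: bas i.
Proof.
apply/colP=> i; rewrite summxE (bigD1 i) //= !mxE eqxx mulr1 big1 ?addr0 //.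
by move=> j /negPf ne; rewrite !mxE eq_sym ne mulr0.
Qed.

Lemma bilin_ext (F G : 'cV[R]_14 -> 'cV[R]_14 -> 'cV[R]_14) :
    (forall v, linear (F ^~ v)) -> (forall u, linear (F u)) ->
    (forall v, linear (G ^~ v)) -> (forall u, linear (G u)) ->
    (forall i j, F (bas i) (bas j) = G (bas i) (bas j)) ->
  forall u v, F u v = G u v.
Proof.
have lin_ext (f g : 'cV[R]_14 -> 'cV[R]_14) : linear f -> linear g ->
    (forall i, f (bas i) = g (bas i)) -> f =1 g.
  move=> lf lg e u.
  pose f' := GRing.isLinear.Build R _ _ _ f lf.
  pose g' := GRing.isLinear.Build R _ _ _ g lg.
  pose F' := HB.pack_for {linear 'cV[R]_14 -> 'cV[R]_14} f f'.
  pose G' := HB.pack_for {linear 'cV[R]_14 -> 'cV[R]_14} g g'.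
  rewrite -[f u]/(F' u) -[g u]/(G' u) (col_bas u) !linear_sum.
  by apply: eq_bigr => i _; rewrite !linearZ /= e.
move=> Fl Fr Gl Gr e u v; apply: (lin_ext (F ^~ v) (G ^~ v)) => // i.
by apply: lin_ext => // j; apply: e.
Qed.

Lemma bvalP b b' : (forall u v, bval b u v = bval b' u v) -> b = b'.
Proof. by move=> e; apply/ffunP=> -[i j]; rewrite -!bval_bas. Qed.

End Bilinear.

(** Stated for predicates on naturals, so that each case has a literal index on which tables and
    lists reduce by computation. *)
Lemma lt14P (P : nat -> Prop) :
  P 0%N -> P 1%N -> P 2%N -> P 3%N -> P 4%N -> P 5%N -> P 6%N -> P 7%N ->
  P 8%N -> P 9%N -> P 10%N -> P 11%N -> P 12%N -> P 13%N ->
  forall n, (n < 14)%N -> P n.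
Proof. by move=> ? ? ? ? ? ? ? ? ? ? ? ? ? ?; do 14! [case=> [//|]]. Qed.

Section Sparse.
Variable R : comUnitRingType.
Implicit Types (u v w : 'cV[R]_14) (s : seq (nat * nat * nat * R)).

(** Natural indices let [terms_bracket] compare positions by computation, which ordinals built by
    [inord] would block. *)
Definition co u (n : nat) : R := u (inord n) 0.

Lemma coP u v : (forall n, (n < 14)%N -> co u n = co v n) -> u = v.
Proof.
by move=> e; apply/colP=> i; have := e i (ltn_ord i); rewrite /co inord_val.
Qed.

(* The quadruple (i, j, l, c) contributes c e_l to [e_i, e_j]. *)
Definition of_terms s : bilin R :=
  [ffun p : 'I_14 * 'I_14 => \col_(l < 14)
     \sum_(x <- s) x.2 * (((p.1 : nat, p.2 : nat, l : nat) == x.1)%:R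
        - ((p.2 : nat, p.1 : nat, l : nat) == x.1)%:R)].

Fixpoint terms_bracket s u v (m : nat) : R :=
  if s is (i, j, l, c) :: s' then
    if l == m then
     (c * (co u i * co v j - co u j * co v i)) + terms_bracket s' u v m
    else terms_bracket s' u v m
  else 0.

Definition term_ok (x : nat * nat * nat * R) :=
  [&& x.1.1.1 < 14, x.1.1.2 < 14 & x.1.2 < 14]%N.

Lemma co_bas (i : 'I_14) n : (n < 14)%N -> co (bas i) n = (i == n :> nat)%:R.
Proof.
move=> nP; rewrite /co mxE eqxx andbT; congr (_%:R).
by rewrite -val_eqE /= inordK // eq_sym.
Qed.

(** For a concrete table and a literal m the right side reduces to a polynomial in the coordinates
    of u and v; identities between brackets thus become goals for [ring]. *)
Lemma co_bval s u v m : all term_ok s -> (m < 14)%N ->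
  co (bval (of_terms s) u v) m = terms_bracket s u v m.
Proof.
move=> sP mP; pose F u v := \sum_(x <- s)
  (x.2 * (co u x.1.1.1 * co v x.1.1.2 - co u x.1.1.2 * co v x.1.1.1)) *: bas (inord x.1.2).
have -> : bval (of_terms s) u v = F u v.
  apply: bilin_ext => [w|w|w|w|i j].
  - exact: bval_linearl.
  - exact: bval_is_linear.
  - move=> c y z; rewrite /F scaler_sumr -big_split; apply: eq_bigr => x _ /=.
    by rewrite scalerA -scalerDl /co !mxE; congr (_ *: _); ring.
  - move=> c y z; rewrite /F scaler_sumr -big_split; apply: eq_bigr => x _ /=.
    by rewrite scalerA -scalerDl /co !mxE; congr (_ *: _); ring.
  rewrite bval_bas ffunE; apply/colP=> l; rewrite mxE /F summxE big_seq [RHS]big_seq.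
  apply: eq_bigr => -[[[i' j'] l'] c] /(allP sP)/and3P[/= iP jP lP].
  rewrite !co_bas // !mxE /= eqxx andbT !xpair_eqE.
  rewrite -(inj_eq val_inj) /= inordK // (eq_sym (l : nat) l').
  case: (l' == l :> nat); case: (i == i' :> nat); case: (j == j' :> nat);
    case: (i == j' :> nat); case: (j == i' :> nat) => /=; ring.
rewrite /F /co summxE {F}; elim: s sP => [|[[[i j] l] c] s IHs] /=; first by rewrite big_nil.
case/andP=> /and3P[/= _ _ lP] sP; rewrite big_cons /= IHs // !mxE eqxx andbT.
rewrite -(inj_eq val_inj) /= !inordK // eq_sym.
by case: (l == m); rewrite ?mulr1 // mulr0 add0r.
Qed.

End Sparse.

Section Vec.
Variable R : comUnitRingType.

Definition vec (s : seq R) : 'cV[R]_14 := \col_i s`_i.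

Lemma co_vec s n : (n < 14)%N -> co (vec s) n = s`_n.
Proof. by move=> nP; rewrite /co mxE inordK. Qed.

Lemma bilin_coP (b b' : bilin R) :
  (forall u v n, (n < 14)%N -> co (bval b u v) n = co (bval b' u v) n) -> b = b'.
Proof. by move=> e; apply: bvalP => u v; apply: coP => n /e. Qed.

Lemma coD (u v : 'cV[R]_14) n : co (u + v) n = co u n + co v n.
Proof. by rewrite /co mxE. Qed.

Lemma coN (u : 'cV[R]_14) n : co (- u) n = - co u n.
Proof. by rewrite /co mxE. Qed.

Lemma coZ c (u : 'cV[R]_14) n : co (c *: u) n = c * co u n.
Proof. by rewrite /co mxE. Qed.

Lemma co0 n : co (0 : 'cV[R]_14) n = 0.
Proof. by rewrite /co mxE. Qed.

Lemma of_terms_anti (s : seq (nat * nat * nat * R)) i j :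
  of_terms s (i, j) = - of_terms s (j, i).
Proof.
rewrite !ffunE; apply/colP=> l; rewrite !mxE -sumrN; apply: eq_bigr => x _ /=.
by rewrite -mulrN opprB.
Qed.

(** The function [deg] on naturals, where it reduces on literals. *)
Definition wt (n : nat) : nat :=
  nth 0%N [:: 1; 1; 2; 3; 3; 4; 4; 4; 5; 5; 5; 5; 6; 6]%N n.

Lemma of_terms_graded (s : seq (nat * nat * nat * R)) :
  all (fun x => wt x.1.2 == wt x.1.1.1 + wt x.1.1.2)%N s -> graded_alt (of_terms s).
Proof.
move=> sP; split=> [i j|i j l dl]; first exact: of_terms_anti.
rewrite ffunE mxE big_seq big1 // => -[x c] /(allP sP) /= /eqP dP.
have ne p q : (wt p + wt q = deg i + deg j)%N -> ((p, q, l : nat) == x) = false.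
  move=> e; apply/negP=> /eqP ex; move/eqP: dl; apply; move: dP; rewrite -ex /= e.
  move=> <-.
  by rewrite /deg.
by rewrite !ne ?subrr ?mulr0 //; rewrite addnC.
Qed.

Lemma of_terms_cat (s s' : seq (nat * nat * nat * R)) :
  of_terms (s ++ s') = of_terms s + of_terms s'.
Proof.
apply/ffunP=> p; rewrite [RHS]ffunE !ffunE; apply/colP=> l.
by rewrite !mxE big_cat.
Qed.

(** Membership counts an entry once, the sum counts it with multiplicity; hence [uniq]. *)
Lemma of_tableE (t : seq (nat * nat * nat)) : uniq t ->
  of_table t R = of_terms [seq (x, 1) | x <- t].
Proof.
move=> ut; apply/ffunP=> -[i j]; rewrite !ffunE; apply/colP=> l; rewrite !mxE big_map /=.
have E (y : nat * nat * nat) : (y \in t)%:R = \sum_(x <- t) (y == x)%:R :> R.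
  rewrite -natr_sum -count_uniq_mem // -sum1_count; congr (_%:R).
  by rewrite [LHS]big_mkcond; apply: eq_bigr => x _ /=; rewrite eq_sym; case: (y == x).
by rewrite !E -sumrB; apply: eq_bigr => x _; rewrite mul1r.
Qed.

End Vec.

(** * The explicit family of laws *)

Section Family.
Variable R : comUnitRingType.

(* The element r of L_5 with [X, r] = a0 T_0 + a1 T_1 and [Y, r] = b0 T_0 + b1 T_1. *)
Definition L5_terms (i j : nat) (a0 a1 b0 b1 : R) : seq (nat * nat * nat * R) :=
  [:: (i, j, bZx3, a0); (i, j, bZx2y, a1 - b0); (i, j, bZxy2, b1 - a0);
      (i, j, bZy3, b0)].

Definition mu_terms : seq (nat * nat * nat * R) :=
  [:: (bX, bY, bZ0, 1);
      (bX, bZ0, bZx, 1); (bY, bZ0, bZy, 1);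
      (bX, bZx, bZx2, 1); (bX, bZy, bZxy, 1);
      (bY, bZx, bZxy, 1); (bY, bZy, bZy2, 1);
      (bX, bZx2, bZx3, 1); (bX, bZxy, bZx2y, 1); (bX, bZy2, bZxy2, 1);
      (bY, bZx2, bZx2y, 1); (bY, bZxy, bZxy2, 1); (bY, bZy2, bZy3, 1);
      (bX, bZx3, bT0, 1); (bX, bZx2y, bT1, 1); (bX, bZy3, bT1, 1);
      (bY, bZx3, bT1, 1); (bY, bZxy2, bT1, 1); (bY, bZy3, bT0, 1)].

Lemma muE : mu = of_terms mu_terms.
Proof. by rewrite /mu of_tableE //; reflexivity. Qed.

(* q moves the quartic of T_0, while (u, 2 v, w) and z are the values on Z_0 times
   (Z_{x^2}, Z_{xy}, Z_{y^2}) and on (Z_x, Z_y); the remaining entries are forced. *)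
Definition fam_terms (t : 'cV[R]_11) : seq (nat * nat * nat * R) :=
  let q0 := t (inord 0) 0 in let q1 := t (inord 1) 0 in let q2 := t (inord 2) 0 in
  let u0 := t (inord 3) 0 in let u1 := t (inord 4) 0 in
  let v0 := t (inord 5) 0 in let v1 := t (inord 6) 0 in
  let w0 := t (inord 7) 0 in let w1 := t (inord 8) 0 in
  let z0 := t (inord 9) 0 in let z1 := t (inord 10) 0 in
  L5_terms bX bZx2 q0 0 (q1 - u0) (- u1) ++
  L5_terms bY bZx2 q1 0 (q2 + z0 - 3 * v0) (z1 - 3 * v1) ++
  L5_terms bX bZxy (q1 + u0) u1 (q2 - v0) (- v1) ++
  L5_terms bY bZxy (q2 + v0) v1 (- q1 - w0) (- w1) ++
  L5_terms bX bZy2 (q2 + 3 * v0 + z0) (3 * v1 + z1) (- q1) 0 ++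
  L5_terms bY bZy2 (w0 - q1) w1 (- q0) 0 ++
  L5_terms bZ0 bZx u0 u1 (2 * v0 - z0) (2 * v1 - z1) ++
  L5_terms bZ0 bZy (2 * v0 + z0) (2 * v1 + z1) w0 w1 ++
  [:: (bZ0, bZx2, bT0, u0); (bZ0, bZx2, bT1, u1);
      (bZ0, bZxy, bT0, 2 * v0); (bZ0, bZxy, bT1, 2 * v1);
      (bZ0, bZy2, bT0, w0); (bZ0, bZy2, bT1, w1);
      (bZx, bZy, bT0, z0); (bZx, bZy, bT1, z1)].

Definition pert t : bilin R := of_terms (fam_terms t).
Definition fam t : bilin R := mu + pert t.

Lemma famE t : fam t = of_terms (mu_terms ++ fam_terms t).
Proof. by rewrite of_terms_cat -muE. Qed.

Lemma pert_linear c (s t : 'cV[R]_11) : pert (c *: s + t) = c *: pert s + pert t.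
Proof.
apply: bilin_coP => u v n nP; rewrite bval_addf coD co_bval //.
rewrite bvalZf coZ !co_bval //; move: n nP; apply: lt14P; rewrite /= ?mxE; ring.
Qed.

Lemma famD t x (s : 'cV[R]_11) p : fam (t + x *: s) p = fam t p + x *: pert s p.
Proof. by rewrite /fam (addrC t) pert_linear !bilinDE bilinZE addrCA addrC. Qed.

Lemma fam_graded t : graded_alt (fam t).
Proof. by rewrite famE; apply: of_terms_graded. Qed.

(** The perturbation takes values in L_5 + L_6 and vanishes as soon as an argument lies there, so it
    composes to zero with itself. The Jacobi identity has no term quadratic in t, and first-order
    solutions are exact ones. *)
Lemma fam_law t : graded_law (fam t).
Proof.
split=> [|u v w]; first exact: fam_graded.
rewrite famE; apply: coP => n nP; rewrite !coD co0 !co_bval //.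
move: n nP; apply: lt14P; rewrite /= ?co_bval //=; ring.
Qed.

End Family.

(** * Intertwiners and the quartic relations *)

Section Intertwiners.
Variable R : comUnitRingType.
Implicit Types (h : 'M[R]_14) (b : bilin R).

Definition be (n : nat) : 'cV[R]_14 := bas (inord n).

Lemma co_be m n : (m < 14)%N -> (n < 14)%N -> co (be m) n = (m == n)%:R.
Proof. by move=> mP nP; rewrite co_bas // inordK. Qed.

Definition mu_table := [seq x.1 | x <- mu_terms R].

Lemma mu_be i j l : (i, j, l) \in mu_table -> bval mu (be i) (be j) = be l.
Proof.
move=> ijl; apply: coP => n nP; rewrite muE co_bval //.
by move: ijl; rewrite !inE; do ?case/orP; case/eqP=> -> -> ->;
  move: n nP; apply: lt14P; rewrite /= ?co_be //=; ring.
Qed.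

(** Unlike [act], this contains no inverse matrix, so it can be checked on coordinates; [actP]
    compares the two. *)
Definition intertw h b b' := forall u v, h *m bval b u v = bval b' (h *m u) (h *m v).

(** The other eight coordinates are the default value 0 of [nth]. *)
Definition metab (q0 q1 q2 : R) : 'cV[R]_11 := \col_i [:: q0; q1; q2]`_i.

(* The functional T_0^* on the quartic with coefficients k4, ..., k0. *)
Definition quartic_T0 (q0 q1 q2 k4 k3 k2 k1 k0 : R) :=
  k4 * (1 + q0) + k3 * q1 + k2 * q2 - k1 * q1 + k0 * (1 - q0).

Section Quartics.
Variables (h : 'M[R]_14) (q0 q1 q2 a b c d : R).
Hypothesis hI : intertw h mu (fam (metab q0 q1 q2)).
Hypotheses (hX : h *m be bX = vec [:: a; c]) (hY : h *m be bY = vec [:: b; d]).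

Let D := a * d - b * c.

Lemma intertw_step i j l s t r : (i, j, l) \in mu_table ->
  h *m be i = vec s -> h *m be j = vec t ->
  (forall n, (n < 14)%N ->
    terms_bracket (mu_terms R ++ fam_terms (metab q0 q1 q2)) (vec s) (vec t) n = r`_n) ->
  h *m be l = vec r.
Proof.
move=> ijl hi hj e; rewrite -(mu_be ijl) hI hi hj famE.
by apply: coP => n nP; rewrite co_bval // co_vec // e.
Qed.

Ltac step H1 H2 := apply: (intertw_step _ H1 H2) => //; apply: lt14P;
  rewrite /= ?co_vec //= ?mxE ?inordK //= /D; ring.

Lemma hZ0 : h *m be bZ0 = vec [:: 0; 0; D].
Proof. by step hX hY. Qed.
Lemma hZx : h *m be bZx = vec [:: 0; 0; 0; D * a; D * c].
Proof. by step hX hZ0. Qed.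
Lemma hZy : h *m be bZy = vec [:: 0; 0; 0; D * b; D * d].
Proof. by step hY hZ0. Qed.
Lemma hZx2 : h *m be bZx2 =
  vec [:: 0; 0; 0; 0; 0; D * a ^+ 2; D * (2 * a * c); D * c ^+ 2].
Proof. by step hX hZx. Qed.
Lemma hZxy : h *m be bZxy =
  vec [:: 0; 0; 0; 0; 0; D * (a * b); D * (a * d + b * c); D * (c * d)].
Proof. by step hX hZy. Qed.
Lemma hZy2 : h *m be bZy2 =
  vec [:: 0; 0; 0; 0; 0; D * b ^+ 2; D * (2 * b * d); D * d ^+ 2].
Proof. by step hY hZy. Qed.

(** The double bracket depends only on the quartic (p0 x + p1 y)(s0 x + s1 y)(z0 x^2 + z1 xy + z2
    y^2); the arguments of [quartic_T0] are its coefficients. *)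
Lemma fam_L4 p0 p1 s0 s1 z0 z1 z2 :
  let f := fam (metab q0 q1 q2) in
  let k3 := p1 * s0 * z0 + p0 * s1 * z0 + p0 * s0 * z1 in
  let k1 := p1 * s1 * z1 + (p1 * s0 + p0 * s1) * z2 in
  let r := bval f (vec [:: p0; p1])
    (bval f (vec [:: s0; s1]) (vec [:: 0; 0; 0; 0; 0; z0; z1; z2])) in
  co r bT0 = quartic_T0 q0 q1 q2 (p0 * s0 * z0) k3
    (p1 * s1 * z0 + (p1 * s0 + p0 * s1) * z1 + p0 * s0 * z2) k1 (p1 * s1 * z2) /\
  co r bT1 = k3 + k1.
Proof.
by rewrite /= famE; split; rewrite !co_bval //= !co_bval //= !co_vec //= !mxE !inordK //= /quartic_T0; ring.
Qed.

(** In the algebra of mu the monomials satisfy x^4 = y^4, x^3 y = x y^3 and x^2 y^2 = 0 in L_6.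
    Applying h substitutes ax + cy for x and bx + dy for y and multiplies by D, its action on Z_0;
    each relation is read in the coordinates T_0 and T_1, and D is cancelled. *)
Lemma quartic_eqs : D \is a GRing.unit ->
  [/\ quartic_T0 q0 q1 q2 (a ^+ 4) (4 * a ^+ 3 * c) (6 * a ^+ 2 * c ^+ 2) (4 * a * c ^+ 3) (c ^+ 4)
      = quartic_T0 q0 q1 q2 (b ^+ 4) (4 * b ^+ 3 * d) (6 * b ^+ 2 * d ^+ 2) (4 * b * d ^+ 3) (d ^+ 4),
      4 * a * c * (a ^+ 2 + c ^+ 2) = 4 * b * d * (b ^+ 2 + d ^+ 2) &
   [/\ quartic_T0 q0 q1 q2 (a ^+ 3 * b) (a ^+ 3 * d + 3 * a ^+ 2 * b * c)
        (3 * a ^+ 2 * c * d + 3 * a * b * c ^+ 2) (3 * a * c ^+ 2 * d + b * c ^+ 3) (c ^+ 3 * d)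
      = quartic_T0 q0 q1 q2 (b ^+ 3 * a) (b ^+ 3 * c + 3 * b ^+ 2 * a * d)
        (3 * b ^+ 2 * d * c + 3 * b * a * d ^+ 2) (3 * b * d ^+ 2 * c + a * d ^+ 3) (d ^+ 3 * c),
      a ^+ 3 * d + 3 * a ^+ 2 * b * c + 3 * a * c ^+ 2 * d + b * c ^+ 3
      = b ^+ 3 * c + 3 * b ^+ 2 * a * d + 3 * b * d ^+ 2 * c + a * d ^+ 3,
      quartic_T0 q0 q1 q2 (a ^+ 2 * b ^+ 2) (2 * a ^+ 2 * b * d + 2 * a * c * b ^+ 2)
        (a ^+ 2 * d ^+ 2 + 4 * a * b * c * d + b ^+ 2 * c ^+ 2)
        (2 * a * c * d ^+ 2 + 2 * b * d * c ^+ 2) (c ^+ 2 * d ^+ 2) = 0 &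
      2 * ((a * b + c * d) * (a * d + b * c)) = 0 ]].
Proof.
move=> Du.
have word i j z (p s r : seq R) : h *m be i = vec p -> h *m be j = vec s -> h *m be z = vec r ->
  h *m bval mu (be i) (bval mu (be j) (be z)) =
  bval (fam (metab q0 q1 q2)) (vec p) (bval (fam (metab q0 q1 q2)) (vec s) (vec r)).
  by move=> hi hj hz; rewrite !hI hi hj hz.
have T0x : bval mu (be bX) (bval mu (be bX) (be bZx2)) = be bT0.
  by rewrite (@mu_be _ _ bZx3) // (@mu_be _ _ bT0).
have T0y : bval mu (be bY) (bval mu (be bY) (be bZy2)) = be bT0.
  by rewrite (@mu_be _ _ bZy3) // (@mu_be _ _ bT0).
have T1x : bval mu (be bX) (bval mu (be bX) (be bZxy)) = be bT1.
  by rewrite (@mu_be _ _ bZx2y) // (@mu_be _ _ bT1).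
have T1y : bval mu (be bY) (bval mu (be bY) (be bZxy)) = be bT1.
  by rewrite (@mu_be _ _ bZxy2) // (@mu_be _ _ bT1).
have T2 : bval mu (be bX) (bval mu (be bX) (be bZy2)) = 0.
  rewrite (@mu_be _ _ bZxy2) // muE; apply: coP => n nP; rewrite co_bval // co0.
  by move: n nP; apply: lt14P; rewrite /= ?co_be //=; ring.
have := word _ _ _ _ _ _ hX hX hZx2; rewrite T0x => e1.
have := word _ _ _ _ _ _ hY hY hZy2; rewrite T0y {}e1 => e1.
have := word _ _ _ _ _ _ hX hX hZxy; rewrite T1x => e2.
have := word _ _ _ _ _ _ hY hY hZxy; rewrite T1y {}e2 => e2.
have := word _ _ _ _ _ _ hX hX hZy2; rewrite T2 mulmx0 => e3.
have c0 p0 p1 s0 s1 z0 z1 z2 := (@fam_L4 p0 p1 s0 s1 z0 z1 z2).1.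
have c1 p0 p1 s0 s1 z0 z1 z2 := (@fam_L4 p0 p1 s0 s1 z0 z1 z2).2.
have e10 := congr1 (fun x => co x bT0) e1; have e11 := congr1 (fun x => co x bT1) e1.
have e20 := congr1 (fun x => co x bT0) e2; have e21 := congr1 (fun x => co x bT1) e2.
have e30 := congr1 (fun x => co x bT0) e3; have e31 := congr1 (fun x => co x bT1) e3.
rewrite /= ?co0 ?c0 ?c1 in e10 e11 e20 e21 e30 e31.
split; [ | | split]; apply: (mulrI Du);
  [apply: (etrans _ (etrans e10 _)) | apply: (etrans _ (etrans e11 _))
  | apply: (etrans _ (etrans e20 _)) | apply: (etrans _ (etrans e21 _))
  | apply: (etrans _ (etrans (esym e30) _)) | apply: (etrans _ (etrans (esym e31) _))];
  rewrite /quartic_T0; ring.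
Qed.
End Quartics.

End Intertwiners.

(** * Automorphisms of the regular quartic pencil *)

Section LocalStabilizer.
Variable R : comUnitRingType.
Hypotheses (Rloc : is_local R) (u2 : (2 : R) \is a GRing.unit).

(** The relations of [quartic_eqs] at q = 0, with the factors 4 and 2 divided out. *)
Definition pencil_eqs (a b c d : R) :=
  [/\ a ^+ 4 + c ^+ 4 = b ^+ 4 + d ^+ 4,
      a * c * (a ^+ 2 + c ^+ 2) = b * d * (b ^+ 2 + d ^+ 2),
      a ^+ 3 * b + c ^+ 3 * d = b ^+ 3 * a + d ^+ 3 * c,
      a ^+ 3 * d + 3 * a ^+ 2 * b * c + 3 * a * c ^+ 2 * d + b * c ^+ 3
      = b ^+ 3 * c + 3 * b ^+ 2 * a * d + 3 * b * d ^+ 2 * c + a * d ^+ 3 &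
      a ^+ 2 * b ^+ 2 + c ^+ 2 * d ^+ 2 = 0 /\ (a * b + c * d) * (a * d + b * c) = 0].

Lemma local_sum (x y : R) : x + y \is a GRing.unit ->
  x \is a GRing.unit \/ y \is a GRing.unit.
Proof.
move=> u; have [|] := Rloc (x / (x + y)); first by rewrite unitrM => /andP[]; left.
have -> : 1 - x / (x + y) = y / (x + y).
  by rewrite -{1}(divrr u) -mulrBl addrAC subrr add0r.
by rewrite unitrM => /andP[]; right.
Qed.

Lemma unit_mul0 (u x : R) : u \is a GRing.unit -> u * x = 0 -> x = 0.
Proof. by move=> uu e; apply: (mulrI uu); rewrite mulr0. Qed.

(** Write s = ad + bc. As ad - bc = 2ad - s = s - 2bc, either s is a unit or a, b, c, d all are. In
    the second case ad = -bc modulo s, and the relations put b^4 + d^4, c^2 - d^2 and (b^4 -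
    d^4)(c^4 + d^4) in the ideal of multiples of s. This ideal then contains the unit 4 d^8. *)
Lemma pencil_sum_unit a b c d : a * d - b * c \is a GRing.unit ->
  pencil_eqs a b c d -> a * d + b * c \is a GRing.unit.
Proof.
move=> Du [E1 E2 E3 E4 [E5 E6]]; set s := a * d + b * c.
pose I x := exists y, x = s * y.
have Iu x : I x -> x \is a GRing.unit -> s \is a GRing.unit.
  by move=> [y ->]; rewrite unitrM => /andP[].
have IM x y : I y -> I (x * y) by case=> z ->; exists (x * z); ring.
have ID x y : I x -> I y -> I (x + y) by case=> z -> [t ->]; exists (z + t); ring.
have Ican u x : u \is a GRing.unit -> I (u * x) -> I x.
  by move=> uu [y e]; exists (u^-1 * y); apply: (mulrI uu); rewrite e mulrCA mulVKr.
have Is y : I (s * y) by exists y.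
have [//|u2ad] : s \is a GRing.unit \/ 2 * (a * d) \is a GRing.unit.
  have : - s + 2 * (a * d) \is a GRing.unit.
    by rewrite (_ : _ + _ = a * d - b * c) // /s; ring.
  by case/local_sum; rewrite ?unitrN; [left|right].
have [//|u2bc] : s \is a GRing.unit \/ 2 * (b * c) \is a GRing.unit.
  have : s + - (2 * (b * c)) \is a GRing.unit.
    by rewrite (_ : _ + _ = a * d - b * c) // /s; ring.
  by case/local_sum; rewrite ?unitrN; [left|right].
move: u2ad u2bc; rewrite !unitrM => /and3P[_ ua ud] /and3P[_ ub uc].
have i1 : I (b ^+ 4 + d ^+ 4).
  apply: (Ican (c ^+ 2)); first by rewrite unitrX.
  have -> : c ^+ 2 * (b ^+ 4 + d ^+ 4) =
    d ^+ 2 * (a ^+ 2 * b ^+ 2 + c ^+ 2 * d ^+ 2) + s * (- b ^+ 2 * (a * d - b * c)).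
    by rewrite /s; ring.
  by rewrite E5 mulr0 add0r.
have i2 : I (c ^+ 2 - d ^+ 2).
  apply: (Ican (2 * d ^+ 4 * c)); first by rewrite !unitrM u2 uc ?ud.
  have -> : 2 * d ^+ 4 * c * (c ^+ 2 - d ^+ 2) =
    d ^+ 3 * (a ^+ 3 * b + c ^+ 3 * d - (b ^+ 3 * a + d ^+ 3 * c))
    + (c * (c ^+ 2 - d ^+ 2)) * (b ^+ 4 + d ^+ 4)
    + s * (- b * ((a * d) ^+ 2 - (a * d) * (b * c) + (b * c) ^+ 2) + b ^+ 3 * d ^+ 2).
    by rewrite /s; ring.
  by rewrite E3 subrr mulr0 add0r; apply: ID => //; apply: IM.
have i3 : I ((b * (b ^+ 2 + d ^+ 2)) * (c ^+ 4 + d ^+ 4)).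
  have -> : b * (b ^+ 2 + d ^+ 2) * (c ^+ 4 + d ^+ 4) =
    - d ^+ 3 * (a * c * (a ^+ 2 + c ^+ 2) - b * d * (b ^+ 2 + d ^+ 2))
    + s * (c * ((a * d) ^+ 2 - (a * d) * (b * c) + (b * c) ^+ 2) + c ^+ 3 * d ^+ 2).
    by rewrite /s; ring.
  by rewrite E2 subrr mulr0 add0r.
have i4 : I ((b ^+ 2 - d ^+ 2) * ((b ^+ 2 + d ^+ 2) * (c ^+ 4 + d ^+ 4))).
  by apply/IM/(Ican b) => //; rewrite mulrA.
apply: (@Iu (2 * d ^+ 4 * (2 * d ^+ 4))); last by rewrite !unitrM u2 ?ud.
have -> : 2 * d ^+ 4 * (2 * d ^+ 4) =
  - ((b ^+ 2 - d ^+ 2) * ((b ^+ 2 + d ^+ 2) * (c ^+ 4 + d ^+ 4)))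
  + (c ^+ 4 + d ^+ 4) * (b ^+ 4 + d ^+ 4)
  + - (2 * d ^+ 4 * (c ^+ 2 + d ^+ 2)) * (c ^+ 2 - d ^+ 2) by ring.
by rewrite -mulN1r; apply: (ID _ _ _ (IM _ _ i2)); apply: ID; apply: IM.
Qed.

(** The ring may have nilpotents, so the relations first give only b^2 = bc = c^2 = 0 and a^2 = d^2.
    With these and cd = -ab, the third relation becomes 2 a^3 b = 0. *)
Lemma pencil_diag a b c d : a * d \is a GRing.unit -> a * d + b * c \is a GRing.unit ->
  pencil_eqs a b c d -> [/\ b = 0, c = 0 & a = d \/ a = - d].
Proof.
rewrite unitrM => /andP[ua ud] us [E1 E2 E3 E4 [E5 E6]].
have e6 : c * d = - (a * b).
  by apply/eqP; rewrite -addr_eq0 addrC; apply/eqP/(unit_mul0 us); rewrite mulrC.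
have b2 : b ^+ 2 = 0.
  apply: (@unit_mul0 (2 * a ^+ 2)); first by rewrite unitrM unitrX ?u2.
  have -> : 2 * a ^+ 2 * b ^+ 2 = a ^+ 2 * b ^+ 2 + c ^+ 2 * d ^+ 2 - (c * d + a * b) * (c * d - a * b) by ring.
  by rewrite E5 e6 addNr mul0r subr0.
have bc : b * c = 0.
  apply: (unit_mul0 ud); have -> : d * (b * c) = b * (c * d) by ring.
  by rewrite e6 (_ : b * - (a * b) = - a * b ^+ 2); [rewrite b2 mulr0 | ring].
have c2 : c ^+ 2 = 0.
  apply: (unit_mul0 ud); have -> : d * c ^+ 2 = c * (c * d) by ring.
  by rewrite e6 (_ : c * - (a * b) = - a * (b * c)); [rewrite bc mulr0 | ring].
have a2 : (a - d) * (a + d) = 0.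
  apply: (@unit_mul0 (a * d)); first by rewrite unitrM ua.
  have -> : a * d * ((a - d) * (a + d)) = 
    a ^+ 3 * d + 3 * a ^+ 2 * b * c + 3 * a * c ^+ 2 * d + b * c ^+ 3
    - (b ^+ 3 * c + 3 * b ^+ 2 * a * d + 3 * b * d ^+ 2 * c + a * d ^+ 3)
    - (3 * a ^+ 2 + c ^+ 2 - b ^+ 2 - 3 * d ^+ 2) * (b * c) - 3 * a * d * c ^+ 2 + 3 * a * d * b ^+ 2 by ring.
  by rewrite E4 subrr bc c2 b2 !mulr0 !subr0 addr0.
have b0 : b = 0.
  apply: (@unit_mul0 (2 * a ^+ 3)); first by rewrite unitrM unitrX ?u2.
  have -> : 2 * a ^+ 3 * b = (a ^+ 3 * b + c ^+ 3 * d - (b ^+ 3 * a + d ^+ 3 * c))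
    + a * b * ((a - d) * (a + d)) + d ^+ 2 * (c * d + a * b)
    - c * d * c ^+ 2 + a * b * b ^+ 2 by ring.
  by rewrite E3 subrr a2 e6 addNr b2 c2 !mulr0 !addr0 subr0.
have c0 : c = 0 by apply: (unit_mul0 ud); rewrite mulrC e6 b0 mulr0 oppr0.
split=> //; have : (a - d) + (a + d) \is a GRing.unit.
  by rewrite (_ : (a - d) + (a + d) = 2 * a); [rewrite unitrM u2 | ring].
case/local_sum=> u.
  by right; apply/eqP; rewrite -addr_eq0; apply/eqP/(unit_mul0 u).
by left; apply/eqP; rewrite -subr_eq0; apply/eqP/(unit_mul0 u); rewrite mulrC.
Qed.

Lemma pencil_klein a b c d : a * d - b * c \is a GRing.unit -> pencil_eqs a b c d ->
  [/\ b = 0, c = 0 & a = d \/ a = - d] \/ [/\ a = 0, d = 0 & b = c \/ b = - c].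
Proof.
move=> Du E; have us := pencil_sum_unit Du E.
have [u|] := local_sum Du; first by left; apply: pencil_diag u us E.
(* The relations are symmetric under exchange of the images of X and Y, which turns the antidiagonal
   case into the diagonal one. *)
rewrite unitrN => u; right; apply: (@pencil_diag b a d c u); first by rewrite addrC.
by case: E => E1 E2 E3 E4 [E5 E6]; split=> //; split; [rewrite -E5 | rewrite -E6]; ring.
Qed.

End LocalStabilizer.

(** * The action of the graded group on laws *)

Lemma bval_antisym (R : comUnitRingType) (b : bilin R) u v :
  (forall i j, b (i, j) = - b (j, i)) -> bval b u v = - bval b v u.
Proof.
move=> e; move: u v; apply: (@bilin_ext _ _ (fun u v => - bval b v u)) => [v|u|v|u|i j].
- exact: bval_linearl.
- exact: bval_is_linear.
- by move=> c x y; rewrite linearP opprD scalerN.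
- by move=> c x y; rewrite bvalDl bvalZl opprD scalerN.
- by rewrite !bval_bas e.
Qed.

Section Action.
Variable R : comUnitRingType.
Implicit Types (c : R) (h g : 'M[R]_14) (b : bilin R).

Lemma intertw_bas h b b' :
  (forall i j, h *m b (i, j) = bval b' (h *m bas i) (h *m bas j)) -> intertw h b b'.
Proof.
move=> e; apply: bilin_ext => [v|u|v|u|i j]; last by rewrite bval_bas e.
- by move=> c x y; rewrite bvalDl bvalZl mulmxDr scalemxAr.
- by move=> c x y; rewrite linearP /= mulmxDr scalemxAr.
- by move=> c x y; rewrite mulmxDr -scalemxAr bvalDl bvalZl.
- by move=> c x y; rewrite mulmxDr -scalemxAr linearP.
Qed.

Lemma bval_act h b u v :
  bval (act h b) u v = h *m bval b (invmx h *m u) (invmx h *m v).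
Proof.
move: u v; apply: bilin_ext => [v|u|v|u|i j]; last by rewrite bval_bas ffunE.
- by move=> c x y; rewrite bvalDl bvalZl.
- by move=> c x y; rewrite linearP.
- by move=> c x y; rewrite mulmxDr -scalemxAr bvalDl bvalZl mulmxDr -scalemxAr.
- by move=> c x y; rewrite mulmxDr -scalemxAr linearP /= mulmxDr -scalemxAr.
Qed.

Lemma actP h b b' : h \in unitmx -> act h b = b' <-> intertw h b b'.
Proof.
move=> hu; split=> [<- u v|e]; first by rewrite bval_act !mulKmx.
by apply: bvalP => u v; rewrite bval_act e !mulKVmx.
Qed.

Lemma intertw_mul h g b b' b'' :
  intertw g b b' -> intertw h b' b'' -> intertw (h *m g) b b''.
Proof. by move=> eg eh u v; rewrite -!mulmxA eg eh. Qed.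

Lemma act_mul h g b : h \in unitmx -> g \in unitmx -> act (h *m g) b = act h (act g b).
Proof.
move=> hu gu; apply/actP; first by rewrite unitmx_mul hu.
by apply: (@intertw_mul _ _ _ (act g b)); apply/actP.
Qed.

Lemma act1 b : act 1%:M b = b.
Proof. by apply/actP; [apply: unitmx1 | move=> u v; rewrite !mul1mx]. Qed.

Lemma actK h b : h \in unitmx -> act (invmx h) (act h b) = b.
Proof. by move=> hu; rewrite -act_mul ?unitmx_inv // mulVmx // act1. Qed.

Definition gradedmx h := forall i j, deg i != deg j -> h i j = 0.

(** Commutation with the projection onto each L_d passes to products and inverses with no
    computation on entries. *)
Lemma gradedmxP h : gradedmx h <-> forall d : nat,
  h *m diag_mx (\row_i (deg i == d)%:R) = diag_mx (\row_i (deg i == d)%:R) *m h.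
Proof.
split=> [e d|e i j ne].
  rewrite mul_mx_diag mul_diag_mx; apply/matrixP=> i j; rewrite !mxE mulrC.
  by case: (eqVneq (deg i) (deg j)) => [->//|/e ->]; rewrite !mulr0.
have := e (deg i); rewrite mul_mx_diag mul_diag_mx => /matrixP/(_ i j).
by rewrite !mxE eqxx eq_sym (negPf ne) mulr0 mul1r.
Qed.

Lemma gradedmx_mul h g : gradedmx h -> gradedmx g -> gradedmx (h *m g).
Proof.
by move=> /gradedmxP eh /gradedmxP eg; apply/gradedmxP => d;
  rewrite -mulmxA eg mulmxA eh mulmxA.
Qed.

Lemma grGL_mul h g : grGL h -> grGL g -> grGL (h *m g).
Proof.
move=> [hu hg] [gu gg]; split; first by rewrite unitmx_mul hu.
exact: gradedmx_mul.
Qed.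

Lemma grGL_inv h : grGL h -> grGL (invmx h).
Proof.
move=> [hu /gradedmxP hg]; split; first by rewrite unitmx_inv.
apply/gradedmxP => d; apply: (can_inj (mulKmx hu)).
by rewrite [in RHS]mulmxA hg -[RHS]mulmxA mulmxV // mulmx1 mulKVmx.
Qed.

Lemma grGL1 : grGL (1%:M : 'M[R]_14).
Proof.
split=> [|i j ne]; first exact: unitmx1.
by rewrite mxE; case: (eqVneq i j) ne => [->|//]; rewrite eqxx.
Qed.

Lemma carnotM c (u : 'cV[R]_14) i : (carnot c *m u) i 0 = c ^+ deg i * u i 0.
Proof. by rewrite mul_diag_mx !mxE. Qed.

Lemma carnot_unit c : c \is a GRing.unit -> carnot c \in unitmx.
Proof.
move=> cu; have : carnot c *m carnot c^-1 = 1%:M.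
  rewrite /carnot mulmx_diag; apply/matrixP=> i j; rewrite !mxE -exprMn divrr //.
  by rewrite expr1n.
by case/mulmx1_unit.
Qed.

Lemma carnot_grGL c : c \is a GRing.unit -> grGL (carnot c).
Proof.
move=> cu; split=> [|i j ne]; first exact: carnot_unit.
by rewrite mxE; case: (eqVneq i j) ne => [->|//]; rewrite eqxx.
Qed.

Lemma carnot_bas c i : carnot c *m bas i = c ^+ deg i *: bas i.
Proof.
apply/colP=> j; rewrite carnotM !mxE.
by case: (eqVneq j i) => [->//|]; rewrite !mulr0.
Qed.

Lemma carnot_intertw c b : graded_alt b -> intertw (carnot c) b b.
Proof.
move=> [_ gb]; apply: intertw_bas => i j; rewrite !carnot_bas bvalZl linearZ /=.
rewrite bval_bas scalerA; apply/colP=> l; rewrite carnotM mxE -exprD.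
by case: (eqVneq (deg l) (deg i + deg j)%N) => [->//|/gb ->]; rewrite !mulr0.
Qed.

Lemma carnot_comm c h : gradedmx h -> carnot c *m h = h *m carnot c.
Proof.
move=> gh; rewrite mul_mx_diag mul_diag_mx; apply/matrixP=> i j; rewrite !mxE mulrC.
by case: (eqVneq (deg i) (deg j)) => [->//|/gh ->]; rewrite !mul0r.
Qed.

Lemma mul_bas h i l : (h *m bas i) l 0 = h l i.
Proof. by rewrite -colE mxE. Qed.

Lemma graded_bval b u v l : graded_alt b ->
  bval b u v l 0 =
  \sum_i \sum_(j | deg l == (deg i + deg j)%N) u i 0 * v j 0 * b (i, j) l 0.
Proof.
move=> [_ gb]; rewrite /bval summxE; apply: eq_bigr => i _.
rewrite summxE [RHS]big_mkcond; apply: eq_bigr => j _; rewrite mxE.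
by case: eqP => // /eqP /gb ->; rewrite mulr0.
Qed.

Lemma graded_act h b : grGL h -> graded_alt b -> graded_alt (act h b).
Proof.
move=> hh gb.
split=> [i j|i j l ne]; first by rewrite !ffunE (bval_antisym _ _ gb.1) mulmxN.
have gi := (grGL_inv hh).2; rewrite ffunE mxE big1 // => m _ /=.
case: (eqVneq (deg l) (deg m)) => [lm|/hh.2 ->]; last by rewrite mul0r.
rewrite graded_bval // big1 ?mulr0 // => i' _; rewrite big1 // => j' /eqP e.
rewrite !mul_bas; case: (eqVneq (deg i') (deg i)) => [ei|/gi ->]; last by rewrite !mul0r.
case: (eqVneq (deg j') (deg j)) => [ej|/gi ->]; last by rewrite mulr0 mul0r.
by move: ne; rewrite lm e ei ej eqxx.
Qed.

Lemma jacobi_act h b : h \in unitmx -> jacobi b -> jacobi (act h b).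
Proof.
by move=> hu jb u v w; rewrite !bval_act !mulKmx // -!mulmxDr jb mulmx0.
Qed.

Lemma graded_law_act h b : grGL h -> graded_law b -> graded_law (act h b).
Proof.
by move=> hh [gb jb]; split; [apply: graded_act | apply: jacobi_act jb; case: hh].
Qed.

Lemma metabelian_act h b : h \in unitmx -> metabelian b -> metabelian (act h b).
Proof. by move=> hu mb u v w z; rewrite !bval_act !mulKmx // mb mulmx0. Qed.

End Action.

(** * The Klein four-group on the family *)

Section Klein.
Variable R : comUnitRingType.

(* X |-> - X, Y |-> Y *)
Definition flip_sign (n : nat) : R :=
  [:: -1; 1; -1; 1; -1; -1; 1; -1; 1; -1; 1; -1; -1; 1]`_n.
Definition flipL1 : 'M[R]_14 := diag_mx (\row_i flip_sign i).

(* X |-> Y, Y |-> X *)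
Definition swap_sign (n : nat) : R := if (n < 2)%N then 1 else -1.
Definition swap_ix (n : nat) : nat :=
  nth 0%N [:: 1; 0; 2; 4; 3; 7; 6; 5; 11; 10; 9; 8; 12; 13]%N n.
Definition swapL1 : 'M[R]_14 :=
  \matrix_(i, j) (swap_sign i *+ (j == swap_ix i :> nat)).

Lemma co_flip u n : (n < 14)%N -> co (flipL1 *m u) n = flip_sign n * co u n.
Proof. by move=> nP; rewrite /co mul_diag_mx !mxE inordK. Qed.

Lemma co_swap u n : (n < 14)%N -> co (swapL1 *m u) n = swap_sign n * co u (swap_ix n).
Proof.
move=> nP; have sP : (swap_ix n < 14)%N by move: n nP; apply: lt14P.
rewrite /co mxE (bigD1 (inord (swap_ix n))) //= mxE !inordK // eqxx mulr1n.
rewrite big1 ?addr0 // => j ne; rewrite mxE inordK //.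
case: eqP => [e|_]; last by rewrite mulr0n mul0r.
by case/eqP: ne; apply: val_inj; rewrite /= inordK.
Qed.

Lemma mulmx_coP (h g : 'M[R]_14) :
  (forall u n, (n < 14)%N -> co (h *m u) n = co (g *m u) n) -> h = g.
Proof.
move=> e; apply/matrixP=> i j; rewrite -!mul_bas (_ : h *m _ = g *m bas j) //.
by apply: coP => n; apply: e.
Qed.

Lemma flipK : flipL1 *m flipL1 = 1%:M.
Proof.
apply: mulmx_coP => u n nP; rewrite -mulmxA mul1mx !co_flip //.
move: n nP; apply: lt14P; rewrite /flip_sign /=; ring.
Qed.

Lemma swapK : swapL1 *m swapL1 = 1%:M.
Proof.
apply: mulmx_coP => u n nP; rewrite -mulmxA mul1mx !co_swap //; last by move: n nP; apply: lt14P.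
move: n nP; apply: lt14P; rewrite /swap_sign /=; ring.
Qed.

(** Before dividing by the torus the two lifts do not commute and generate a dihedral group of order
    8; the Klein group appears only in the effective quotient. *)
Lemma swap_flip : swapL1 *m flipL1 = carnot (-1) *m (flipL1 *m swapL1).
Proof.
apply: mulmx_coP => u n nP; rewrite -!mulmxA co_swap // co_flip; last by move: n nP; apply: lt14P.
rewrite {2}/co carnotM -/(co _ _) co_flip // co_swap // /deg inordK //.
move: n nP; apply: lt14P; rewrite /swap_sign /flip_sign /=; ring.
Qed.

Lemma flip_grGL : grGL flipL1.
Proof.
split=> [|i j ne]; first by have [] := mulmx1_unit flipK.
by rewrite mxE; case: (eqVneq i j) ne => [->|//]; rewrite eqxx.
Qed.

Lemma swap_grGL : grGL swapL1.
Proof.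
split=> [|i j ne]; first by have [] := mulmx1_unit swapK.
rewrite mxE; case: eqP => // e; case/eqP: ne; rewrite /deg e.
by case: i {e} => n /= nP; move: n nP; apply: lt14P.
Qed.

Lemma fam0 : fam 0 = mu :> bilin R.
Proof.
rewrite /fam (_ : pert 0 = 0) ?addr0 //.
by have := pert_linear (-1) 0 (0 : 'cV[R]_11); rewrite !scaleN1r oppr0 addr0 addNr.
Qed.

Definition flip_fam (t : 'cV[R]_11) : 'cV[R]_11 :=
  \col_i ([:: 1; -1; 1; -1; 1; 1; -1; -1; 1; 1; -1]`_i * t i 0).

Definition swap_fam (t : 'cV[R]_11) : 'cV[R]_11 :=
  \col_i ([:: -1; -1; 1; -1; -1; -1; -1; -1; -1; 1; 1]`_i *
          t (inord (nth 0%N [:: 0; 1; 2; 7; 8; 5; 6; 3; 4; 9; 10]%N i)) 0).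

Lemma flip_intertw t : intertw flipL1 (fam t) (fam (flip_fam t)).
Proof.
move=> u v; apply: coP => n nP; rewrite !famE co_flip // !co_bval //.
by move: n nP; apply: lt14P; rewrite /= ?co_flip //= ?mxE ?inordK //= /flip_sign /=; ring.
Qed.

Lemma swap_intertw t : intertw swapL1 (fam t) (fam (swap_fam t)).
Proof.
move=> u v; apply: coP => n nP; rewrite !famE co_swap // !co_bval //; last by move: n nP; apply: lt14P.
by move: n nP; apply: lt14P; rewrite /= ?co_swap //= ?mxE ?inordK //= /swap_sign /swap_ix /=; ring.
Qed.

End Klein.

(** * Stabilisers over local rings *)

Section Rigid.
Variable R : comUnitRingType.
Implicit Types (h : 'M[R]_14) (b : bilin R).

(* X and Y generate the Lie algebra. *)
Lemma intertw_gen h g b : intertw h mu b -> intertw g mu b ->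
  h *m be _ bX = g *m be _ bX -> h *m be _ bY = g *m be _ bY -> h = g.
Proof.
move=> hI gI eX eY.
have step i j l : (i, j, l) \in mu_table R ->
    h *m be _ i = g *m be _ i -> h *m be _ j = g *m be _ j -> h *m be _ l = g *m be _ l.
  by move=> ijl ei ej; rewrite -(mu_be ijl) hI gI ei ej.
have e2 : h *m be _ 2 = g *m be _ 2 by apply: (@step 0 1).
have e3 : h *m be _ 3 = g *m be _ 3 by apply: (@step 0 2).
have e4 : h *m be _ 4 = g *m be _ 4 by apply: (@step 1 2).
have e5 : h *m be _ 5 = g *m be _ 5 by apply: (@step 0 3).
have e6 : h *m be _ 6 = g *m be _ 6 by apply: (@step 0 4).
have e7 : h *m be _ 7 = g *m be _ 7 by apply: (@step 1 4).
have e8 : h *m be _ 8 = g *m be _ 8 by apply: (@step 0 5).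
have e9 : h *m be _ 9 = g *m be _ 9 by apply: (@step 0 6).
have e10 : h *m be _ 10 = g *m be _ 10 by apply: (@step 0 7).
have e11 : h *m be _ 11 = g *m be _ 11 by apply: (@step 1 7).
have e12 : h *m be _ 12 = g *m be _ 12 by apply: (@step 0 8).
have e13 : h *m be _ 13 = g *m be _ 13 by apply: (@step 0 9).
have e n : (n < 14)%N -> h *m be _ n = g *m be _ n by move: n; apply: lt14P.
apply/matrixP=> i j; rewrite -!mul_bas (_ : h *m bas j = g *m bas j) //.
by have := e j (ltn_ord j); rewrite /be inord_val.
Qed.

Lemma graded_L1 h j : gradedmx h -> (j < 2)%N ->
  h *m be _ j = vec [:: co (h *m be _ j) 0; co (h *m be _ j) 1].
Proof.
move=> gh jP; have j14 : (j < 14)%N by apply: leq_trans jP _.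
apply: coP => n nP; rewrite co_vec //; case: n nP => [|[|n]] nP //=.
have ne m : (m < 14)%N -> (1 < m)%N -> wt m != 1%N by move: m; apply: lt14P.
rewrite nth_nil /co mul_bas gh // /deg !inordK // -!/(wt _).
by rewrite (_ : wt j = 1%N); [apply: ne | case: j jP {j14} => [|[]]].
Qed.

Definition klein (s w : bool) : 'M[R]_14 :=
  (if s then flipL1 R else 1%:M) *m (if w then swapL1 R else 1%:M).

Lemma klein_grGL s w : grGL (klein s w).
Proof.
apply: grGL_mul; [case: s | case: w]; do ?exact: grGL1.
  exact: flip_grGL.
exact: swap_grGL.
Qed.

Definition klein_fam s w t : 'cV[R]_11 :=
  let t' := if w then swap_fam t else t in if s then flip_fam t' else t'.

Lemma id_intertw b : intertw 1%:M b b.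
Proof. by move=> u v; rewrite !mul1mx. Qed.

Lemma klein_intertw s w t : intertw (klein s w) (fam t) (fam (klein_fam s w t)).
Proof.
apply: (@intertw_mul _ _ _ _ (fam (if w then swap_fam t else t))).
  by case: w; [apply: swap_intertw | apply: id_intertw].
by case: s; [apply: flip_intertw | apply: id_intertw].
Qed.

Lemma klein_fam0 s w : klein_fam s w 0 = 0.
Proof.
have f0 : flip_fam 0 = 0 :> 'cV[R]_11 by apply/colP=> i; rewrite !mxE mulr0.
have s0 : swap_fam 0 = 0 :> 'cV[R]_11 by apply/colP=> i; rewrite !mxE mulr0.
by case: s; case: w; rewrite /klein_fam ?s0 ?f0.
Qed.

Lemma klein_mu s w : intertw (klein s w) mu mu.
Proof. by have := klein_intertw s w 0; rewrite klein_fam0 fam0. Qed.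

Lemma klein_stab s w : stab (klein s w).
Proof. by split; [exact: klein_grGL | apply/actP; [case: (klein_grGL s w) | exact: klein_mu]]. Qed.

Lemma klein_X s w : klein s w *m be _ bX =
  vec (if w then [:: 0; 1] else if s then [:: -1] else [:: 1]).
Proof.
apply: coP => n nP; rewrite -mulmxA.
have e : (if w then swapL1 R else 1%:M) *m be _ bX = be _ (if w then bY else bX).
  apply: coP => m mP; case: w; rewrite ?mul1mx // co_swap // !co_be //.
    by move: m mP; apply: lt14P; rewrite /swap_sign /=; ring.
  by move: m mP; apply: lt14P.
rewrite e co_vec //; case: s; rewrite ?mul1mx ?co_flip // co_be; try by case: (w).
all: by case: w {e}; move: n nP; apply: lt14P; rewrite /flip_sign /=; ring.
Qed.

Lemma klein_Y s w : klein s w *m be _ bY =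
  vec (if w then [:: if s then -1 else 1] else [:: 0; 1]).
Proof.
apply: coP => n nP; rewrite -mulmxA.
have e : (if w then swapL1 R else 1%:M) *m be _ bY = be _ (if w then bX else bY).
  apply: coP => m mP; case: w; rewrite ?mul1mx // co_swap // !co_be //.
    by move: m mP; apply: lt14P; rewrite /swap_sign /=; ring.
  by move: m mP; apply: lt14P.
rewrite e co_vec //; case: s; rewrite ?mul1mx ?co_flip // co_be; try by case: (w).
all: by case: w {e}; move: n nP; apply: lt14P; rewrite /flip_sign /=; ring.
Qed.

Lemma carnot_vec (c : R) (s : seq R) : (size s <= 2)%N -> carnot c *m vec s = vec [seq c * x | x <- s].
Proof.
move=> sP; apply: coP => n nP; rewrite /co carnotM -/(co _ _) -/(co _ _) !co_vec // /deg inordK //.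
case: s sP => [|x [|y []]] //= _; case: n nP => [|[|n]] nP //=; rewrite ?expr1 ?nth_nil ?mulr0 //.
Qed.

Lemma mu_graded : graded_alt (mu : bilin R).
Proof. by rewrite -fam0; apply: fam_graded. Qed.

Lemma carnot_klein_mu (c : R) s w : intertw (carnot c *m klein s w) mu mu.
Proof. by apply: intertw_mul (klein_mu s w) (carnot_intertw c mu_graded). Qed.

Hypotheses (Rloc : is_local R) (u2 : (2 : R) \is a GRing.unit).

Lemma metab0 : metab 0 0 0 = 0 :> 'cV[R]_11.
Proof. by apply/colP=> i; rewrite !mxE; case: i => [[|[|[|[]]]]]. Qed.

(** The inverse of h is graded too, so its L_1 block inverts that of h and the two determinants
    multiply to 1. *)
Lemma L1_det_unit h (a b c d : R) : grGL h ->
  h *m be _ bX = vec [:: a; c] -> h *m be _ bY = vec [:: b; d] ->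
  a * d - b * c \is a GRing.unit.
Proof.
move=> hh hX hY; have [_ gi] := grGL_inv hh; have [hu _] := hh.
have iX := graded_L1 gi (isT : (bX < 2)%N); have iY := graded_L1 gi (isT : (bY < 2)%N).
set a' := co _ _ in iX; set c' := co _ _ in iX; set b' := co _ _ in iY; set d' := co _ _ in iY.
have lin x y : vec [:: x; y] = x *: be R bX + y *: be R bY.
  apply: coP => n nP; rewrite coD !coZ !co_be // co_vec //.
  by move: n nP; apply: lt14P; rewrite /=; ring.
have eq x y : h *m vec [:: x; y] = x *: vec [:: a; c] + y *: vec [:: b; d].
  by rewrite lin mulmxDr -!scalemxAr hX hY.
have /(congr1 (fun z => (co z 0, co z 1))) := mulKVmx hu (be R bX).
rewrite iX eq !coD !coZ !co_vec // !co_be // => -[/= e1 e2].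
have /(congr1 (fun z => (co z 0, co z 1))) := mulKVmx hu (be R bY).
rewrite iY eq !coD !coZ !co_vec // !co_be // => -[/= e3 e4].
have e : (a * d - b * c) * (a' * d' - b' * c') = 1.
  transitivity ((a' * a + c' * b) * (b' * c + d' * d)
                - (a' * c + c' * d) * (b' * a + d' * b)); first by ring.
  by rewrite e1 e2 e3 e4; ring.
by apply/unitrPr; exists (a' * d' - b' * c').
Qed.

Lemma stab_klein h : stab h -> exists s w, eq_modT (klein s w) h.
Proof.
move=> [hh hmu]; have [hu gh] := hh; have hI : intertw h mu mu by apply/actP.
have := graded_L1 gh (isT : (bX < 2)%N); set a := co _ _; set c := co _ _ => hX.
have := graded_L1 gh (isT : (bY < 2)%N); set b := co _ _; set d := co _ _ => hY.
have Du := L1_det_unit hh hX hY.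
have hI' : intertw h mu (fam (metab 0 0 0)) by rewrite metab0 fam0.
have [E1 E2 [E3 E4 E5 E6]] := quartic_eqs hI' hX hY Du.
have pe : pencil_eqs a b c d.
  have u4 : (4 : R) \is a GRing.unit by rewrite (_ : 4 = 2 * 2) ?unitrM ?u2 //; ring.
  split; last split.
  - by apply: (etrans _ (etrans E1 _)); rewrite /quartic_T0; ring.
  - by apply: (mulrI u4); apply: (etrans _ (etrans E2 _)); ring.
  - by apply: (etrans _ (etrans E3 _)); rewrite /quartic_T0; ring.
  - exact: E4.
  - by apply: (etrans _ (etrans E5 _)); rewrite /quartic_T0; ring.
  - exact: (unit_mul0 u2 E6).
have fin s w e : e \is a GRing.unit -> h *m be _ bX = (carnot e *m klein s w) *m be _ bX ->
    h *m be _ bY = (carnot e *m klein s w) *m be _ bY -> eq_modT (klein s w) h.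
  by move=> eu eX eY; exists e => //; apply: intertw_gen eX eY => //; apply: carnot_klein_mu.
have v1 x : vec [:: x; 0] = vec [:: x] :> 'cV[R]_14.
  by apply: coP => n nP; rewrite !co_vec //; case: n nP => [|[|n]] _ //=; rewrite nth_nil.
have [[b0 c0 ad]|[a0 d0 bc]] := pencil_klein Rloc u2 Du pe.
(* The torus parameter is the entry of h on L_1 at which the Klein matrices have coefficient +1: d
   here, c in the antidiagonal case. *)
- have du : d \is a GRing.unit by move: Du; rewrite b0 mul0r subr0 unitrM => /andP[].
  by case: ad => ad; [exists false, false | exists true, false];
    apply: (fin _ _ d) => //; rewrite -mulmxA ?klein_X ?klein_Y carnot_vec //= ?hX ?hY
      ?b0 ?c0 ?v1 ?ad ?mulr0 ?mulr1 ?mulrN1.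
- have cu : c \is a GRing.unit by move: Du; rewrite a0 mul0r sub0r unitrN unitrM => /andP[].
  by case: bc => bc; [exists false, true | exists true, true];
    apply: (fin _ _ c) => //; rewrite -mulmxA ?klein_X ?klein_Y carnot_vec //= ?hX ?hY
      ?a0 ?d0 ?v1 ?bc ?mulr0 ?mulr1 ?mulrN1.
Qed.

(** On L_1, two distinct Klein elements could agree up to scalars only if a unit were 0 or equal to
    its opposite; the unit 2 excludes the latter. *)
Lemma klein_inj s w s' w' (c c' : R) : c \is a GRing.unit -> c' \is a GRing.unit ->
  carnot c *m klein s w = carnot c' *m klein s' w' -> (s, w) = (s', w').
Proof.
move=> cu cu' e; have nz (x : R) : x \is a GRing.unit -> x <> 0.
  by move=> xu x0; move: xu; rewrite x0 unitr0.
have ne (x : R) : x \is a GRing.unit -> x <> - x.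
  move=> xu /eqP; rewrite -subr_eq0 opprK => /eqP xx.
  have /nz : 2 * x \is a GRing.unit by rewrite unitrM u2.
  by apply; rewrite -xx; ring.
have eX : carnot c *m (klein s w *m be R bX) = carnot c' *m (klein s' w' *m be R bX).
  by rewrite [LHS]mulmxA e -mulmxA.
have eY : carnot c *m (klein s w *m be R bY) = carnot c' *m (klein s' w' *m be R bY).
  by rewrite [LHS]mulmxA e -mulmxA.
move: eX eY; rewrite !klein_X !klein_Y !carnot_vec; try by case: (s); case: (w); case: (s'); case: (w').
move=> eX eY; have e1 := congr1 (fun z => co z 0) eX; have e2 := congr1 (fun z => co z 1) eX.
have e3 := congr1 (fun z => co z 0) eY; have e4 := congr1 (fun z => co z 1) eY.
rewrite !co_vec // in e1 e2 e3 e4; have [nc nc' nec] : [/\ c <> 0, c' <> 0 & c <> - c].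
  by split; auto.
have [nec' nNc nNc'] : [/\ c' <> - c', - c <> 0 & - c' <> 0].
  by split; auto; apply: nz; rewrite unitrN.
case: s e1 e2 e3 e4 {e eX eY}; case: w; case: s'; case: w' => //=;
  rewrite ?mulrN1 ?mulr1 ?mulr0 => e1 e2 e3 e4 //.
all: try congruence.
- by case: nec; rewrite e3.
- by case: nec; rewrite e1.
- by case: nec; rewrite {1}e3 e2.
- by case: nec; rewrite {1}e1 e4.
Qed.

End Rigid.

(** * The effective stabiliser as a constant group *)

Section StabEff.
Variable k : fieldType.
Hypothesis char0 : [pchar k] =i pred0.

Lemma two_unit (A : comUnitAlgType k) : (2 : A) \is a GRing.unit.
Proof.
have -> : (2 : A) = in_alg A 2 by rewrite rmorph_nat.
by apply: rmorph_unit; rewrite unitfE (pcharf0P k).1.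
Qed.

Lemma map_flipL1 (A : comUnitAlgType k) : map_mx (in_alg A) (flipL1 k) = flipL1 A.
Proof.
apply/matrixP=> i j; rewrite !mxE rmorphMn /=; congr (_ *+ _).
rewrite /flip_sign; move: (i : nat) (ltn_ord i).
by apply: lt14P => /=; rewrite ?scaleN1r ?scale1r.
Qed.

Lemma map_swapL1 (A : comUnitAlgType k) : map_mx (in_alg A) (swapL1 k) = swapL1 A.
Proof.
apply/matrixP=> i j; rewrite !mxE rmorphMn /=; congr (_ *+ _).
by rewrite /swap_sign; case: ifP; rewrite ?scaleN1r ?scale1r.
Qed.

Lemma map_klein (A : comUnitAlgType k) s w : map_mx (in_alg A) (klein k s w) = klein A s w.
Proof.
by rewrite /klein map_mxM; case: s; case: w; rewrite ?map_mx1 ?map_flipL1 ?map_swapL1.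
Qed.

Lemma kleinM (s w s' w' : bool) :
  eq_modT (klein k s w *m klein k s' w') (klein k (s (+) s') (w (+) w')).
Proof.
have eq1 (h g : 'M[k]_14) : h = g -> eq_modT h g.
  move=> ->; exists 1; first exact: unitr1.
  by apply: mulmx_coP => u n nP; rewrite -mulmxA [in RHS]/co carnotM expr1n mul1r.
have sw := @swap_flip k.
have fw s1 s2 w1 : klein k s1 false *m klein k s2 w1 = klein k (s1 (+) s2) w1.
  rewrite /klein mulmx1 mulmxA; congr (_ *m _).
  by case: s1; case: s2; rewrite ?mul1mx ?mulmx1 // flipK.
have fs s1 w1 w2 : klein k s1 w1 *m klein k false w2 = klein k s1 (w1 (+) w2).
  rewrite /klein mul1mx -mulmxA; congr (_ *m _).
  by case: w1; case: w2; rewrite ?mul1mx ?mulmx1 // swapK.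
case: w => //; last by rewrite fw; apply: eq1.
case: s' => //; last by rewrite fs addbF; apply: eq1.
(* A swap to the left of a flip is the one product that is out of order; reordering it costs the
   torus element at -1. *)
have -> : klein k s true *m klein k true w' = klein k s false *m (swapL1 k *m flipL1 k) *m klein k false w'.
  by rewrite /klein !mulmx1 !mul1mx !mulmxA.
have N1 : (-1 : k) \is a GRing.unit by rewrite unitrN unitr1.
exists (-1) => //; rewrite sw -[flipL1 k *m swapL1 k]/(klein k true true).
have cK := carnot_comm (-1) (klein_grGL k s false).2.
have -> : klein k (s (+) true) (true (+) w') = klein k s false *m klein k true true *m klein k false w'.
  by rewrite fw fs.
move: (klein k s false) (klein k true true) (klein k false w') cK => K L M cK.
rewrite (mulmxA K) -cK !mulmxA.
rewrite (_ : carnot (-1) *m carnot (-1) = 1%:M) ?mul1mx //.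
apply: mulmx_coP => u n nP; rewrite -mulmxA mul1mx /co !carnotM mulrA -exprMn.
by rewrite mulrNN mulr1 expr1n mul1r.
Qed.

Lemma stab_eff_klein : stab_eff_V4 k.
Proof.
exists (fun g => klein k (g.1 != 0) (g.2 != 0)); split=> [g|g g'|A Aloc h hs].
- exact: klein_stab.
- have := kleinM (g.1 != 0) (g.2 != 0) (g'.1 != 0) (g'.2 != 0).
  have Z2 (x y : 'Z_2) : (x != 0) (+) (y != 0) = (x + y != 0).
    by case: x => [[|[|[]]] ?] //; case: y => [[|[|[]]] ?].
  by rewrite !Z2.
have u2 := two_unit A; have [s [w [c cu ec]]] := stab_klein Aloc u2 hs.
exists (s%:R, w%:R); split=> [|[s' w'] [c' cu' ec']] /=.
  by exists c => //; rewrite map_klein; case: (s) ec; case: (w).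
rewrite ec map_klein in ec'; have [-> ->] := klein_inj u2 cu cu' ec'.
have Z2 (x : 'Z_2) : (x != 0)%:R = x by apply: val_inj; case: x => [[|[|[]]] ?].
by rewrite !Z2.
Qed.

End StabEff.

(** * Small extensions of Artinian algebras *)

Section Nilpotents.
Variable R : comUnitRingType.
Implicit Types x y : R.

Lemma nilp0 : nilp (0 : R).
Proof. by exists 1%N; rewrite expr1. Qed.

Lemma nilpM x y : nilp y -> nilp (x * y).
Proof. by case=> n e; exists n; rewrite exprMn e mulr0. Qed.

Lemma nilpD x y : nilp x -> nilp y -> nilp (x + y).
Proof.
move=> [m ex] [n ey]; exists (m + n)%N; rewrite exprDn big1 // => i _.
have [le_ni|lt_in] := leqP n i.
  by rewrite -(subnKC le_ni) (exprD y) ey mul0r mulr0 mul0rn.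
have le_m : (m <= m + n - i)%N by rewrite -addnBA ?leq_addr // ltnW.
by rewrite -(subnKC le_m) exprD ex !mul0r mul0rn.
Qed.

Lemma nilpN x : nilp x -> nilp (- x).
Proof. by rewrite -mulN1r; apply: nilpM. Qed.

Lemma nilpB x y : nilp x -> nilp y -> nilp (x - y).
Proof. by move=> hx hy; apply: nilpD => //; apply: nilpN. Qed.

Lemma nilp_sum (I : Type) (r : seq I) (P : pred I) (F : I -> R) :
  (forall i, P i -> nilp (F i)) -> nilp (\sum_(i <- r | P i) F i).
Proof. by move=> h; apply: big_ind; [exact: nilp0 | exact: nilpD | exact: h]. Qed.

Lemma unit_nilp x y : x \is a GRing.unit -> nilp y -> x + y \is a GRing.unit.
Proof.
move=> xu [n e]; have : (x + y) * (\sum_(i < n) x ^+ (n.-1 - i) * (- y) ^+ i) = x ^+ n.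
  by have := subrXX x (- y) n; rewrite opprK (exprNn y) e mulr0 subr0.
move=> ee; have : x ^+ n \is a GRing.unit by rewrite unitrX.
by rewrite -ee unitrM => /andP[].
Qed.

End Nilpotents.

Lemma rmorph_nilp (R S : comUnitRingType) (f : {rmorphism R -> S}) x :
  nilp x -> nilp (f x).
Proof. by case=> n e; exists n; rewrite -rmorphXn e rmorph0. Qed.

(** * A composition series of the nilradical *)

Section Ideals.
Variables (k : fieldType) (A : artAlg k).
Implicit Types (J : A -> Prop) (x y z : A).

Record ideal J : Prop := Ideal {
  ideal0 : J 0;
  idealD : forall x y, J x -> J y -> J (x + y);
  idealM : forall a x, J x -> J (a * x) }.

Lemma idealZ J (c : k) x : ideal J -> J x -> J (c *: x).
Proof. by move=> iJ Jx; rewrite -mulr_algl; apply: idealM. Qed.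

Lemma idealN J x : ideal J -> J x -> J (- x).
Proof. by move=> iJ Jx; rewrite -mulN1r; apply: idealM. Qed.

Lemma ideal_sum J (I : Type) (r : seq I) (P : pred I) (F : I -> A) : ideal J ->
  (forall i, P i -> J (F i)) -> J (\sum_(i <- r | P i) F i).
Proof. by move=> iJ h; apply: big_ind; [exact: ideal0 | exact: idealD | exact: h]. Qed.

Lemma nilp_ideal : ideal (@nilp A).
Proof. by split; [exact: nilp0 | exact: nilpD | exact: nilpM]. Qed.

Lemma nilpZ (c : k) x : nilp x -> nilp (c *: x).
Proof. by apply: idealZ; apply: nilp_ideal. Qed.

Lemma alg_nilp (c : k) : nilp (c%:A : A) -> c = 0.
Proof.
case=> n; rewrite -in_algE -rmorphXn => e.
have : c ^+ n == 0 by rewrite -(fmorph_eq0 (in_alg A)) e.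
by rewrite expf_eq0 => /andP[_ /eqP].
Qed.

Definition addline J x : A -> Prop := fun z => exists c : k, J (z - c *: x).

(** Ideals reached from 0 by adjoining lines k x on which the nilpotents act as zero modulo J, so
    that A/J -> A/(J + k x) is a small extension. *)
Inductive chain : (A -> Prop) -> Prop :=
| chain0 : chain (fun z => z = 0)
| chainS J x : chain J -> nilp x -> (forall y, nilp y -> J (y * x)) ->
    chain (addline J x).

Lemma addline_ideal J x : ideal J -> (forall y, nilp y -> J (y * x)) ->
  ideal (addline J x).
Proof.
move=> iJ h; split=> [|y z [c hc] [d hd]|a z [c hc]].
- by exists 0; rewrite scale0r subr0; apply: ideal0.
- by exists (c + d); rewrite scalerDl opprD addrACA; apply: idealD.
- have [d hd] := art_local a; exists (d * c).
  have -> : a * z - (d * c) *: x = a * (z - c *: x) + c *: ((a - d%:A) * x).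
    by rewrite mulrBr mulrBl scalerBr mulr_algl scalerA mulrC (mulrC c) -scalerAr addrA subrK.
  by apply: idealD => //; [apply: idealM | apply: idealZ => //; apply: h].
Qed.

Lemma chain_ideal J : chain J -> ideal J /\ (forall x, J x -> nilp x).
Proof.
elim=> {J} [|J x _ [iJ nJ] nx h].
  split=> [|x ->]; last exact: nilp0.
  by split=> [//|x y -> ->|a x ->]; rewrite ?addr0 ?mulr0.
split=> [|z [c /nJ hc]]; first exact: addline_ideal.
rewrite -(subrK (c *: x) z); apply: nilpD => //.
exact: nilpZ.
Qed.

(** For each y of the list in turn, x is multiplied by the largest power of y that keeps it outside
    J. *)
Lemma socle_mod J x (ys : seq A) : ideal J -> nilp x -> ~ J x ->
  (forall y, y \in ys -> nilp y) ->
  exists x', [/\ nilp x', ~ J x' & forall y, y \in ys -> J (y * x')].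
Proof.
move=> iJ nx Jx; elim: ys => [|y ys IH] nys; first by exists x.
have [z zys|x1 [nx1 Jx1 h1]] := IH; first by apply: nys; rewrite inE zys orbT.
have [n e] : nilp y by apply: nys; rewrite inE eqxx.
have [m [Jm JSm]] : exists m, ~ J (y ^+ m * x1) /\ J (y ^+ m.+1 * x1).
  have: J (y ^+ n * x1) by rewrite e mul0r; apply: ideal0.
  elim: n {e} => [|n IHn] Jn; first by rewrite mul1r in Jn.
  by have [/IHn //|Jn'] := classic (J (y ^+ n * x1)); exists n.
exists (y ^+ m * x1); split=> [||z]; [exact: nilpM | exact: Jm |].
rewrite inE => /orP[/eqP->|/h1 hz]; first by rewrite mulrA -exprS.
by rewrite mulrCA; apply: idealM.
Qed.

(** The nilpotents are spanned by the generators minus their residues, so being annihilated modulo J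
    is a condition on finitely many products. *)
Lemma chain_next J : chain J -> (exists2 x, nilp x & ~ J x) ->
  exists x, [/\ nilp x, ~ J x & forall y, nilp y -> J (y * x)].
Proof.
move=> /chain_ideal[iJ _] [x nx Jx]; have [s sP] := art_findim A.
have [c cP] : exists c : 'I_(size s) -> k, forall i : 'I_(size s), nilp (s`_i - (c i)%:A).
  have h (i : 'I_(size s)) := art_local s`_i.
  have [c cP] := fin_all_exists h; by exists c.
pose ys := [seq s`_i - (c i)%:A | i : 'I_(size s)].
have [|x' [nx' Jx' hx']] := socle_mod (ys := ys) iJ nx Jx.
  by move=> y /codomP[i ->].
exists x'; split=> // y ny; have [a ya] := sP y.
have yE : y = \sum_i a i *: (s`_i - (c i)%:A) + (\sum_i a i * c i)%:A.
  rewrite {1}ya scaler_suml -big_split; apply: eq_bigr => i _ /=.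
  by rewrite scalerBr scalerA subrK.
have /alg_nilp e : nilp ((\sum_i a i * c i)%:A : A).
  rewrite -[X in nilp X](addKr (\sum_i a i *: (s`_i - (c i)%:A))) -yE addrC.
  by apply: nilpB => //; apply: nilp_sum => i _; apply: nilpZ.
rewrite yE e scale0r addr0 mulr_suml; apply: ideal_sum => // i _.
by rewrite -scalerAl; apply: idealZ => //; apply/hx'/codom_f.
Qed.

(** Families indexed by [nat] keep one type while [chain_full] lengthens them. *)
Lemma free_bound : exists N, forall x : nat -> A,
  (forall v : nat -> k, \sum_(i < N) v i *: x i = 0 -> forall i : 'I_N, v i = 0) -> False.
Proof.
have [s sP] := art_findim A; exists (size s).+1 => x free_x.
have [C CP] : exists C : 'I_(size s).+1 -> 'I_(size s) -> k,
    forall i : 'I_(size s).+1, x i = \sum_j C i j *: s`_j.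
  by have [C CP] := fin_all_exists (fun i : 'I_(size s).+1 => sP (x i)); exists C.
pose M := \matrix_(i, j) C i j.
have /rowV0Pn[v /sub_kermxP vM v0] : kermx M != 0.
  rewrite kermx_eq0 /row_free neq_ltn; apply/orP; left.
  by apply: leq_ltn_trans (rank_leq_col M) _.
case/eqP: v0; apply/rowP=> i; rewrite mxE.
have := free_x (fun n => if insub n is Some i then v 0 i else 0); 
have val_v (j : 'I_(size s).+1) : (if insub (val j) is Some i then v 0 i else 0) = v 0 j.
  by rewrite valK.
move=> /(_ _ i); rewrite val_v; apply.
under eq_bigr => j _ do rewrite val_v CP scaler_sumr.
rewrite exchange_big big1 // => j _ /=.
have /rowP/(_ j) := vM; rewrite !mxE => e.
rewrite -[RHS](scale0r s`_j) -e scaler_suml; apply: eq_bigr => i' _.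
by rewrite mxE scalerA.
Qed.

Lemma chain_full : exists2 J, chain J & forall x, nilp x -> J x.
Proof.
apply: NNPP => none; have [N free_x] := free_bound.
(* If no ideal of the chain exhausted the nilpotents, the chain could be extended N times by
   independent vectors, for every N. *)
suff [J [x [cJ xJ]]] : exists J (x : nat -> A), [/\ chain J, 
   forall z, J z <-> exists v : nat -> k, z = \sum_(i < N) v i *: x i &
   forall v : nat -> k, \sum_(i < N) v i *: x i = 0 -> forall i : 'I_N, v i = 0].
  exact: free_x.
elim: N {free_x} => [|n [J [x [cJ xJ fx]]]].
  exists (fun z => z = 0), (fun _ => 0); split; [exact: chain0 | | by move=> v _ []].
  move=> z; split=> [->|[v ->]]; last by rewrite big_ord0.
  by exists (fun _ => 0); rewrite big_ord0.
have [|y [ny Jy hy]] := chain_next cJ.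
  apply: NNPP => nex; apply: none; exists J => // y ny.
  by apply: NNPP => Jy; apply: nex; exists y.
pose x' (i : nat) := if i == n then y else x i.
have sumE (v : nat -> k) : \sum_(i < n.+1) v i *: x' i = \sum_(i < n) v i *: x i + v n *: y.
  rewrite big_ord_recr /= /x' eqxx; congr (_ + _); apply: eq_bigr => i _.
  by rewrite ltn_eqF.
have [iJ _] := chain_ideal cJ.
exists (addline J y), x'; split; first exact: chainS.
  move=> z; split=> [[c /xJ[v e]]|[v ->]].
    pose v' (i : nat) := if i == n then c else v i.
    exists v'; rewrite sumE {2}/v' eqxx.
    rewrite -[LHS](subrK (c *: y)) e; congr (_ + _); apply: eq_bigr => i _.
    by rewrite /v' ltn_eqF.
  by exists (v n); apply/xJ; exists v; rewrite sumE addrK.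
move=> v; rewrite sumE => e.
have vn : v n = 0.
  apply: NNPP => /eqP vn; apply: Jy; rewrite -[y](scalerK vn); apply: idealZ => //.
  have -> : v n *: y = - \sum_(i < n) v i *: x i.
    by apply/eqP; rewrite -addr_eq0 addrC e.
  by apply: idealN => //; apply/xJ; exists v.
rewrite vn scale0r addr0 in e => i; have := ltn_ord i; rewrite ltnS leq_eqVlt.
by case/orP=> [/eqP->//|lt_in]; apply: (fx v e (Ordinal lt_in)).
Qed.

End Ideals.

(** * Base change *)

Section BaseChange.
Variables (R S : comUnitRingType) (f : {rmorphism R -> S}).

Lemma map_bval b u v :
  map_mx f (bval b u v) = bval (bmap f b) (map_mx f u) (map_mx f v).
Proof.
rewrite /bval raddf_sum; apply: eq_bigr => i _; rewrite raddf_sum; apply: eq_bigr => j _.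
by rewrite /= map_mxZ rmorphM ffunE !mxE.
Qed.

Lemma map_bas i : map_mx f (bas i) = bas i.
Proof. by apply/colP=> l; rewrite !mxE rmorph_nat. Qed.

Lemma bmapD b b' : bmap f (b + b') = bmap f b + bmap f b'.
Proof. by apply/ffunP=> p; rewrite !ffunE map_mxD. Qed.

Lemma bmap_of_terms s : bmap f (of_terms s) = of_terms [seq (x.1, f x.2) | x <- s].
Proof.
apply/ffunP=> p; rewrite !ffunE; apply/colP=> l; rewrite !mxE big_map rmorph_sum.
by apply: eq_bigr => x _; rewrite rmorphM rmorphB !rmorph_nat.
Qed.

Lemma bmap_mu : bmap f mu = mu.
Proof. by rewrite !muE bmap_of_terms /= !rmorph1. Qed.

Lemma bmap_pert t : bmap f (pert t) = pert (map_mx f t).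
Proof.
rewrite /pert bmap_of_terms; congr of_terms; rewrite /fam_terms !mxE /=.
by rewrite !(rmorphD, rmorphB, rmorphN, rmorphM, rmorph_nat, rmorph0, rmorph1).
Qed.

Lemma bmap_fam t : bmap f (fam t) = fam (map_mx f t).
Proof. by rewrite /fam bmapD bmap_mu bmap_pert. Qed.

Lemma unitmx_map (h : 'M[R]_14) : h \in unitmx -> map_mx f h \in unitmx.
Proof. by rewrite !unitmxE det_map_mx; apply: rmorph_unit. Qed.

Lemma map_invmx_unit (h : 'M[R]_14) : h \in unitmx ->
  map_mx f (invmx h) = invmx (map_mx f h).
Proof.
move=> hu; have e : map_mx f h *m map_mx f (invmx h) = 1%:M.
  by rewrite -map_mxM mulmxV // map_mx1.
by rewrite -[RHS]mulmx1 -e mulKmx // unitmx_map.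
Qed.

Lemma bmap_act h b : h \in unitmx -> bmap f (act h b) = act (map_mx f h) (bmap f b).
Proof.
move=> hu; apply/ffunP=> p; rewrite !ffunE map_mxM map_bval !map_mxM !map_bas.
by rewrite map_invmx_unit.
Qed.

End BaseChange.

(** * Congruences and first variation over a small extension *)

Section Congruence.
Variables (k : fieldType) (A : artAlg k).
Implicit Types (J : A -> Prop) (x y z : A).

Definition cong J m n (M N : 'M[A]_(m, n)) := forall i j, J ((M - N) i j).

Section Cong.
Variables (J : A -> Prop) (iJ : ideal J).

Lemma cong_refl m n (M : 'M[A]_(m, n)) : cong J M M.
Proof. by move=> i j; rewrite subrr mxE; apply: ideal0. Qed.

Lemma cong_sym m n (M N : 'M[A]_(m, n)) : cong J M N -> cong J N M.
Proof. by move=> e i j; rewrite -opprB mxE; apply: idealN. Qed.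

Lemma cong_trans m n (M N P : 'M[A]_(m, n)) : cong J M N -> cong J N P -> cong J M P.
Proof.
move=> e e' i j; rewrite (_ : M - P = (M - N) + (N - P)); last by rewrite addrA subrK.
by rewrite mxE; apply: idealD.
Qed.

Lemma congD m n (M N M' N' : 'M[A]_(m, n)) :
  cong J M N -> cong J M' N' -> cong J (M + M') (N + N').
Proof. by move=> e e' i j; rewrite opprD addrACA mxE; apply: idealD. Qed.

Lemma congN m n (M N : 'M[A]_(m, n)) : cong J M N -> cong J (- M) (- N).
Proof. by move=> e i j; rewrite -opprD mxE; apply: idealN. Qed.

Lemma congB m n (M N M' N' : 'M[A]_(m, n)) :
  cong J M N -> cong J M' N' -> cong J (M - M') (N - N').
Proof. by move=> e e'; apply: congD => //; apply: congN. Qed.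

Lemma congZ m n a (M N : 'M[A]_(m, n)) : cong J M N -> cong J (a *: M) (a *: N).
Proof. by move=> e i j; rewrite -scalerBr mxE; apply: idealM. Qed.

Lemma congZl m n a b (M : 'M[A]_(m, n)) : J (a - b) -> cong J (a *: M) (b *: M).
Proof. by move=> e i j; rewrite -scalerBl mxE mulrC; apply: idealM. Qed.

Lemma cong_sum m n (I : finType) (F G : I -> 'M[A]_(m, n)) :
  (forall i, cong J (F i) (G i)) -> cong J (\sum_i F i) (\sum_i G i).
Proof.
move=> e i j; rewrite -sumrB summxE; apply: ideal_sum => // l _; exact: e.
Qed.

Lemma cong_mul m n p (M N : 'M[A]_(m, n)) (M' N' : 'M[A]_(n, p)) :
  cong J M N -> cong J M' N' -> cong J (M *m M') (N *m N').
Proof.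
move=> e e'; apply: (@cong_trans _ _ _ (N *m M')) => i j.
  rewrite -mulmxBl mxE; apply: ideal_sum => // l _.
  by rewrite mulrC; apply: idealM.
by rewrite -mulmxBr mxE; apply: ideal_sum => // l _; apply: idealM.
Qed.

Definition congb (b b' : bilin A) := forall p, cong J (b p) (b' p).

Lemma cong_bval b b' u u' v v' : congb b b' -> cong J u u' -> cong J v v' ->
  cong J (bval b u v) (bval b' u' v').
Proof.
move=> eb eu ev; apply: cong_sum => i; apply: cong_sum => j.
apply: (@cong_trans _ _ _ ((u i 0 * v j 0) *: b' (i, j))); first exact: congZ.
apply: congZl; have := eu i 0; have := ev j 0; rewrite !mxE => dv du.
rewrite (_ : _ - _ = v j 0 * (u i 0 - u' i 0) + u' i 0 * (v j 0 - v' j 0)); last by ring.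
by apply: idealD => //; apply: idealM.
Qed.

End Cong.

Definition liftmx m n : 'M[k]_(m, n) -> 'M[A]_(m, n) := map_mx (in_alg A).
Definition liftb : bilin k -> bilin A := bmap (in_alg A).

(** The defect along the line k x has its coefficients in k itself, which brings in cochains over
    k. *)
Lemma cong_addline J x m n (M N : 'M[A]_(m, n)) : cong (addline J x) M N ->
  exists C : 'M[k]_(m, n), cong J M (N + x *: liftmx C).
Proof.
move=> e; have [c cP] := fin_all_exists (fun p => e p.1 p.2).
exists (\matrix_(i, j) c (i, j)) => i j; have := cP (i, j).
by rewrite !mxE /= opprD addrA mulr_algr.
Qed.

Lemma liftb_pert t : liftb (pert t) = pert (liftmx t).
Proof. exact: bmap_pert. Qed.

Lemma cong_lift0 J x (b : bilin A) p : ideal J -> cong J (b p) (b p + x *: liftb 0 p).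
Proof.
by move=> iJ; rewrite /liftb !ffunE map_mx0 scaler0 addr0; apply: cong_refl.
Qed.

Section Small.
Variables (J : A -> Prop) (x : A).
Hypotheses (iJ : ideal J) (nx : nilp x) (hx : forall y, nilp y -> J (y * x)).

Lemma congx m n (M N : 'M[A]_(m, n)) : cong (@Defs.nilp A) M N -> cong J (x *: M) (x *: N).
Proof. by move=> e i j; rewrite -scalerBr mxE mulrC; apply: hx; apply: e. Qed.

Lemma cong_xeq0 m n (C : 'M[k]_(m, n)) : ~ J x -> cong J (x *: liftmx C) 0 -> C = 0.
Proof.
move=> Jx e; apply/matrixP=> i j; have := e i j; rewrite !mxE oppr0 addr0 /= mulr_algr.
move=> Jc; apply: NNPP => /eqP c0; apply: Jx.
by rewrite -[x](scalerK c0); apply: idealZ.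
Qed.

Variables (b b' n : bilin A) (d d' : bilin k) (g : 'M[A]_14) (f : 'M[k]_14).
Hypotheses (n_mu : congb (@Defs.nilp A) n mu)
  (bE : forall p, cong J (b p) (n p + x *: liftb d p))
  (bE' : forall p, cong J (b' p) (n p + x *: liftb d' p))
  (gE : cong J g (1%:M + x *: liftmx f)) (Jn : forall y, J y -> nilp y).

Let nilA := nilp_ideal A.

Lemma cong_weak m m' (M N : 'M[A]_(m, m')) : cong J M N -> cong (@Defs.nilp A) M N.
Proof. by move=> e i j; apply/Jn/e. Qed.

Lemma cong_xnil m m' (M : 'M[A]_(m, m')) : cong (@Defs.nilp A) (x *: M) 0.
Proof. by move=> i j; rewrite subr0 mxE mulrC; apply: nilpM. Qed.

Lemma var_mu (c : bilin A) (e : bilin k) : 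
  (forall p, cong J (c p) (n p + x *: liftb e p)) -> congb (@Defs.nilp A) c mu.
Proof.
move=> h p; apply: (cong_trans nilA (cong_weak (h p))).
by rewrite -[mu p]addr0; apply: congD => //; apply: cong_xnil.
Qed.

(** Products of x with a nilpotent lie in J. Hence in every term that carries x the laws may be
    replaced by mu, and the failure of g = 1 + x f to intertwine n + x d with n + x d' is x times
    the cochain d - d' - [ce1] f over k. *)
Lemma first_variation i j :
  cong J (g *m b (i, j) - bval b' (g *m bas i) (g *m bas j))
         (x *: liftmx ((d - d' - ce1 f) (i, j))).
Proof.
have gu (u : 'cV[A]_14) : cong J (g *m u) (u + x *: (liftmx f *m u)).
  rewrite (_ : _ + _ = (1%:M + x *: liftmx f) *m u); last by rewrite mulmxDl mul1mx scalemxAl.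
  by apply: cong_mul => //; apply: cong_refl.
have e1 : cong J (g *m b (i, j)) (n (i, j) + x *: liftb d (i, j) + x *: (liftmx f *m mu (i, j))).
  apply: (cong_trans iJ (gu _)); apply: congD => //.
  apply: congx; apply: cong_mul => //; first exact: cong_refl.
  exact: var_mu bE _.
have e2 : cong J (bval b' (g *m bas i) (g *m bas j))
   (n (i, j) + x *: liftb d' (i, j) +
    x *: (bval mu (liftmx f *m bas i) (bas j) + bval mu (bas i) (liftmx f *m bas j))).
  apply: (cong_trans iJ (N := bval b' (bas i + x *: (liftmx f *m bas i)) (bas j + x *: (liftmx f *m bas j)))).
    by apply: cong_bval => // p; apply: cong_refl.
  set Fi := liftmx f *m bas i; set Fj := liftmx f *m bas j.
  have -> : bval b' (bas i + x *: Fi) (bas j + x *: Fj) = b' (i, j) +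
      x *: (bval b' Fi (bas j) + bval b' (bas i) Fj + x *: bval b' Fi Fj).
    rewrite bvalDl !(raddfD (bval b' _)) /= bval_bas !bvalZl !linearZ /=.
    by apply/colP=> l; rewrite !mxE; ring.
  apply: congD => //; apply: congx; rewrite -[X in cong _ _ X]addr0.
  apply: congD => //; last exact: cong_xnil.
  by apply: congD => //; apply: cong_bval => //; try exact: cong_refl; apply: var_mu bE'.
apply: (cong_trans iJ (congB iJ e1 e2)).
have cE : liftmx (ce1 f (i, j)) = bval mu (bas i) (liftmx f *m bas j)
    + bval mu (liftmx f *m bas i) (bas j) - liftmx f *m mu (i, j).
  rewrite ffunE /liftmx !map_mxB !map_bval !map_mxM !map_bas.
  have -> : bmap (in_alg A) mu = mu by apply: bmap_mu.
  have -> : map_mx (in_alg A) (mu (i, j)) = mu (i, j).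
    by have /ffunP/(_ (i, j)) := bmap_mu (in_alg A); rewrite ffunE.
  congr (_ + _ - _); rewrite [RHS]bval_antisym // => i' j'.
  by rewrite muE of_terms_anti.
have dE (e : bilin k) : liftmx ((d - d' - e) (i, j)) =
    liftb d (i, j) - liftb d' (i, j) - liftmx (e (i, j)).
  by rewrite /liftb /liftmx !ffunE !map_mxB.
rewrite dE cE => l l'; rewrite (_ : _ - _ = 0) ?mxE; first exact: ideal0.
by apply/colP=> m; rewrite !mxE; ring.
Qed.

End Small.
End Congruence.

HB.instance Definition _ (R : comUnitRingType) :=
  GRing.isLinear.Build R _ _ _ (@pert R) (@pert_linear R).

(** * The formal group and the formal neighbourhood of mu *)

Section HatGroup.
Variables (k : fieldType) (A : artAlg k).
Implicit Types (h g : 'M[A]_14) (b : bilin A) (J : A -> Prop).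
Let iN := nilp_ideal A.

Lemma cong_det J m (M N : 'M[A]_m) : ideal J -> cong J M N -> J (\det M - \det N).
Proof.
move=> iJ e; rewrite /determinant -sumrB; apply: ideal_sum => // s _.
rewrite -mulrBr; apply: idealM => //.
apply: (big_ind2 (fun x y => J (x - y))) => [|x x' y y' hx hy|i _].
- by rewrite subrr; apply: ideal0.
- rewrite (_ : _ - _ = y * (x - x') + x' * (y - y')); last by ring.
  by apply: idealD => //; apply: idealM.
- by have := e i (s i); rewrite !mxE.
Qed.

Lemma hatH_intro h : gradedmx h -> cong (@Defs.nilp A) h 1%:M -> hatH h.
Proof.
move=> gh nh; split; last exact: nh.
split=> //; rewrite unitmxE -[\det h](subrK 1) addrC.
by apply: unit_nilp; [exact: unitr1 | rewrite -(det1 A 14); apply: cong_det].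
Qed.

Lemma hatH_cong h : hatH h -> cong (@Defs.nilp A) h 1%:M.
Proof. by case. Qed.

Lemma hatH1 : hatH (1%:M : 'M[A]_14).
Proof. by split; [exact: grGL1 | exact: cong_refl]. Qed.

Lemma hatH_mul h g : hatH h -> hatH g -> hatH (h *m g).
Proof.
move=> hh hg; split; first by apply: grGL_mul; [case: hh | case: hg].
rewrite -/(cong _ _ _) -[X in cong _ _ X]mul1mx.
by apply: cong_mul => //; apply: hatH_cong.
Qed.

Lemma hatH_conj g h : grGL g -> hatH h -> hatH (g *m h *m invmx g).
Proof.
move=> gg hh; have [gu _] := gg; split.
  by apply: grGL_mul; [apply: grGL_mul => //; case: hh | apply: grGL_inv].
rewrite -/(cong _ _ _) -[X in cong _ _ X](mulmxV gu).
apply: cong_mul => //; last exact: cong_refl.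
rewrite -[X in cong _ _ X]mulmx1.
by apply: cong_mul => //; [exact: cong_refl | apply: hatH_cong].
Qed.

Lemma hatH_inv h : hatH h -> hatH (invmx h).
Proof.
move=> hh; have [[hu _] _] := hh; split; first by apply: grGL_inv; case: hh.
rewrite -/(cong _ _ _); apply: cong_sym => //.
rewrite -[X in cong _ X _](mulmxV hu) -[X in cong _ _ X]mul1mx.
by apply: cong_mul => //; [apply: hatH_cong | apply: cong_refl].
Qed.

Lemma hatH_act h b : hatH h -> hatX b -> hatX (act h b).
Proof.
move=> hh [lb nb]; split; first by apply: graded_law_act => //; case: hh.
suff e : congb (@Defs.nilp A) (act h b) mu.
  by move=> p l; have := e p l 0; rewrite !mxE.
have nb' : congb (@Defs.nilp A) b mu.
  by move=> p l j; rewrite (ord1 j).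
move=> -[i j]; rewrite ffunE /= -(mul1mx (mu _)) -(bval_bas mu).
have ci : cong (@Defs.nilp A) (invmx h) 1%:M by apply/hatH_cong/hatH_inv.
apply: cong_mul => //; first exact: hatH_cong.
by apply: cong_bval => //; rewrite -[X in cong _ _ X]mul1mx; apply: cong_mul => //; apply: cong_refl.
Qed.

Lemma cong_pert J (s t : 'cV[A]_11) : ideal J -> cong J s t -> congb J (pert s) (pert t).
Proof.
move=> iJ e.
have pE (u : 'cV[A]_11) p : pert u p = \sum_i u i 0 *: pert (delta_mx i 0) p.
  have {1}-> : u = \sum_i u i 0 *: delta_mx i 0.
    rewrite {1}[u]matrix_sum_delta; apply: eq_bigr => i _; by rewrite big_ord1.
  rewrite linear_sum sum_ffunE; apply: eq_bigr => i _.
  by rewrite linearZ ffunE.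
move=> p; rewrite !pE; apply: cong_sum => // i; apply: congZl => //.
by have := e i 0; rewrite !mxE.
Qed.

Lemma fam_hatX (t : 'cV[A]_11) : (forall i, nilp (t i 0)) -> hatX (fam t).
Proof.
move=> nt; split; first exact: fam_law.
move=> p l; rewrite -(fam0 A).
have : congb (@Defs.nilp A) (pert t) (pert 0).
  by apply: cong_pert => // i j; rewrite (ord1 j) subr0.
by move=> /(_ p l 0); rewrite !(ffunE, mxE) opprD addrACA subrr add0r.
Qed.

(** The chain read backwards: a property modulo all nilpotents descends to the zero ideal through
    one small extension at a time. *)
Lemma chain_descent (P : (A -> Prop) -> Prop) :
  (forall J, ideal J -> (forall x, nilp x -> J x) -> P J) ->
  (forall J x, ideal J -> (forall y, J y -> nilp y) -> nilp x ->
     (forall y, nilp y -> J (y * x)) -> P (addline J x) -> P J) ->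
  P (fun z => z = 0).
Proof.
move=> top step; have [J cJ full] := chain_full A.
have [iJ _] := chain_ideal cJ; have PJ := top _ iJ full.
elim: cJ PJ => // {J iJ full} J x cJ IH nx hx PJ; apply: IH.
have [iJ nJ] := chain_ideal cJ; exact: step PJ.
Qed.

Lemma liftb_addline J x b b' : congb (addline J x) b b' ->
  exists d : bilin k, forall p, cong J (b p) (b' p + x *: liftb A d p).
Proof.
move=> e; have [d dP] := fin_all_exists (fun p => cong_addline (e p)).
by exists (finfun d) => p; rewrite /liftb !ffunE.
Qed.

Lemma ideal_xeq0 J x (c : k) : ideal J -> ~ J x -> J (c *: x) -> c = 0.
Proof.
move=> iJ Jx Jc; apply: NNPP => /eqP c0; apply: Jx.
by rewrite -[x](scalerK c0); apply: idealZ.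
Qed.

(** The difference of the Jacobi identities of b and n is, modulo J, x times the cocycle identity of
    d relative to mu, and x is not in J. *)
Lemma small_cocycle J x b n (d : bilin k) : ideal J -> (forall y, J y -> nilp y) ->
  nilp x -> (forall y, nilp y -> J (y * x)) -> ~ J x ->
  graded_law b -> graded_law n -> congb (@Defs.nilp A) n mu ->
  (forall p, cong J (b p) (n p + x *: liftb A d p)) -> d \in Z2_0.
Proof.
move=> iJ nJ nx hx Jx [[ab gb] jb] [[an gn] jn] n_mu bE.
have ad i j : d (i, j) = - d (j, i).
  apply/eqP; rewrite -addr_eq0; apply/eqP; apply: (cong_xeq0 iJ Jx).
  have := congD iJ (bE (i, j)) (bE (j, i)).
  rewrite {1}ab addNr addrACA {1}an addNr add0r => /(cong_sym iJ).
  by rewrite /liftb /liftmx !ffunE map_mxD scalerDr.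
apply/Z2_0P; split.
  split=> // i j l dl; apply: (ideal_xeq0 iJ Jx).
  have := bE (i, j) l 0; rewrite !(ffunE, mxE) gb // gn // !add0r => /(idealN iJ).
  by rewrite opprK /= mulr_algr.
have b_mu := var_mu nx n_mu nJ bE.
have e u v w : cong J (bval b (bas u) (b (v, w)))
   (bval n (bas u) (n (v, w)) +
    x *: liftmx A (bval d (bas u) (mu (v, w)) + bval mu (bas u) (d (v, w)))).
  apply: (cong_trans iJ (N := bval (n + [ffun p => x *: liftb A d p]) (bas u)
      (n (v, w) + x *: liftb A d (v, w)))).
    apply: cong_bval => //; last exact: cong_refl.
    by move=> p; rewrite !ffunE; have := bE p; rewrite /liftb ffunE.
  have bZ u' v' : bval [ffun p => x *: liftb A d p] u' v' = x *: bval (liftb A d) u' v'.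
    rewrite /bval !scaler_sumr; apply: eq_bigr => i _; rewrite scaler_sumr.
    by apply: eq_bigr => j _; rewrite ffunE !scalerA mulrC.
  rewrite !bval_addf !(raddfD (bval _ _)) /= !linearZ /= !bZ.
  rewrite (_ : bval n _ _ + _ + _ = bval n (bas u) (n (v, w)) + 
     x *: (bval (liftb A d) (bas u) (n (v, w)) + bval n (bas u) (liftb A d (v, w)) +
           x *: bval (liftb A d) (bas u) (liftb A d (v, w)))); last first.
    by apply/colP=> l; rewrite !mxE; ring.
  apply: congD => //; first exact: cong_refl.
  apply: congx => //; rewrite -[X in cong _ _ X]addr0 /liftmx map_mxD !map_bval map_bas.
  rewrite (_ : bmap (in_alg A) mu = mu); last exact: bmap_mu.
  rewrite (_ : map_mx (in_alg A) (mu (v, w)) = mu (v, w)); last first.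
    by have /ffunP/(_ (v, w)) := bmap_mu (in_alg A); rewrite ffunE.
  apply: congD => //; last exact: cong_xnil.
  apply: congD => //; apply: cong_bval => //; try exact: cong_refl.
  - by move=> p; rewrite /liftb; apply: cong_refl.
  - by rewrite /liftb ffunE; apply: cong_refl.
have jac u v w :
  (bval d (bas u) (mu (v, w)) + bval mu (bas u) (d (v, w))) +
  (bval d (bas v) (mu (w, u)) + bval mu (bas v) (d (w, u))) +
  (bval d (bas w) (mu (u, v)) + bval mu (bas w) (d (u, v))) = 0.
  apply: (cong_xeq0 iJ Jx).
  have := congD iJ (congD iJ (e u v w) (e v w u)) (e w u v).
  have := jb (bas u) (bas v) (bas w); rewrite !bval_bas => ->.
  have := jn (bas u) (bas v) (bas w); rewrite !bval_bas => jn' h.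
  apply: (cong_sym iJ); apply: (cong_trans iJ h); rewrite -[X in cong _ _ X]add0r -jn'.
  rewrite /liftmx !map_mxD /= -/(liftmx _ _) => l l'.
  rewrite (_ : _ - _ = 0) ?mxE; first exact: ideal0.
  by apply/colP=> m; rewrite !mxE; ring.
(* Skew-symmetry of d and mu turns the cyclic sum into the alternating sum of [ce2]. *)
apply/ffunP=> -[[u v] w]; rewrite !ffunE /= -[RHS](jac u v w) !bval_bas.
have am : forall i j, mu (i, j) = - mu (j, i) :> 'cV[k]_14.
  by move=> i j; rewrite muE of_terms_anti.
rewrite (bval_antisym (b := d) (mu _) (bas w)) // (bval_antisym (b := d) (mu _) (bas v)) //.
rewrite (bval_antisym (b := d) (mu _) (bas u)) // (ad u w) (am u w) !linearN /=.
by apply/colP=> m; rewrite !mxE; ring.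
Qed.

End HatGroup.

(** The grading derivation, which generates the Lie algebra of the Carnot torus. *)
Definition euler (k : fieldType) : 'M[k]_14 := diag_mx (\row_i (deg i)%:R).

(** * Existence and uniqueness of the normal form *)

Section Versal.
Variables (k : fieldType) (A : artAlg k).
Implicit Types (h g : 'M[A]_14) (b : bilin A) (J : A -> Prop).
Let iN := nilp_ideal A.
(** Assumed here and proved further on, with the help of [hatH_small] and [carnot_cong] from this
    section. *)
Hypothesis spanning : forall d : bilin k, d \in Z2_0 ->
  exists t f, gradedmx f /\ d = pert t + ce1 f.
Hypothesis independent : forall t (f : 'M[k]_14), gradedmx f -> pert t + ce1 f = 0 ->
  t = 0 /\ exists c, f = c *: euler k.

Lemma hatX_cong b : hatX b -> congb (@Defs.nilp A) b mu.
Proof. by case=> _ nb p l j; rewrite (ord1 j). Qed.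

Lemma cong_eq0 m n (M N : 'M[A]_(m, n)) : cong (fun z : A => z = 0) M N -> M = N.
Proof. by move=> e; apply/matrixP=> i j; apply/eqP; rewrite -subr_eq0; have := e i j; rewrite !mxE => ->. Qed.

Lemma hatH_small x (f : 'M[k]_14) : nilp x -> gradedmx f ->
  hatH (1%:M + x *: liftmx A f).
Proof.
move=> nx gf; apply: hatH_intro => [i j ne|].
  by rewrite !mxE gf // rmorph0 mulr0 addr0; have := (grGL1 A).2 i j ne; rewrite mxE.
rewrite -[X in cong _ _ X]addr0; apply: congD => //; [exact: cong_refl | exact: cong_xnil].
Qed.

Lemma cong_act J g b b' : ideal J -> g \in unitmx ->
  (forall i j, cong J (g *m b (i, j)) (bval b' (g *m bas i) (g *m bas j))) ->
  congb J (act g b) b'.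
Proof.
move=> iJ gu e [i j]; rewrite ffunE /=.
pose c1 : bilin A := [ffun p => g *m b p].
pose c2 : bilin A := [ffun p => bval b' (g *m bas p.1) (g *m bas p.2)].
have e1 u v : g *m bval b u v = bval c1 u v.
  rewrite /bval mulmx_sumr; apply: eq_bigr => m _; rewrite mulmx_sumr.
  by apply: eq_bigr => n _; rewrite -scalemxAr ffunE.
have e2 : forall u v, bval b' (g *m u) (g *m v) = bval c2 u v.
  apply: bilin_ext => [v|u|v|u|m n]; last by rewrite bval_bas ffunE.
  - by move=> c x y; rewrite mulmxDr -scalemxAr bvalDl bvalZl.
  - by move=> c x y; rewrite mulmxDr -scalemxAr linearP.
  - by move=> c x y; rewrite bvalDl bvalZl.
  - by move=> c x y; rewrite linearP.
rewrite e1 -[X in cong _ _ X]bval_bas -{2}(mulKVmx gu (bas i)) -{2}(mulKVmx gu (bas j)) e2.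
apply: cong_bval => //; try exact: cong_refl.
by move=> [m n]; rewrite !ffunE.
Qed.

(** At a small extension the defect is a cocycle d = [pert] a + [ce1] f; adding x a to t and
    multiplying h by 1 + x f removes it. *)
Lemma versal_exists b : hatX b -> exists h (t : 'cV[A]_11),
  [/\ hatH h, forall i, nilp (t i 0) & act h b = fam t].
Proof.
move=> Xb; suff [h [t [hh nt e]]] : exists h (t : 'cV[A]_11), [/\ hatH h, forall i, nilp (t i 0) &
    congb (fun z : A => z = 0) (act h b) (fam t)].
  by exists h, t; split=> //; apply/ffunP=> p; apply: cong_eq0.
pose P J := exists h (t : 'cV[A]_11), [/\ hatH h, forall i, nilp (t i 0) & congb J (act h b) (fam t)].
rewrite -/(P _); apply: chain_descent => [J iJ full|J x iJ nJ nx hx [h [t [hh nt e]]]].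
  exists 1%:M, 0; split; [exact: hatH1 | by move=> i; rewrite mxE; apply: nilp0 |].
  by rewrite act1 fam0 => p i j; apply/full/(hatX_cong Xb).
(* A step of the chain may leave the ideal unchanged. *)
have [Jx|Jx] := classic (J x).
  exists h, t; split=> // p i j; have [c hc] := e p i j.
  by rewrite -[X in J X](subrK (c *: x)); apply: idealD => //; apply: idealZ.
have Xb' := hatH_act hh Xb; have Xt := fam_hatX nt.
have [d bE] := liftb_addline e.
have [a [f [gf dE]]] : exists t f, gradedmx f /\ d = pert t + ce1 f.
  by apply/spanning/(small_cocycle iJ nJ nx hx Jx Xb'.1 Xt.1 (hatX_cong Xt) bE).
pose g : 'M[A]_14 := 1%:M + x *: liftmx A f; pose t' := t + x *: liftmx A a.
have hg : hatH g by apply: hatH_small.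
have bE' p : cong J (fam t' p) (fam t p + x *: liftb A (pert a) p).
  by rewrite liftb_pert -famD; apply: cong_refl.
exists (g *m h), t'; split; first exact: hatH_mul.
  by move=> i; rewrite !mxE; apply: nilpD => //; rewrite mulrC; apply: nilpM.
have [[hu _] _] := hh; have [[gu _] _] := hg.
rewrite act_mul //; set b1 := act h b in bE *.
have e' i j : cong J (g *m b1 (i, j)) (bval (fam t') (g *m bas i) (g *m bas j)).
  have := first_variation iJ nx hx (hatX_cong Xt) bE bE' (cong_refl iJ g) nJ i j.
  rewrite dE (_ : (_ - _ - _) = 0); last first.
    by rewrite (addrC (pert a)) addrK subrr.
  rewrite [X in liftmx A X]ffunE /liftmx map_mx0 scaler0 => h0 l l'.
  by have := h0 l l'; rewrite subr0.
exact: cong_act.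
Qed.

(** As x^2 lies in J, (1 + c x)^i is 1 + i c x. *)
Lemma carnot_cong J x c : ideal J -> J (x * x) ->
  cong J (carnot (1 + c *: x)) (1%:M + x *: liftmx A (c *: euler k)).
Proof.
move=> iJ Jx i j; rewrite !mxE.
case: (i == j); rewrite ?mulr0n ?mulr1n; last first.
  by rewrite mulr0 rmorph0 mulr0 addr0 subr0; apply: ideal0.
elim: (deg i) => [|n IHn].
  by rewrite expr0 mulr0 rmorph0 mulr0 addr0 subrr; apply: ideal0.
rewrite exprS.
have -> : (1 + c *: x) * (1 + c *: x) ^+ n - (1 + x * in_alg A (c * n.+1%:R)) =
  (1 + c *: x) * ((1 + c *: x) ^+ n - (1 + x * in_alg A (c * n%:R))) +
  in_alg A (c * c * n%:R) * (x * x).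
  rewrite -(mulr_algl c x) -in_algE !rmorphM -natr1 rmorphD rmorph1.
  have aux (E c' n' : A) : (1 + c' * x) * E - (1 + x * (c' * (n' + 1))) =
    (1 + c' * x) * (E - (1 + x * (c' * n'))) + c' * c' * n' * (x * x) by ring.
  exact: aux.
by apply: idealD => //; apply: idealM.
Qed.

(** The induction carries a group element g congruent to 1 modulo J. By [independent], t and t'
    agree at the next stage and g is 1 + c x times the grading derivation there; a torus element,
    which fixes graded laws, makes it congruent to 1 again. *)
Lemma versal_unique h (t t' : 'cV[A]_11) : hatH h -> (forall i, nilp (t i 0)) ->
  (forall i, nilp (t' i 0)) -> act h (fam t) = fam t' -> t' = t.
Proof.
move=> hh nt nt' e; pose P J := exists g, [/\ hatH g, cong J g 1%:M,
  act g (fam t) = fam t' & cong J t' t].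
suff [g [_ _ _]] : P (fun z => z = 0) by apply: cong_eq0.
apply: chain_descent => [J iJ full|J x iJ nJ nx hx [g [hg g1 eg tt']]].
  exists h; split=> // i j; first by apply/full/(hatH_cong hh).
  by rewrite (ord1 j) !mxE; apply/full/nilpB.
have [Jx|Jx] := classic (J x).
  have sub z : addline J x z -> J z.
    by case=> c hc; rewrite -[z](subrK (c *: x)); apply: idealD => //; apply: idealZ.
  by exists g; split=> // i j; apply: sub.
have [f gE] := cong_addline g1; have [a tE] := cong_addline tt'.
have gf : gradedmx f.
  move=> i j ne; apply: (ideal_xeq0 iJ Jx).
  have := gE i j; rewrite !mxE (proj2 (proj1 hg)) //.
  have := (grGL1 A).2 i j ne; rewrite mxE => ->.
  by rewrite !add0r => /(idealN iJ); rewrite opprK /= mulr_algr.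
have bE p := cong_lift0 x (fam t) p iJ.
have bE' p : cong J (fam t' p) (fam t p + x *: liftb A (pert a) p).
  rewrite liftb_pert -famD !bilinDE; apply: congD => //; first exact: cong_refl.
  exact: cong_pert tE p.
have Xt := fam_hatX nt; have [[gu _] _] := hg.
have eq0 : pert a + ce1 f = 0.
  apply/eqP; rewrite -oppr_eq0; apply/eqP/ffunP=> -[i j]; rewrite [RHS]ffunE.
  apply: (cong_xeq0 iJ Jx); rewrite opprD -[- pert a]add0r.
  have := first_variation iJ nx hx (hatX_cong Xt) bE bE' gE nJ i j.
  have /actP-/(_ gu) := eg; move=> /(_ (bas i) (bas j)); rewrite bval_bas => ->.
  by rewrite subrr => /(cong_sym iJ).
have [a0 [c fE]] := independent gf eq0.
have xx : J (x * x) by apply: hx.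
have cu : 1 + (- c) *: x \is a GRing.unit.
  by apply: unit_nilp; [exact: unitr1 | exact: nilpZ].
exists (carnot (1 + (- c) *: x) *m g).
have hc : hatH (carnot (1 + (- c) *: x)).
  apply: hatH_intro; first by case: (carnot_grGL cu).
  apply: (cong_trans iN (cong_weak nJ (carnot_cong (- c) iJ xx))).
  rewrite -[X in cong _ _ X]addr0; apply: congD => //; [exact: cong_refl | exact: cong_xnil].
have [[cU _] _] := hc; split; first exact: hatH_mul.
- apply: (cong_trans iJ (cong_mul iJ (carnot_cong (- c) iJ xx) gE)).
  rewrite fE; set E := liftmx A (c *: euler k).
  have -> : liftmx A (- c *: euler k) = - E by rewrite scaleNr /liftmx map_mxN.
  have -> : (1%:M + x *: - E) *m (1%:M + x *: E) = 1%:M + (- (x * x)) *: (E *m E).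
    rewrite scalerN mulmxDl mul1mx mulmxDr mulmx1 mulNmx -scalemxAl -scalemxAr scalerA.
    by move: (E *m E) => EE; apply/matrixP=> i j; rewrite !mxE; ring.
  rewrite -[X in cong _ _ X]addr0; apply: congD => //; first exact: cong_refl.
  by rewrite -(scale0r (E *m E)); apply: congZl => //; rewrite subr0; apply: idealN.
- rewrite act_mul // eg; apply/actP => //; apply: carnot_intertw; exact: fam_graded.
- by have := tE; rewrite a0 /liftmx map_mx0 scaler0 addr0.
Qed.

End Versal.

(** * Top components *)

Section Dual.
Variable k : fieldType.
Local Notation D := (dual k).
Local Notation e := (eps k).

Lemma val_eps : (e : {poly k}) = 'X.
Proof.
rewrite /eps /= mk_monicX2 -Pdiv.IdomainMonic.modpE ?monicXn // modp_small //.
by rewrite size_polyXn size_polyX.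
Qed.

Lemma dual_coord (x : D) : x = ((x : {poly k})`_0)%:A + (x : {poly k})`_1 *: e.
Proof.
apply: val_inj.
change ((x : {poly k}) = (x : {poly k})`_0 *: 1 + (x : {poly k})`_1 *: (e : {poly k})).
rewrite val_eps; apply/polyP=> -[|[|i]].
- by rewrite !coefE /= ?mulr0 ?mulr1 ?addr0.
- by rewrite !coefE /= ?mulr0 ?mulr1 ?add0r.
rewrite !coefE /= ?mulr0 ?addr0.
apply: nth_default; apply: leq_trans (size_npoly (x : {poly %/ ('X^2 : {poly k})})) _.
by rewrite mk_monicX2 size_polyXn.
Qed.

Lemma eps_sq : e * e = 0.
Proof.
apply: val_inj.
change (Pdiv.CommonRing.rmodp ((e : {poly k}) * (e : {poly k})) (mk_monic ('X^2 : {poly k})) = 0).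
rewrite val_eps -expr2 mk_monicX2.
by rewrite -Pdiv.IdomainMonic.modpE ?monicXn // modpp.
Qed.

Lemma eps_inj (c : k) : c *: e = 0 -> c = 0.
Proof.
move/(congr1 (fun x : D => (x : {poly k})`_1)); 
rewrite -[LHS]/((c *: (e : {poly k}))`_1) val_eps.
by rewrite !coefE /= mulr1.
Qed.

Lemma eps_neq0 : e <> 0.
Proof.
by move=> e0; have := @eps_inj 1; rewrite scale1r => /(_ e0)/eqP; rewrite oner_eq0.
Qed.

Lemma nilp_eps : nilp e.
Proof. by exists 2%N; rewrite expr2 eps_sq. Qed.

Lemma nilp_dual (x : D) : nilp x -> exists c : k, x = c *: e.
Proof.
move=> nx; have xE := dual_coord x; exists ((x : {poly k})`_1).
rewrite {1}xE (_ : (x : {poly k})`_0 = 0) ?scale0r ?add0r //.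
apply: (@alg_nilp k D); rewrite -[X in nilp X](addrK ((x : {poly k})`_1 *: e)) -xE.
by apply: nilpB => //; apply: nilpZ; apply: nilp_eps.
Qed.

Lemma nilpM_dual (x y : D) : nilp x -> nilp y -> x * y = 0.
Proof.
move=> /nilp_dual[c ->] /nilp_dual[d ->].
by rewrite -scalerAl -scalerAr eps_sq !scaler0.
Qed.

End Dual.

Section Independent.
Variable k : fieldType.
Hypothesis char0 : [pchar k] =i pred0.
Implicit Types f : 'M[k]_14.

Lemma mu_high (R : comUnitRingType) (u v : 'cV[R]_14) :
  co u 0 = 0 -> co u 1 = 0 -> co v 0 = 0 -> co v 1 = 0 -> bval mu u v = 0.
Proof.
move=> u0 u1 v0 v1; rewrite muE; apply: coP => n nP; rewrite co_bval // co0.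
move: n nP; apply: lt14P; rewrite /= /bX /bY ?u0 ?u1 ?v0 ?v1; ring.
Qed.

Lemma co_bas_low (R : comUnitRingType) (m : 'I_14) n : (1 < deg m)%N -> (n < 2)%N ->
  co (bas m : 'cV[R]_14) n = 0.
Proof.
move=> hm nP; have n14 : (n < 14)%N by apply: leq_trans nP _.
rewrite co_bas //; case: eqP => // em; move: hm; rewrite /deg em.
by case: n nP {n14 em} => [|[]].
Qed.

Lemma top_pair_low d e : top_pair d e -> (1 < d)%N /\ (1 < e)%N.
Proof. by rewrite /top_pair !inE => /or3P[] /eqP[-> ->]. Qed.

Lemma mu_top_pair (R : comUnitRingType) i j : top_pair (deg i) (deg j) ->
  mu (i, j) = 0 :> 'cV[R]_14.
Proof. by case/top_pair_low => hi hj; rewrite -bval_bas mu_high ?co_bas_low. Qed.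

(** The bracket mu vanishes on arguments of degree at least 2, and f preserves degrees. The top part
    of a cocycle therefore depends only on its class. *)
Lemma ce1_top f i j : gradedmx f -> top_pair (deg i) (deg j) -> ce1 f (i, j) = 0.
Proof.
move=> gf hij; have [hi hj] := top_pair_low hij.
have low (n : nat) : (n < 2)%N -> deg (inord n) = 1%N.
  by case: n => [|[|]] // _; rewrite /deg inordK.
have fz (m : 'I_14) n : (1 < deg m)%N -> (n < 2)%N -> co (f *m bas m) n = 0.
  by move=> hm nP; rewrite /co mul_bas gf // low // neq_ltn hm.
rewrite ffunE /= (mu_high (u := bas i)) ?co_bas_low ?fz //.
by rewrite (mu_high (u := bas j)) ?co_bas_low ?fz // mu_top_pair // mulmx0 !subr0.
Qed.

Lemma pert_top (R : comUnitRingType) (t : 'cV[R]_11) :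
  [/\ pert t (inord bZ0, inord bZx2) = t (inord 3) 0 *: be R bT0 + t (inord 4) 0 *: be R bT1,
      pert t (inord bZ0, inord bZxy) = 2 *: (t (inord 5) 0 *: be R bT0 + t (inord 6) 0 *: be R bT1),
      pert t (inord bZ0, inord bZy2) = t (inord 7) 0 *: be R bT0 + t (inord 8) 0 *: be R bT1 &
      pert t (inord bZx, inord bZy) = t (inord 9) 0 *: be R bT0 + t (inord 10) 0 *: be R bT1].
Proof.
split; rewrite -bval_bas; apply: coP => n nP;
  rewrite /pert co_bval // ?coZ coD ?coZ !co_be //;
  move: n nP; apply: lt14P; rewrite /= ?co_bas ?inordK //=; ring.
Qed.

End Independent.

Section TopPart.
Variable R : comUnitRingType.
Implicit Types b w : bilin R.

Definition top_part b : bilin R :=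
  [ffun p => if top_pair (deg p.1) (deg p.2) then b p else 0].

Lemma top_pairC d e : top_pair d e = top_pair e d.
Proof.
rewrite /top_pair !inE !xpair_eqE.
by rewrite (andbC (e == 2)) (andbC (e == 4)) (andbC (e == 3)) orbCA.
Qed.

Lemma top_part_in b : graded_alt b -> in_top (top_part b).
Proof.
move=> [ab gb]; split; last by move=> i j /negPf ne; rewrite ffunE /= ne.
split=> [i j|i j l ne]; rewrite !ffunE /=.
  by rewrite top_pairC; case: ifP => _; rewrite ?oppr0.
by case: ifP => _; rewrite ?mxE // gb.
Qed.

Lemma bval_top_part b d e (u v : 'cV[R]_14) :
  (forall m, deg m != d -> u m 0 = 0) -> (forall m, deg m != e -> v m 0 = 0) ->
  bval (top_part b) u v = if top_pair d e then bval b u v else 0.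
Proof.
move=> hu hv; transitivity (\sum_i \sum_j (u i 0 * v j 0) *:
    (if top_pair d e then b (i, j) else 0)); last first.
  case: ifP => // _; rewrite big1 // => i _; rewrite big1 // => j _.
  by rewrite scaler0.
apply: eq_bigr => i _; apply: eq_bigr => j _; rewrite ffunE /=.
case: (eqVneq (deg i) d) => [->|/hu ->]; last by rewrite !mul0r !scale0r.
by case: (eqVneq (deg j) e) => [->|/hv ->] //; rewrite !mulr0 !scale0r.
Qed.

(** A graded change of basis preserves every L_d, hence the summand supported on the top pairs. *)
Lemma act_top_part h b : grGL h -> act h (top_part b) = top_part (act h b).
Proof.
move=> hh; have [hu gh] := hh; apply/actP => //; apply: intertw_bas => i j.
have hb m : forall l, deg l != deg m -> (h *m bas m) l 0 = 0.
  by move=> l ne; rewrite mul_bas gh.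
rewrite (bval_top_part _ (hb i) (hb j)) ffunE /= bval_act !mulKmx // bval_bas.
by case: ifP => // _; rewrite mulmx0.
Qed.

Lemma top_part_mu : top_part mu = 0.
Proof.
apply/ffunP=> -[i j]; rewrite [LHS]ffunE [RHS]ffunE /=.
by case: ifP => // /mu_top_pair.
Qed.

Lemma top_partD b b' : top_part (b + b') = top_part b + top_part b'.
Proof.
apply/ffunP=> p; rewrite [LHS]ffunE [RHS]ffunE [X in _ = X + _]ffunE [X in _ = _ + X]ffunE.
by case: ifP => _; rewrite ?addr0 // ffunE.
Qed.

Lemma top_part0 : top_part 0 = 0.
Proof. by apply/ffunP=> p; rewrite !ffunE; case: ifP. Qed.

Lemma top_part_fam t : top_part (fam t) = top_part (pert t).
Proof. by rewrite /fam top_partD top_part_mu add0r. Qed.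

Lemma top_part_co b i j : top_pair (wt i) (wt j) -> (i < 14)%N -> (j < 14)%N ->
  top_part b (inord i, inord j) = b (inord i, inord j).
Proof. by move=> tij iP jP; rewrite ffunE /= /deg !inordK // -!/(wt _) tij. Qed.

Hypothesis u2 : (2 : R) \is a GRing.unit.

(** Up to order, these four are the pairs of distinct basis vectors of degrees (2, 4) and (3, 3);
    the unit 2 handles equal arguments. *)
Lemma in_top_ext w w' : in_top w -> in_top w' ->
  (forall i j, (i, j) \in [:: (2, 5); (2, 6); (2, 7); (3, 4)]%N ->
     w (inord i, inord j) = w' (inord i, inord j)) -> w = w'.
Proof.
move=> [[aw gw] tw] [[aw' gw'] tw'] e; apply/ffunP=> -[i j].
case: (boolP (top_pair (deg i) (deg j))) => [|ne]; last by rewrite tw // tw'.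
have d0 (b : bilin R) m : (forall i j, b (i, j) = - b (j, i)) -> b (m, m) = 0.
  move=> a; apply/colP=> l; apply: (mulrI u2); rewrite [RHS]mulrC mxE mul0r.
  by rewrite mulr_natl mulr2n {1}a mxE addNr.
rewrite -[i]inord_val -[j]inord_val; move: (val i) (val j) (ltn_ord i) (ltn_ord j).
move=> {i j} i j iP jP; rewrite /deg !inordK // -!/(wt _).
wlog ij : i j iP jP / (i <= j)%N.
  by move=> W; case: (leqP i j) => [|/ltnW] /W h t; first exact: h;
    rewrite aw aw' h // top_pairC.
case: (ltngtP i j) ij => // [ij|<-] _; last by rewrite !d0.
have := e i j; move: j jP ij; move: i iP; apply: lt14P; apply: lt14P => //= _ h _;
  by apply: h.
Qed.

End TopPart.

Section TopCoordinates.
Variable k : fieldType.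
Hypothesis char0 : [pchar k] =i pred0.

Lemma two_neq0 : 2 != 0 :> k.
Proof. by rewrite (pcharf0P k).1. Qed.

Section Algebra.
Variable A : comUnitAlgType k.

(** Scaling by an element of k commutes with algebra maps by linearity. *)
Definition halve (x : A) : A := (2^-1 : k) *: x.

Lemma halveK x : 2 * halve x = x.
Proof. by rewrite /halve -scalerAr mulr_natl -scaler_nat scalerA mulVf ?scale1r // two_neq0. Qed.

Lemma halve2 x : halve (2 * x) = x.
Proof. by rewrite /halve mulr_natl -scaler_nat scalerA mulVf ?scale1r // two_neq0. Qed.

(** Recovers t from its first three entries and its top part; two entries are halved since the
    family takes the value 2 v on (Z_0, Z_xy). *)
Definition of_top (q0 q1 q2 : A) (w : bilin A) : 'cV[A]_11 :=
  let c i j l := w (inord i, inord j) (inord l) 0 in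
  \col_i [:: q0; q1; q2; c 2 5 12; c 2 5 13; halve (c 2 6 12); halve (c 2 6 13);
             c 2 7 12; c 2 7 13; c 3 4 12; c 3 4 13]%N`_i.

Lemma of_topK q0 q1 q2 w : in_top w -> top_part (pert (of_top q0 q1 q2 w)) = w.
Proof.
move=> tw; apply: (in_top_ext (two_unit char0 A)) => //.
  by apply: top_part_in; apply: of_terms_graded.
have [[aw gw] _] := tw.
have wE i j : (i < 14)%N -> (j < 14)%N -> (wt i + wt j = 6)%N ->
    w (inord i, inord j) = w (inord i, inord j) (inord 12) 0 *: be A bT0
      + w (inord i, inord j) (inord 13) 0 *: be A bT1.
  move=> iP jP e; apply: coP => n nP; rewrite coD !coZ !co_be //.
  have g m : (m < 14)%N -> wt m != 6 -> co (w (inord i, inord j)) m = 0.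
    by move=> mP ne; rewrite /co gw // /deg !inordK // -!/(wt _) e.
  move: n nP; apply: lt14P; do 1?[by rewrite g // !mulr0 addr0];
    by rewrite /= ?mulr0 ?mulr1 ?addr0 ?add0r.
have [e1 e2 e3 e4] := pert_top (of_top q0 q1 q2 w).
move=> i j; rewrite !inE => /or4P[] /eqP[-> ->]; rewrite top_part_co // wE //.
- by rewrite [LHS]e1 !mxE !inordK.
- by rewrite [LHS]e2 !mxE !inordK //= scalerDr !scalerA !halveK.
- by rewrite [LHS]e3 !mxE !inordK.
- by rewrite [LHS]e4 !mxE !inordK.
Qed.

Lemma top_of (t : 'cV[A]_11) :
  of_top (t (inord 0) 0) (t (inord 1) 0) (t (inord 2) 0) (top_part (pert t)) = t.
Proof.
have [e1 e2 e3 e4] := pert_top t.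
apply/colP=> i; rewrite mxE !top_part_co // e1 e2 e3 e4 -!/(co _ _).
rewrite !(coZ, coD) !co_be //= !(mulr0, mulr1, addr0, add0r) !halve2.
rewrite -[in RHS](inord_val i).
by case: i => [[|[|[|[|[|[|[|[|[|[|[|[]]]]]]]]]]]] iP] //=.
Qed.

Lemma top_part_eq0 (t : 'cV[A]_11) : top_part (pert t) = 0 ->
  t = metab (t (inord 0) 0) (t (inord 1) 0) (t (inord 2) 0).
Proof.
move=> t0; rewrite -[LHS]top_of t0; apply/colP=> i; rewrite !mxE !ffunE !mxE.
have h0 : halve 0 = 0 by rewrite /halve scaler0.
by case: i => [[|[|[|[|[|[|[|[|[|[|[|[]]]]]]]]]]]] iP] //=; rewrite nth_nil.
Qed.

Lemma top_part_metab (q0 q1 q2 : A) : top_part (pert (metab q0 q1 q2)) = 0.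
Proof.
apply: (in_top_ext (two_unit char0 A)).
- by apply: top_part_in; apply: of_terms_graded.
- split; last by move=> i j _; rewrite ffunE.
  by split=> [i j|i j l _]; rewrite !ffunE ?oppr0 // mxE.
have [e1 e2 e3 e4] := pert_top (metab q0 q1 q2).
by move=> i j; rewrite !inE => /or4P[] /eqP[-> ->]; rewrite top_part_co // [RHS]ffunE;
  [rewrite e1 | rewrite e2 | rewrite e3 | rewrite e4];
  rewrite !mxE !inordK //= !scale0r addr0 ?scaler0.
Qed.

Lemma fam_be (t : 'cV[A]_11) i j l : (i, j, l) \in [:: (0, 1, 2); (0, 2, 3); (1, 2, 4); (0, 3, 5); (0, 4, 6); (1, 4, 7)]%N ->
  bval (fam t) (be A i) (be A j) = be A l.
Proof.
move=> h; apply: coP => n nP; rewrite famE co_bval //; move: h; rewrite !inE.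
by do ?case/orP; case/eqP=> -> -> ->;
  move: n nP; apply: lt14P; rewrite /= ?co_be //=; ring.
Qed.

(** The basis vectors of L_2, L_3 and L_4 are brackets in every member of the family, by [fam_be];
    brackets between them vanish in a metabelian law. *)
Lemma metabelian_top (t : 'cV[A]_11) : metabelian (fam t) -> top_part (pert t) = 0.
Proof.
move=> mt; rewrite -top_part_fam; apply: (in_top_ext (two_unit char0 A)).
- by apply/top_part_in/fam_graded.
- split; last by move=> i j _; rewrite ffunE.
  by split=> [i j|i j l _]; rewrite !ffunE ?oppr0 // mxE.
move=> i j hij; rewrite [RHS]ffunE.
have [tij iP jP] : [/\ top_pair (wt i) (wt j), i < 14 & j < 14]%N.
  by move: hij; rewrite !inE => /or4P[] /eqP[-> ->].
rewrite top_part_co // -bval_bas -!/(be A _).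
by move: hij; rewrite !inE => /or4P[] /eqP[-> ->];
  rewrite ?(esym (@fam_be t 0 3 5 isT)) ?(esym (@fam_be t 0 4 6 isT))
    ?(esym (@fam_be t 1 4 7 isT)) ?(esym (@fam_be t 0 1 2 isT)) ?(esym (@fam_be t 0 2 3 isT))
    ?(esym (@fam_be t 1 2 4 isT)) mt.
Qed.

Lemma metab_metabelian (q0 q1 q2 : A) : metabelian (fam (metab q0 q1 q2)).
Proof.
have lo u v n : (n < 2)%N -> co (bval (fam (metab q0 q1 q2)) u v) n = 0.
  by case: n => [|[|]] // _; rewrite famE co_bval.
move=> u v w z; move: (lo u v) (lo w z).
move: (bval _ u v) (bval _ w z) => x y hx hy.
have [x0 x1 y0 y1] : [/\ co x 0 = 0, co x 1 = 0, co y 0 = 0 & co y 1 = 0] by split; auto.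
apply: coP => n nP; rewrite famE co_bval // co0.
move: n nP; apply: lt14P; rewrite /= ?mxE ?inordK //= /bX /bY ?x0 ?x1 ?y0 ?y1; ring.
Qed.

End Algebra.

Lemma map_of_top (A B : comUnitAlgType k) (f : {lrmorphism A -> B}) q0 q1 q2 w :
  map_mx f (of_top q0 q1 q2 w) = of_top (f q0) (f q1) (f q2) (bmap f w).
Proof.
apply/colP=> i; rewrite !mxE !ffunE !mxE /halve -!linearZ.
by case: i => [[|[|[|[|[|[|[|[|[|[|[|[]]]]]]]]]]]] iP] /=; rewrite ?linearZ.
Qed.

Lemma map_top_part (R S : comUnitRingType) (f : {rmorphism R -> S}) (b : bilin R) :
  bmap f (top_part b) = top_part (bmap f b).
Proof. by apply/ffunP=> p; rewrite !ffunE; case: ifP => // _; rewrite map_mx0. Qed.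

Lemma top_part_ce1 (f : 'M[k]_14) : gradedmx f -> top_part (ce1 f) = 0.
Proof.
move=> gf; apply/ffunP=> -[i j]; rewrite [LHS]ffunE [RHS]ffunE /=.
by case: ifP => // hij; apply: ce1_top.
Qed.

Lemma top_part_pert_eq0 (t : 'cV[k]_11) : top_part (pert t) = 0 ->
  t = metab (t (inord 0) 0) (t (inord 1) 0) (t (inord 2) 0).
Proof. exact: (@top_part_eq0 k^o). Qed.

End TopCoordinates.

(** * Cocycles and coboundaries *)

Section Independent.
Variable k : fieldType.
Hypothesis char0 : [pchar k] =i pred0.
Implicit Types f : 'M[k]_14.

Section SmallAlgebra.
Variables (D : artAlg k) (e : D).
Hypotheses (ne : nilp e) (e0 : e <> 0) (he : forall y : D, nilp y -> y * e = 0).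

Lemma eps_eq (c d : k) : e * c%:A = e * d%:A -> c = d.
Proof.
move/eqP; rewrite -subr_eq0 -mulrBr -scalerBl mulr_algr => /eqP cd.
by apply/eqP; rewrite -subr_eq0; apply/negPn/negP => /scalerK h; case: e0; rewrite -[e]h cd scaler0.
Qed.

(** A relation between [pert] t and a coboundary says that 1 + e f intertwines mu with the family at
    e t, so the quartic relations apply. Here e abstracts the generator of the dual numbers. *)
Lemma first_order_gl2 (t : 'cV[k]_11) f : gradedmx f -> pert t + ce1 f = 0 ->
  t = metab (t (inord 0) 0) (t (inord 1) 0) (t (inord 2) 0) ->
  let g := 1%:M + e *: liftmx D f in
  let q i := e * (t (inord i) 0)%:A in
  let c i j := e * (f (inord i) (inord j))%:A in
  [/\ gradedmx g, intertw g mu (fam (metab (q 0%N) (q 1%N) (q 2%N))),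
      g *m be D bX = vec [:: 1 + c 0%N 0%N; c 1%N 0%N] &
      g *m be D bY = vec [:: c 0%N 1%N; 1 + c 1%N 1%N]].
Proof.
move=> gf ez tE g q c; pose J (z : D) := z = 0.
have iJ : ideal J by case: (chain_ideal (chain0 D)).
have nJ z : J z -> nilp z by move=> ->; apply: nilp0.
have Je : ~ J e by [].
pose t' := e *: liftmx D t.
have bE p := cong_lift0 e mu p iJ.
have bE' p : cong J (fam t' p) (mu p + e *: liftb D (pert t) p).
  by rewrite liftb_pert -fam0 -famD add0r; apply: cong_refl.
have gI : intertw g mu (fam t').
  apply: intertw_bas => i j; apply: cong_eq0 => l l'.
  have mm : congb (@Defs.nilp D) mu mu by move=> p; apply: cong_refl; apply: nilp_ideal.
  have := first_variation iJ ne he mm bE bE' (cong_refl iJ g) nJ i j l l'.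
  rewrite (_ : 0 - pert t - ce1 f = 0); last by rewrite -addrA -opprD ez oppr0 addr0.
  rewrite [X in liftmx D X]ffunE /liftmx map_mx0 scaler0 subr0.
  exact.
have gg : gradedmx g.
  move=> i j ne'; rewrite !mxE gf // rmorph0 mulr0 addr0.
  by have := (grGL1 D).2 i j ne'; rewrite mxE.
have gE (i j : 'I_14) : g i j = (i == j)%:R + e * (f i j)%:A by rewrite !mxE.
split=> //.
- suff <- : t' = metab (q 0%N) (q 1%N) (q 2%N) by [].
  apply/colP=> i; rewrite /t' [LHS]mxE [X in _ * X]mxE {1}tE !mxE.
  by case: i => [[|[|[|i]]] iP] //=; rewrite !nth_nil scale0r mulr0.
- by rewrite (graded_L1 gg) // /co !mul_bas !gE -!(inj_eq val_inj) /= !inordK //= add0r.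
- by rewrite (graded_L1 gg) // /co !mul_bas !gE -!(inj_eq val_inj) /= !inordK //= add0r.
Qed.

(** To first order in e the six quartic relations are linear in q and in the entries of f on L_1;
    their solutions are q = 0 and a scalar matrix. *)
Lemma first_order_rigid (t : 'cV[k]_11) f : gradedmx f -> pert t + ce1 f = 0 ->
  t = metab (t (inord 0) 0) (t (inord 1) 0) (t (inord 2) 0) ->
  t = 0 /\ exists c, f = c *: euler k.
Proof.
move=> gf ez tE; have [] := first_order_gl2 gf ez tE.
set g := _ + _; move=> gg gI gX gY; have ee : e * e = 0 by apply: he.
pose q0 := t (inord 0) 0; pose q1 := t (inord 1) 0; pose q2 := t (inord 2) 0.
pose al := f (inord 0) (inord 0); pose be' := f (inord 0) (inord 1).
pose ga := f (inord 1) (inord 0); pose de := f (inord 1) (inord 1).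
have [|E1 E2 [E3 E4 E5 E6]] := quartic_eqs gI gX gY.
  rewrite (_ : _ - _ = 1 + e * (al%:A + de%:A)); last by rewrite /al /de; ring: ee.
  by apply: unit_nilp; [exact: unitr1 | rewrite mulrC; apply: nilpM].
have two : 2 != 0 :> k by rewrite (pcharf0P k).1.
have four : 4 != 0 :> k by rewrite (pcharf0P k).1.
have h1 : 4 * al + q0 = 4 * de - q0.
  apply: eps_eq.
  apply: (addrI 1); apply: (etrans _ (etrans E1 _)); rewrite -!in_algE /quartic_T0 /al /de /q0; ring: ee.
have h2 : 4 * ga = 4 * be'.
  apply: eps_eq.
  apply: (etrans _ (etrans E2 _)); rewrite -!in_algE /ga /be'; ring: ee.
have h3 : be' + q1 = ga - q1.
  apply: eps_eq.
  apply: (etrans _ (etrans E3 _)); rewrite -!in_algE /quartic_T0 /ga /be' /q1; ring: ee.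
have h4 : 3 * al + de = al + 3 * de.
  apply: eps_eq.
  apply: (addrI 1); apply: (etrans _ (etrans E4 _)); rewrite -!in_algE /al /de; ring: ee.
have h5 : q2 = 0.
  apply: eps_eq; rewrite scale0r mulr0.
  apply: (etrans _ E5); rewrite -!in_algE /quartic_T0 /q2; ring: ee.
have h6 : 2 * (be' + ga) = 0.
  apply: eps_eq; rewrite scale0r mulr0.
  apply: (etrans _ E6); rewrite -!in_algE /be' /ga; ring: ee.
have gb : ga = be' by apply: (mulfI four).
have ad : al = de.
  apply: (mulfI two); apply/eqP; rewrite -subr_eq0; apply/eqP.
  by rewrite (_ : _ - _ = 3 * al + de - (al + 3 * de)); [rewrite h4 subrr | ring].
have q00 : q0 = 0.
  apply: (mulfI two); rewrite mulr0 (_ : _ * _ = 4 * al + q0 - (4 * de - q0)).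
    by rewrite h1 subrr.
  by rewrite ad; ring.
have q10 : q1 = 0.
  apply: (mulfI two); rewrite mulr0 (_ : _ * _ = be' + q1 - (ga - q1)).
    by rewrite h3 subrr.
  by rewrite gb; ring.
have b0 : be' = 0.
  apply: (mulfI four); rewrite mulr0 -[RHS]h6 gb; ring.
have t0 : t = 0.
  rewrite tE -/q0 -/q1 -/q2 q00 q10 h5; apply/colP=> i; rewrite !mxE.
  by case: i => [[|[|[|i]]] iP] //=; rewrite nth_nil.
split=> //; exists al.
have gI0 : intertw g mu mu.
  by move: gI; rewrite -/q0 -/q1 -/q2 q00 q10 h5 !scale0r !mulr0 metab0 fam0.
(* Both sides are automorphisms of mu that agree on the generators X and Y. *)
have gE : g = carnot (1 + al *: e).
  apply: (intertw_gen gI0); first by apply/carnot_intertw/mu_graded.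
    rewrite gX -/al -/ga gb b0 scale0r mulr0; apply: coP => n nP.
    rewrite co_vec // [RHS]/co carnotM -/(co _ _) co_be //.
    by move: n nP; apply: lt14P; rewrite /deg inordK //= -(mulr_algl al e); ring.
  rewrite gY -/de -/be' b0 scale0r mulr0 -ad; apply: coP => n nP.
  rewrite co_vec // [RHS]/co carnotM -/(co _ _) co_be //.
  by move: n nP; apply: lt14P; rewrite /deg inordK //= -(mulr_algl al e); ring.
have iJ : ideal (fun z : D => z = 0) by case: (chain_ideal (chain0 D)).
have := carnot_cong al iJ ee; rewrite -gE => /cong_eq0/addrI ef.
apply/eqP; rewrite -subr_eq0; apply/eqP; apply: (cong_xeq0 iJ e0) => i j.
by rewrite /liftmx map_mxB scalerBr ef subrr subr0 mxE.
Qed.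

End SmallAlgebra.

(** Coboundaries have no top part, so the last eight coordinates of t vanish at once and only the
    three metabelian ones are left to [first_order_rigid]. *)
Theorem independent (t : 'cV[k]_11) f : gradedmx f -> pert t + ce1 f = 0 ->
  t = 0 /\ exists c, f = c *: euler k.
Proof.
move=> gf ez; apply: (@first_order_rigid (dual k) (eps k)) => //.
- exact: nilp_eps.
- exact: eps_neq0.
- by move=> y ny; apply: nilpM_dual => //; apply: nilp_eps.
- apply: (top_part_pert_eq0 char0); have := congr1 (@top_part k) ez.
  by rewrite top_partD top_part_ce1 // addr0 top_part0.
Qed.

End Independent.

(** * Coordinates that determine a cocycle *)

Section CocycleCoordinates.
Variable k : fieldType.
Hypothesis char0 : [pchar k] =i pred0.
Variable phi : bilin k.
Hypothesis phiZ : phi \in Z2_0.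
Let p i j := bval phi (be k i) (be k j).

Lemma cochain_anti i j : p i j = - p j i.
Proof. by have /Z2_0P[[a _] _] := phiZ; rewrite /p !bval_bas. Qed.

Lemma cochain_diag i : p i i = 0.
Proof.
have two : 2 != 0 :> k by rewrite (pcharf0P k).1.
apply: (scalerI two); rewrite scaler0 scaler_nat mulr2n {1}cochain_anti addNr //.
Qed.

Lemma cochain_graded i j n : (i < 14)%N -> (j < 14)%N -> (n < 14)%N ->
  wt n != (wt i + wt j)%N -> co (p i j) n = 0.
Proof.
move=> iP jP nP ne; have /Z2_0P[[_ g] _] := phiZ.
by rewrite /p bval_bas /co g // /deg !inordK.
Qed.

Lemma cocycle_eq i j l :
  bval mu (be k i) (p j l) - bval mu (be k j) (p i l) + bval mu (be k l) (p i j)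
  - bval phi (bval mu (be k i) (be k j)) (be k l)
  + bval phi (bval mu (be k i) (be k l)) (be k j)
  - bval phi (bval mu (be k j) (be k l)) (be k i) = 0.
Proof.
have /Z2_0P[_ /ffunP/(_ (inord i, inord j, inord l))] := phiZ.
by rewrite !ffunE.
Qed.

Lemma mu_be0 i j : (1 < i < 14)%N -> (1 < j < 14)%N -> bval mu (be k i) (be k j) = 0.
Proof.
move=> /andP[i1 iP] /andP[j1 jP]; apply: mu_high; rewrite co_be //; try by case: (i) i1 => [|[]].
all: by case: (j) j1 => [|[]].
Qed.

(** In degree zero these amount to the 48 scalar conditions listed in [coord_positions]. *)
Hypotheses (h01 : p 0%N 1%N = 0) (h02 : p 0%N 2%N = 0) (h12 : p 1%N 2%N = 0)
  (h03 : p 0%N 3%N = 0) (h04 : p 0%N 4%N = 0) (h14 : p 1%N 4%N = 0)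
  (h0L5 : forall m, (7 < m < 12)%N -> p 0%N m = 0)
  (h1L5 : forall m, (7 < m < 12)%N -> p 1%N m = 0)
  (h05 : p 0%N 5%N = 0) (h15 : p 1%N 5%N = 0) (h16 : p 1%N 6%N = 0)
  (h06 : forall n, (9 < n < 12)%N -> co (p 0%N 6%N) n = 0)
  (h07 : forall n, (9 < n < 12)%N -> co (p 0%N 7%N) n = 0)
  (h17 : forall n, (9 < n < 12)%N -> co (p 1%N 7%N) n = 0).

(** The cocycle condition on (X, Y, Z_0); the next relations come in the same way from (X, Y, Z_x),
    (X, Y, Z_y) and (X, Y, L_4). *)
Lemma coords13 : p 1%N 3%N = 0.
Proof.
have := cocycle_eq 0 1 2; rewrite h12 h02 h01 !linear0.
rewrite (@mu_be _ 0 1 2) // (@mu_be _ 0 2 3) // (@mu_be _ 1 2 4) // -!/(p _ _).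
by rewrite cochain_diag (cochain_anti 3) (cochain_anti 4) h04 !(subr0, addr0, sub0r, oppr0) => /eqP; rewrite oppr_eq0 => /eqP.
Qed.

Lemma coords23 : p 2%N 3%N = p 0%N 6%N.
Proof.
have := cocycle_eq 0 1 3; rewrite coords13 h03 h01 !linear0.
rewrite (@mu_be _ 0 1 2) // (@mu_be _ 0 3 5) // (@mu_be _ 1 3 6) // -!/(p _ _).
rewrite (cochain_anti 5) h15 (cochain_anti 6) !(subr0, addr0, sub0r, oppr0, opprK) => /eqP.
by rewrite addrC subr_eq0 => /eqP.
Qed.

Lemma coords24 : p 2%N 4%N = p 0%N 7%N.
Proof.
have := cocycle_eq 0 1 4; rewrite h14 h04 h01 !linear0.
rewrite (@mu_be _ 0 1 2) // (@mu_be _ 0 4 6) // (@mu_be _ 1 4 7) // -!/(p _ _).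
rewrite (cochain_anti 6) h16 (cochain_anti 7) !(subr0, addr0, sub0r, oppr0, opprK) => /eqP.
by rewrite addrC subr_eq0 => /eqP.
Qed.

Lemma coords2L4 m x y : (m, x, y) \in [:: (5, 8, 9); (6, 9, 10); (7, 10, 11)]%N ->
  p 2%N m = bval mu (be k 0) (p 1%N m) - bval mu (be k 1) (p 0%N m).
Proof.
move=> hm; have := cocycle_eq 0 1 m; rewrite h01 !linear0 (@mu_be _ 0 1 2) //.
have -> : bval mu (be k 0) (be k m) = be k x.
  by apply: mu_be; move: hm; rewrite !inE => /or3P[] /eqP[-> -> _].
have -> : bval mu (be k 1) (be k m) = be k y.
  by apply: mu_be; move: hm; rewrite !inE => /or3P[] /eqP[-> _ ->].
have [xP yP] : (7 < x < 12)%N /\ (7 < y < 12)%N.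
  by move: hm; rewrite !inE => /or3P[] /eqP[_ -> ->].
rewrite -!/(p _ _) (cochain_anti x) (cochain_anti y) (h0L5 yP) (h1L5 xP).
by rewrite !(subr0, addr0, oppr0) => /eqP; rewrite subr_eq0 eq_sym => /eqP.
Qed.

(* The cocycle condition on (i, Z_0, j) with i in L_1 and j in L_3. *)
Lemma coords_123 i j l m : (i, 2, l)%N \in mu_table k -> (i, j, m) \in mu_table k ->
  p i j = 0 -> p i 2%N = 0 -> (1 < j < 14)%N ->
  bval mu (be k i) (p 2%N j) = p l j + p 2%N m.
Proof.
move=> il ij pij pi2 jP; have := cocycle_eq i 2 j; rewrite pij pi2 !linear0.
rewrite (mu_be il) (mu_be ij) (mu_be0 _ jP) // bval0l -!/(p _ _).
rewrite (cochain_anti m) !(subr0, addr0) => /eqP; rewrite -addrA -opprD subr_eq0 => /eqP.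
by [].
Qed.

Lemma coords25 : p 2%N 5%N = bval mu (be k 0) (p 2%N 3%N).
Proof. by rewrite (@coords_123 0 3 3 5) // cochain_diag add0r. Qed.

Lemma coords27 : p 2%N 7%N = bval mu (be k 1) (p 2%N 4%N).
Proof. by rewrite (@coords_123 1 4 4 7) // cochain_diag add0r. Qed.

(** Adding the conditions on (Y, Z_0, Z_x) and (X, Z_0, Z_y) cancels the value on (Z_x, Z_y). *)
Lemma coords26 : p 2%N 6%N + p 2%N 6%N =
  bval mu (be k 1) (p 2%N 3%N) + bval mu (be k 0) (p 2%N 4%N).
Proof.
rewrite (@coords_123 1 3 4 6) ?coords13 // (@coords_123 0 4 3 6) //.
by rewrite (cochain_anti 4) addrACA addNr add0r.
Qed.

Lemma coords34 : p 3%N 4%N + bval mu (be k 1) (p 2%N 3%N) = p 2%N 6%N.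
Proof.
by rewrite (@coords_123 1 3 4 6) ?coords13 // (cochain_anti 4) addrA subrr add0r.
Qed.

Lemma co_muX (u : 'cV[k]_14) : (forall n, (n < 8)%N -> co u n = 0) ->
  [/\ co (bval mu (be k 0) u) 12 = co u 8, co (bval mu (be k 0) u) 13 = co u 9 + co u 11,
      co (bval mu (be k 1) u) 12 = co u 11 & co (bval mu (be k 1) u) 13 = co u 8 + co u 10].
Proof.
by move=> u0; split; rewrite muE co_bval //= !co_be //=; ring.
Qed.

Lemma L5_eq0 (u : 'cV[k]_14) : (forall n, (n < 14)%N -> wt n != 5%N -> co u n = 0) ->
  co u 8 = 0 -> co u 9 = 0 -> co u 10 = 0 -> co u 11 = 0 -> u = 0.
Proof.
move=> g u8 u9 u10 u11; apply: coP => n nP; rewrite co0.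
by move: n nP; apply: lt14P => //; apply: g.
Qed.

(** Since ad X maps Z_{x^3}, Z_{x^2 y} to T_0, T_1, it is injective on their span. This is why only
    the coordinates 10 and 11 of three values are prescribed. *)
Lemma muX_inj i j : (i < 14)%N -> (j < 14)%N -> (wt i + wt j = 5)%N ->
  bval mu (be k 0) (p i j) = 0 -> (forall n, (9 < n < 12)%N -> co (p i j) n = 0) ->
  p i j = 0.
Proof.
move=> iP jP e X0 h; have g n : (n < 14)%N -> wt n != 5%N -> co (p i j) n = 0.
  by move=> nP ne; apply: cochain_graded; rewrite ?e.
have lo n : (n < 8)%N -> co (p i j) n = 0.
  move=> nP; apply: g; first exact: leq_trans nP _.
  by case: n nP => [|[|[|[|[|[|[|[|]]]]]]]].
have [] := co_muX lo; rewrite X0 !co0 (h 10) // (h 11) // addr0 => e8 e9 _ _.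
by apply: L5_eq0; rewrite -?e8 -?e9 ?h.
Qed.

(** Zeros propagate alternately: a vanishing value in L_6 shows that ad X kills a value in L_5,
    which is then zero by [muX_inj] and yields the next value in L_6. *)
Lemma coords_eq0 : phi = 0.
Proof.
have p25 : p 2%N 5%N = 0 by rewrite (@coords2L4 5 8 9) // h15 h05 !linear0 ?subr0 ?addr0.
have p06 : p 0%N 6%N = 0 by apply: muX_inj => //; rewrite -coords23 -coords25.
have p26 : p 2%N 6%N = 0 by rewrite (@coords2L4 6 9 10) // h16 p06 !linear0 ?subr0 ?addr0.
have p23 : p 2%N 3%N = 0 by rewrite coords23.
have p07 : p 0%N 7%N = 0.
  apply: muX_inj => //; rewrite -coords24.
  by have := coords26; rewrite p26 p23 linear0 addr0 add0r.
have p24 : p 2%N 4%N = 0 by rewrite coords24.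
have p27 : p 2%N 7%N = 0 by rewrite coords27 p24 linear0.
have p17 : p 1%N 7%N = 0.
  apply: muX_inj => //; have := p27.
  by rewrite (@coords2L4 7 10 11) // p07 linear0 ?subr0 ?addr0.
have p34 : p 3%N 4%N = 0 by have := coords34; rewrite p23 linear0 addr0 p26.
have p13 := coords13.
have hi i j : (i < 14)%N -> (j < 14)%N -> (6 < wt i + wt j)%N -> p i j = 0.
  move=> iP jP ij; apply: coP => n nP; rewrite co0; apply: cochain_graded => //.
  rewrite neq_ltn; apply/orP; left; apply: leq_ltn_trans ij.
  by move: n nP; apply: lt14P.
have lt i j : (i < 14)%N -> (j < 14)%N -> (i < j)%N -> p i j = 0.
  pose low : seq (nat * nat) :=
    ([:: (0, 1); (0, 2); (1, 2); (0, 3); (0, 4); (1, 3); (1, 4); (0, 5); (1, 5); (1, 6);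
        (0, 6); (0, 7); (1, 7); (2, 3); (2, 4); (2, 5); (2, 6); (2, 7); (3, 4)] ++
     [seq (i, m) | i <- iota 0 2, m <- iota 8 4])%N.
  (* Verified by computation: every pair either has total degree above 6 or has been treated. *)
  have check : all (fun i => all (fun j => (i < j)%N ==>
      ((6 < wt i + wt j)%N || ((i, j) \in low))) (iota 0 14)) (iota 0 14) by [].
  move=> iP jP ij; have /allP/(_ j) := allP check i (etrans (mem_iota 0 14 i) iP).
  rewrite mem_iota jP ij => /(_ isT)/orP[/hi -> //|].
  rewrite mem_cat => /orP[|/allpairsP[[i' m] [hi' hm /= [-> ->]]]].
    by rewrite !inE; do ?case/orP; case/eqP=> -> ->.
  move: hm; rewrite mem_iota => hm; move: hi'; rewrite /= !inE.
  by case/orP=> /eqP ->; [apply: h0L5 | apply: h1L5].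
have all0 i j : (i < 14)%N -> (j < 14)%N -> p i j = 0.
  move=> iP jP; case: (ltngtP i j) => [ij|ji|->]; [exact: lt | | exact: cochain_diag].
  by rewrite cochain_anti lt // oppr0.
apply/ffunP=> -[i j]; rewrite [RHS]ffunE.
by have := all0 i j (ltn_ord i) (ltn_ord j); rewrite /p /be !inord_val bval_bas.
Qed.

End CocycleCoordinates.

(** * Dimension count for cocycles and coboundaries *)

Section Dimensions.
Variable k : fieldType.
Hypothesis char0 : [pchar k] =i pred0.

(** 38 = 4 + 1 + 4 + 9 + 16 + 4 is the sum of the squares of the dimensions of the L_i; the
    elementary matrices within the blocks are free. *)
Lemma dim_C1_lower : (38 <= \dim (C1_0 (k := k)))%N.
Proof.
pose L : seq (nat * nat) := [seq (i, j) | i <- iota 0 14, j <- [seq j <- iota 0 14 | wt i == wt j]].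
have sL : size L = 38 by [].
have uL : uniq L by [].
pose ix (m : 'I_38) : 'I_14 * 'I_14 := (inord (nth (0, 0)%N L m).1, inord (nth (0, 0)%N L m).2).
have LP (m : 'I_38) : [/\ (nth (0, 0)%N L m).1 < 14, (nth (0, 0)%N L m).2 < 14 &
   wt (nth (0, 0)%N L m).1 == wt (nth (0, 0)%N L m).2]%N.
  have : all (fun x => [&& x.1 < 14, x.2 < 14 & wt x.1 == wt x.2]%N) L by [].
  by move/allP/(_ (nth (0, 0)%N L m)); rewrite mem_nth // => /(_ isT)/and3P.
have ix_inj : injective ix.
  move=> m m'; rewrite /ix => -[/(congr1 val) e1 /(congr1 val) e2].
  have [a1 b1 _] := LP m; have [a2 b2 _] := LP m'.
  rewrite /= !inordK // in e1 e2; apply: val_inj.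
  have e : nth (0, 0)%N L m = nth (0, 0)%N L m'.
    by rewrite [LHS]surjective_pairing e1 e2 -surjective_pairing.
  have mL (n : 'I_38) : (n < size L)%N by rewrite sL.
  by apply/eqP; have := nth_uniq (0, 0)%N (mL m) (mL m') uL; rewrite e eqxx => <-.
pose th (v : 'rV[k]_38) : 'M[k]_14 := \sum_m v 0 m *: delta_mx (ix m).1 (ix m).2.
have th_lin : linear th.
  move=> c u v; rewrite /th scaler_sumr -big_split; apply: eq_bigr => l _.
  by rewrite (_ : (c *: u + v) 0 l = c * u 0 l + v 0 l) ?scalerDl ?scalerA // !mxE.
pose th' := GRing.isLinear.Build k _ _ _ th th_lin.
pose TH : {linear 'rV[k]_38 -> 'M[k]_14} := HB.pack th th'.
have thE v (n : 'I_38) : th v (ix n).1 (ix n).2 = v 0 n.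
  rewrite /th summxE (bigD1 n) //= !mxE !eqxx mulr1 big1 ?addr0 // => r ne.
  rewrite !mxE; case: andP => [[/eqP e1 /eqP e2]|_]; last by rewrite mulr0.
  by case/eqP: ne; apply: ix_inj; congr (_, _); [exact: esym e1 | exact: esym e2].
have ker0 : lker (linfun TH) = 0%VS.
  apply/eqP; rewrite -subv0; apply/subvP=> v; rewrite memv_ker lfunE /= memv0 => /eqP v0.
  by apply/eqP/rowP=> m; rewrite -thE [th v]v0 !mxE.
have <- : \dim (linfun TH @: fullv)%VS = 38%N.
  by rewrite limg_dim_eq ?ker0 ?capv0 // dimvf /dim /= mul1n.
apply/dimvS/subvP=> _ /memv_imgP[v _ ->]; rewrite lfunE /=.
apply/C1_0P => i j ne; rewrite /th summxE big1 // => m _; rewrite !mxE.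
case: andP => [[/eqP ei /eqP ej]|_]; last by rewrite mulr0.
have [a1 b1 /eqP w] := LP m; case/eqP: ne.
by rewrite ei ej /deg !inordK.
Qed.

Definition coord_positions : seq (nat * nat * nat) :=
  [:: (0, 1, 2); (0, 2, 3); (0, 2, 4); (1, 2, 3); (1, 2, 4)]%N ++
  [seq (x, l) | x <- [:: (0, 3); (0, 4); (1, 4)]%N, l <- iota 5 3] ++
  [seq (x, l) | x <- [seq (i, m) | i <- iota 0 2, m <- iota 8 4], l <- iota 12 2] ++
  [seq (x, l) | x <- [:: (0, 5); (1, 5); (1, 6)]%N, l <- iota 8 4] ++
  [seq (x, l) | x <- [:: (0, 6); (0, 7); (1, 7)]%N, l <- iota 10 2].

(** Evaluation at the 48 positions is injective on cocycles by [coords_eq0]. *)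
Lemma dim_Z2_upper : (\dim (Z2_0 (k := k)) <= 48)%N.
Proof.
pose ev (b : bilin k) : 'rV[k]_48 := \row_m
  let x := nth (0, 0, 0)%N coord_positions m in
  b (inord x.1.1, inord x.1.2) (inord x.2) 0.
have ev_lin : linear ev.
  by move=> c u v; apply/rowP=> m; rewrite !mxE /= !ffunE !mxE.
pose ev' := GRing.isLinear.Build k _ _ _ ev ev_lin.
pose EV : {linear bilin k -> 'rV[k]_48} := HB.pack ev ev'.
have cap0 : (Z2_0 :&: lker (linfun EV) = 0)%VS.
  apply/eqP; rewrite -subv0; apply/subvP=> b; rewrite memv_cap memv_ker lfunE /= memv0.
  case/andP=> bZ /eqP/rowP b0; apply/eqP.
  have pos x : x \in coord_positions -> co (bval b (be k x.1.1) (be k x.1.2)) x.2 = 0.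
    move=> xP; have := b0 (Ordinal (etrans (index_mem x _) xP : (index x coord_positions < 48)%N)).
    by rewrite !mxE /= nth_index // bval_bas.
  have g i j n : (i < 14)%N -> (j < 14)%N -> (n < 14)%N ->
    wt n != (wt i + wt j)%N -> co (bval b (be k i) (be k j)) n = 0.
    exact: cochain_graded.
  have z i j : (i < 14)%N -> (j < 14)%N ->
      all (fun n => (wt n == wt i + wt j)%N ==> ((i, j, n) \in coord_positions)) (iota 0 14) ->
      bval b (be k i) (be k j) = 0.
    move=> iP jP /allP h; apply: coP => n nP; rewrite co0.
    have := h n; rewrite mem_iota => /(_ nP)/implyP hn.
    by case: (boolP (wt n == wt i + wt j)%N) => [/hn/(pos (i, j, n)) // | ne]; apply: g.
  apply: (coords_eq0 char0 bZ); do ?by apply: z.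
  - by move=> m /andP[]; case: m => [|[|[|[|[|[|[|[|[|[|[|[|]]]]]]]]]]]] // _ _; apply: z.
  - by move=> m /andP[]; case: m => [|[|[|[|[|[|[|[|[|[|[|[|]]]]]]]]]]]] // _ _; apply: z.
  - by move=> n nP; apply: (pos (0, 6, n)%N); case/andP: nP; case: n => [|[|[|[|[|[|[|[|[|[|[|[|]]]]]]]]]]]].
  - by move=> n nP; apply: (pos (0, 7, n)%N); case/andP: nP; case: n => [|[|[|[|[|[|[|[|[|[|[|[|]]]]]]]]]]]].
  - by move=> n nP; apply: (pos (1, 7, n)%N); case/andP: nP; case: n => [|[|[|[|[|[|[|[|[|[|[|[|]]]]]]]]]]]].
by rewrite -(limg_dim_eq cap0); apply: leq_trans (dimvS (subvf _)) _; rewrite dimvf /dim /= mul1n.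
Qed.

(** Over the dual numbers the family at e t is a law congruent to mu, so its first-order term is a
    cocycle by [small_cocycle]. *)
Lemma pert_Z2 (t : 'cV[k]_11) : pert t \in Z2_0.
Proof.
pose D := dual k; pose e : D := eps k.
have [iJ _] := chain_ideal (chain0 D).
have e0 : e <> 0 by apply: eps_neq0.
have m0 : hatX (fam (0 : 'cV[D]_11)).
  by apply: fam_hatX => i; rewrite mxE; apply: nilp0.
have mm : congb (@Defs.nilp D) mu mu by move=> p; apply: cong_refl; apply: nilp_ideal.
rewrite fam0 in m0.
apply: (small_cocycle iJ _ (nilp_eps k) _ e0 (fam_law (e *: liftmx D t)) m0.1 mm) => [y ->|y ny|p].
- exact: nilp0.
- by apply: nilpM_dual => //; apply: nilp_eps.
by rewrite liftb_pert -fam0 -famD add0r; apply: cong_refl.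
Qed.

(** Likewise, transporting mu by 1 + e f gives a law, with first-order term - [ce1] f. *)
Lemma ce1_Z2 (f : 'M[k]_14) : gradedmx f -> ce1 f \in Z2_0.
Proof.
move=> gf; pose D := dual k; pose e : D := eps k.
have [iJ nJ] := chain_ideal (chain0 D).
have e0 : e <> 0 by apply: eps_neq0.
have he (y : D) : nilp y -> y * e = 0.
  by move=> ny; apply: nilpM_dual => //; apply: nilp_eps.
have m0 : hatX (fam (0 : 'cV[D]_11)).
  by apply: fam_hatX => i; rewrite mxE; apply: nilp0.
have mm : congb (@Defs.nilp D) mu mu by move=> p; apply: cong_refl; apply: nilp_ideal.
rewrite fam0 in m0.
pose g : 'M[D]_14 := 1%:M + e *: liftmx D f.
have hg : hatH g by apply: hatH_small => //; apply: nilp_eps.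
have [[gu _] _] := hg; rewrite -memvN.
pose b' : bilin D := [ffun p => mu p + e *: liftb D (- ce1 f) p].
have b'E : act g mu = b'.
  apply/actP => //; apply: intertw_bas => i j; apply: cong_eq0 => l l'.
  have bE p := cong_lift0 e mu p iJ.
  have bE' p : cong (fun z : D => z = 0) (b' p) (mu p + e *: liftb D (- ce1 f) p).
    by rewrite ffunE; apply: cong_refl.
  have := first_variation iJ (nilp_eps k) he mm bE bE' (cong_refl iJ g) nJ i j l l'.
  rewrite (_ : 0 - - ce1 f - ce1 f = 0); last by rewrite opprK add0r subrr.
  by rewrite [X in liftmx D X]ffunE /liftmx map_mx0 scaler0 subr0.
have lb : graded_law b' by rewrite -b'E; apply: graded_law_act m0.1; case: hg.
apply: (small_cocycle iJ nJ (nilp_eps k) he e0 lb m0.1 mm) => p.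
by rewrite ffunE; apply: cong_refl.
Qed.

Definition fam_space : {vspace bilin k} := (linfun (@pert k) @: fullv)%VS.

Lemma fam_spaceP b : reflect (exists t, b = pert t) (b \in fam_space).
Proof.
apply: (iffP memv_imgP) => [[t _ ->]|[t ->]]; exists t; rewrite ?lfunE ?memvf //.
Qed.

Lemma dim_fam_space : \dim fam_space = 11%N.
Proof.
rewrite /fam_space limg_dim_eq; first by rewrite dimvf /dim /= muln1.
apply/eqP; rewrite capfv -subv0; apply/subvP=> t; rewrite memv_ker lfunE memv0 /= => /eqP t0.
have g0 : gradedmx (0 : 'M[k]_14) by move=> i j _; rewrite mxE.
have [|-> //] := independent char0 (t := t) g0.
by rewrite t0 linear0 addr0.
Qed.

Lemma fam_capB2 : (fam_space :&: B2_0 = 0)%VS.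
Proof.
apply/eqP; rewrite -subv0; apply/subvP=> b; rewrite memv_cap memv0.
case/andP=> /fam_spaceP[t bt] /B2_0P[f gf bf].
have gNf : gradedmx (- f) by move=> i j ne; rewrite mxE gf // oppr0.
have [|t0 _] := independent char0 (t := t) gNf; last by rewrite bt t0 linear0.
by rewrite linearN /= -bt bf subrr.
Qed.

(** By [independent] at t = 0 the kernel of [ce1] lies on the line of [euler]. *)
Lemma dim_B2_lower : (37 <= \dim (B2_0 (k := k)))%N.
Proof.
have ker1 : (\dim (C1_0 (k := k) :&: lker (linfun (@ce1 k)))%VS <= 1)%N.
  apply: leq_trans (dimvS (_ : _ <= <[euler k]>)%VS) _; last by rewrite dim_vline; case: eqP.
  apply/subvP=> f; rewrite memv_cap memv_ker lfunE /= => /andP[/C1_0P gf /eqP f0].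
  have [|_ [c ->]] := independent char0 (t := 0) gf; last by rewrite memvZ ?memv_line.
  by rewrite linear0 add0r f0.
have := limg_ker_dim (linfun (@ce1 k)) C1_0; rewrite -/B2_0 => e.
by rewrite -(leq_add2l 1); apply: leq_trans (leq_add ker1 (leqnn _)); rewrite e dim_C1_lower.
Qed.

(** The sum is direct and contained in Z^2_0, and 11 + 37 reaches the upper bound 48. *)
Lemma Z2_decomp : (fam_space + B2_0 = Z2_0 :> {vspace bilin k})%VS.
Proof.
apply/eqP; rewrite eqEdim; apply/andP; split.
  rewrite subv_add; apply/andP; split; apply/subvP => b.
    by case/fam_spaceP=> t ->; apply: pert_Z2.
  by case/B2_0P=> f gf ->; apply: ce1_Z2.
apply: leq_trans dim_Z2_upper _; rewrite dimv_disjoint_sum ?fam_capB2 // dim_fam_space.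
by rewrite (leq_add2l 11 37) dim_B2_lower.
Qed.

Lemma dim_Z2 : \dim (Z2_0 (k := k)) = (\dim (B2_0 (k := k)) + 11)%N.
Proof.
by rewrite -Z2_decomp dimv_disjoint_sum ?fam_capB2 // dim_fam_space addnC.
Qed.

Theorem spanning (d : bilin k) : d \in Z2_0 ->
  exists t f, gradedmx f /\ d = pert t + ce1 f.
Proof.
rewrite -Z2_decomp => /memv_addP[_ /fam_spaceP[t ->] [_ /B2_0P[f gf ->] ->]].
by exists t, f.
Qed.

End Dimensions.

(** * Pencil motion *)

Section PencilGauge.
Variable R : comUnitRingType.

(** The family deforms L_1 x L_4 -> L_5 and keeps L_1 x L_5 -> L_6, the pencil motion does the
    reverse. A change of basis passing from one to the other has to alter only the coordinates in
    L_5 and the coordinate of T_0. *)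
Definition gauge_row (q0 q1 q2 : R) (n : nat) : seq R :=
  nth [::] (nseq 8 [::] ++
    [:: nseq 8 0 ++ [:: q0; q1; q2; - q1];
        nseq 8 0 ++ [:: - q1; - q2; q1; q0];
        nseq 8 0 ++ [:: - q0; - q1; - q2; q1];
        nseq 8 0 ++ [:: q1; q2; - q1; - q0];
        nseq 12 0 ++ [:: - q0; - q1]]) n.

Definition gauge (q0 q1 q2 : R) : 'M[R]_14 := \matrix_(i, j) (gauge_row q0 q1 q2 i)`_j.

(** A recursive product, which reduces on a concrete row to an expression for [ring]. *)
Fixpoint rdot (r : seq R) (f : nat -> R) : R :=
  if r is c :: r' then c * f 0%N + rdot r' (fun n => f n.+1) else 0.

Lemma rdotE r f n : (size r <= n)%N -> rdot r f = \sum_(i < n) r`_i * f i.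
Proof.
elim: r f n => [|c r IH] f [|n] //= => [_|_|rn]; rewrite ?big_ord0 //.
  by rewrite big1 // => i _; rewrite nth_nil mul0r.
by rewrite big_ord_recl /= (IH _ n).
Qed.

Lemma co_gauge q0 q1 q2 u n : (n < 14)%N ->
  co (gauge q0 q1 q2 *m u) n = rdot (gauge_row q0 q1 q2 n) (co u).
Proof.
move=> nP; rewrite (@rdotE _ _ 14); last by move: n nP; apply: lt14P.
rewrite /co mxE; apply: eq_bigr => j _.
by rewrite mxE inordK // inord_val.
Qed.

Definition pencil_terms (p : 'cV[R]_3) : seq (nat * nat * nat * R) :=
  [:: (bX, bZx3, bT0, p 0 0); (bX, bZx2y, bT0, p 1 0); (bY, bZx3, bT0, p 1 0);
      (bX, bZxy2, bT0, p 2 0); (bY, bZx2y, bT0, p 2 0)].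

Lemma pencil_motionE p : pencil_motion p = of_terms (mu_terms R ++ pencil_terms p).
Proof.
have -> : pencil_motion p = mu + p 0 0 *: psi0 + p 1 0 *: psi1 + p 2 0 *: psi2.
  by apply/ffunP=> q; rewrite [LHS]ffunE !bilinDE !bilinZE.
rewrite of_terms_cat -muE -!addrA; congr (_ + _); apply: bilin_coP => u v n nP.
rewrite /psi0 /psi1 /psi2 !of_tableE // !bval_addf !bvalZf !coD !coZ !co_bval //.
by move: n nP; apply: lt14P; rewrite /=; ring.
Qed.

Lemma gauge_intertw (p : 'cV[R]_3) (q0 q1 q2 : R) :
  p 0 0 * q0 = p 0 0 - 2 * q0 -> p 1 0 * q0 = p 1 0 - 2 * q1 -> p 2 0 * q0 = p 2 0 - q2 ->
  intertw (1%:M + gauge q0 q1 q2) (pencil_motion p) (fam (metab q0 q1 q2)).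
Proof.
move=> e0 e1 e2 u v; apply: coP => n nP; rewrite pencil_motionE famE.
rewrite mulmxDl mul1mx coD co_gauge // !co_bval //.
move: n nP; apply: lt14P; rewrite /= ?mulmxDl ?mul1mx ?coD ?co_gauge //= ?mxE ?inordK //= ?co_bval //=.
all: rewrite ?/bX ?/bY ?/bZ0 ?/bZx ?/bZy ?/bZx2 ?/bZxy ?/bZy2 ?/bZx3 ?/bZx2y ?/bZxy2 ?/bZy3 ?/bT0 ?/bT1.
all: try ring.
(* The coordinate of T_0 remains, the only one in which p occurs; its defect is a combination of the
   three hypotheses. *)
pose x i j := co u i * co v j - co u j * co v i; apply/eqP.
rewrite -subr_eq0 (_ : _ - _ = - (p 0 0 * q0 - (p 0 0 - 2 * q0)) * x 0%N 8%N
  - (p 1 0 * q0 - (p 1 0 - 2 * q1)) * (x 0%N 9%N + x 1%N 8%N)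
  - (p 2 0 * q0 - (p 2 0 - q2)) * (x 0%N 10%N + x 1%N 9%N)); last by rewrite /x; ring.
by rewrite e0 e1 e2 !subrr !(oppr0, mul0r, subr0, addr0).
Qed.

Lemma gauge_graded (q0 q1 q2 : R) : gradedmx (gauge q0 q1 q2).
Proof.
move=> i j; rewrite mxE /deg -!/(wt _); move: (i : nat) (ltn_ord i) (j : nat) (ltn_ord j).
by apply: lt14P; apply: lt14P.
Qed.

Lemma gauge_nilp (q0 q1 q2 : R) i j : nilp q0 -> nilp q1 -> nilp q2 ->
  nilp (gauge q0 q1 q2 i j).
Proof.
move=> n0 n1 n2; rewrite mxE; move: (i : nat) (ltn_ord i) (j : nat) (ltn_ord j).
have z := nilp0 R; have N x : nilp x -> nilp (- x) := @nilpN R x.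
by apply: lt14P; apply: lt14P; rewrite /gauge_row /=; auto.
Qed.

(* The gauge transformation is linear in q, and p = (2 q0, 2 q1, q2) to first order. *)
Lemma pert_metab (q0 q1 q2 : R) u v : bval (pert (metab q0 q1 q2)) u v =
    (2 * q0) *: bval psi0 u v + (2 * q1) *: bval psi1 u v + q2 *: bval psi2 u v
    - (bval mu u (gauge q0 q1 q2 *m v) - bval mu v (gauge q0 q1 q2 *m u)
       - gauge q0 q1 q2 *m bval mu u v).
Proof.
apply: coP => n nP.
rewrite /psi0 /psi1 /psi2 !of_tableE // muE !(coD, coN, coZ) co_gauge // !co_bval //.
move: n nP; apply: lt14P; rewrite /= ?co_gauge //= ?mxE ?inordK //= ?co_bval //=.
all: rewrite ?/bX ?/bY ?/bZ0 ?/bZx ?/bZy ?/bZx2 ?/bZxy ?/bZy2 ?/bZx3 ?/bZx2y ?/bZxy2 ?/bZy3 ?/bT0 ?/bT1.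
all: ring.
Qed.

End PencilGauge.

(** * Slices *)

Section SliceCoordinates.
Variable k : fieldType.
Hypothesis char0 : [pchar k] =i pred0.
Variable S : subfunctor k.
Hypothesis hS : effective_slice S.

Definition nilv (A : artAlg k) n (t : 'cV[A]_n) := forall i, nilp (t i 0).

(** A relation, since neither direction has a formula. Uniqueness of s is the slice property,
    uniqueness of t is [versal_unique]. *)
Definition normalizes (A : artAlg k) (s : bilin A) (t : 'cV[A]_11) :=
  [/\ S s, nilv t & exists2 h, hatH h & act h s = fam t].

Lemma hatH_unit (A : artAlg k) (h : 'M[A]_14) : hatH h -> h \in unitmx.
Proof. by case=> [[]]. Qed.

Lemma normalizes_inj (A : artAlg k) (s s' : bilin A) t :
  normalizes s t -> normalizes s' t -> s = s'.
Proof.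
move=> [Ss nt [h hh e]] [Ss' _ [h' hh' e']].
have [g [s0 [_ _ _ u]]] := slice_action hS (fam_hatX nt).
by have [_ ->] := u _ _ hh Ss e; have [_ ->] := u _ _ hh' Ss' e'.
Qed.

Lemma normalizes_fun (A : artAlg k) (s : bilin A) t t' :
  normalizes s t -> normalizes s t' -> t = t'.
Proof.
move=> [Ss nt [h hh e]] [_ nt' [h' hh' e']].
have hu := hatH_unit hh; have hu' := hatH_unit hh'.
apply: (versal_unique (independent char0) (hatH_mul hh (hatH_inv hh')) nt' nt).
by rewrite -e' act_mul ?unitmx_inv // actK.
Qed.

Lemma normalizes_total (A : artAlg k) (s : bilin A) : S s -> exists t, normalizes s t.
Proof.
move=> Ss; have [h [t [hh nt e]]] := versal_exists (spanning char0) (slice_sub hS Ss).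
by exists t; split=> //; exists h.
Qed.

Lemma normalizes_onto (A : artAlg k) (t : 'cV[A]_11) : nilv t ->
  exists s, normalizes s t.
Proof.
move=> nt; have [h [s [hh Ss e _]]] := slice_action hS (fam_hatX nt).
by exists s; split=> //; exists h.
Qed.

Lemma hatH_map (A B : artAlg k) (f : {lrmorphism A -> B}) (h : 'M[A]_14) :
  hatH h -> hatH (map_mx f h).
Proof.
move=> [[hu gh] nh]; split; first split; first exact: unitmx_map.
  by move=> i j ne; rewrite mxE gh // rmorph0.
move=> i j; rewrite -(map_mx1 f) -map_mxB mxE.
exact: rmorph_nilp.
Qed.

Lemma normalizes_map (A B : artAlg k) (f : {lrmorphism A -> B}) (s : bilin A) t :
  normalizes s t -> normalizes (bmap f s) (map_mx f t).
Proof.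
move=> [Ss nt [h hh e]]; split; first exact: (slice_functorial hS f Ss).
  by move=> i; rewrite mxE; apply: rmorph_nilp.
exists (map_mx f h); first exact: hatH_map.
by rewrite -bmap_act ?hatH_unit // e bmap_fam.
Qed.

(** Chosen separately for each A; naturality follows from uniqueness. *)
Definition slice_point (A : artAlg k) (t : 'cV[A]_11) : bilin A :=
  epsilon (inhabits 0) (fun s => normalizes s t).

Definition slice_coord (A : artAlg k) (s : bilin A) : 'cV[A]_11 :=
  epsilon (inhabits 0) (fun t => normalizes s t).

Lemma slice_pointP (A : artAlg k) (t : 'cV[A]_11) : nilv t -> normalizes (slice_point t) t.
Proof.
move=> nt.
exact: (epsilon_spec (inhabits 0) (fun s => normalizes s t) (normalizes_onto nt)).
Qed.

Lemma slice_coordP (A : artAlg k) (s : bilin A) : S s -> normalizes s (slice_coord s).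
Proof.
move=> Ss.
exact: (epsilon_spec (inhabits 0) (fun t => normalizes s t) (normalizes_total Ss)).
Qed.

Lemma slice_coordE (A : artAlg k) (s : bilin A) t : normalizes s t -> slice_coord s = t.
Proof.
by move=> st; have [Ss _ _] := st; apply: normalizes_fun (slice_coordP Ss) st.
Qed.

Lemma slice_pointE (A : artAlg k) (s : bilin A) t : normalizes s t -> slice_point t = s.
Proof.
by move=> st; have [_ nt _] := st; apply: normalizes_inj (slice_pointP nt) st.
Qed.

Lemma slice_Spf : isomorphism (F := Spf_series k 11) (G := locus S) slice_point.
Proof.
split; first split.
- by move=> A t nt; case: (slice_pointP nt).
- move=> A B f t nt; apply: slice_pointE; apply: normalizes_map.
  exact: slice_pointP.
move=> A s Ss; exists (slice_coord s); have st := slice_coordP Ss; split.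
  by split; [case: st | apply: slice_pointE].
by move=> t [nt <-]; apply: slice_coordE; apply: slice_pointP.
Qed.

Definition slice_top (A : artAlg k) (s : bilin A) : bilin A := top_part (fam (slice_coord s)).

Lemma slice_top_morphism : morphism (F := locus S) (G := Ehat k) slice_top.
Proof.
split=> [A s Ss|A B f s Ss].
  have [_ nt _] := slice_coordP Ss; split; first by apply/top_part_in/fam_graded.
  move=> p l; rewrite /slice_top ffunE; case: ifP => hp; last by rewrite mxE; apply: nilp0.
  have := (fam_hatX nt).2 p l; have /ffunP/(_ p) := top_part_mu A.
  by rewrite [LHS]ffunE hp [RHS]ffunE => ->; rewrite subr0.
rewrite /slice_top (slice_coordE (normalizes_map f (slice_coordP Ss))).
by rewrite -bmap_fam -map_top_part.
Qed.

Lemma art_is_local (A : artAlg k) : is_local A.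
Proof.
move=> x; have [c nc] := art_local x; have xE : x = c%:A + (x - c%:A) by rewrite addrC subrK.
have [c0|c0] := eqVneq c 0.
  right; rewrite c0 scale0r subr0 in nc.
  by apply: unit_nilp; [exact: unitr1 | exact: nilpN].
left; rewrite xE; apply: unit_nilp => //.
by rewrite -in_algE; apply: rmorph_unit; rewrite unitfE.
Qed.

(** If g takes s to [fam] t, then h g h^-1, again in the formal group, takes h s to h [fam] t. This
    is a member of the family, as h is a torus element times a Klein element. *)
Lemma normalizes_stab (A : artAlg k) (h : 'M[A]_14) (s : bilin A) t :
  stab h -> normalizes s t ->
  exists2 t', normalizes (act h s) t' & fam t' = act h (fam t).
Proof.
move=> sh [Ss nt [g hg e]]; have [hh _] := sh; have [hu _] := hh.
have [a [w [c cu ec]]] := stab_klein (art_is_local (A := A)) (two_unit char0 A) sh.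
have eF : fam (klein_fam a w t) = act h (fam t).
  apply/esym/actP => //; rewrite ec.
  by apply: intertw_mul (klein_intertw a w t) (carnot_intertw c (fam_graded _)).
exists (klein_fam a w t) => //; split; first exact: (slice_stable hS).
  have nf (u : 'cV[A]_11) : nilv u -> nilv (flip_fam u) by move=> nu i; rewrite mxE; apply: nilpM.
  have ns (u : 'cV[A]_11) : nilv u -> nilv (swap_fam u) by move=> nu i; rewrite mxE; apply: nilpM.
  by rewrite /klein_fam; case: (a); case: (w); auto.
exists (h *m g *m invmx h); first exact: hatH_conj.
have gu := hatH_unit hg.
by rewrite !act_mul ?unitmx_mul ?unitmx_inv ?hu // actK // e eF.
Qed.

Lemma slice_top_equivariant : equivariant S slice_top.
Proof.
move=> A h s sh Ss; have [t' nt' e] := normalizes_stab sh (slice_coordP Ss).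
by rewrite /slice_top (slice_coordE nt') e act_top_part //; case: sh.
Qed.

(** Any preimage will do, because algebra maps preserve the residue in k. *)
Lemma nilp_lift (A B : artAlg k) (f : {lrmorphism A -> B}) (b : B) :
  (forall b : B, exists a : A, f a = b) -> nilp b -> exists2 a, nilp a & f a = b.
Proof.
move=> sf nb; have [a fa] := sf b; exists a => //; have [c nc] := art_local a.
suff c0 : c = 0 by move: nc; rewrite c0 scale0r subr0.
apply: (@alg_nilp _ B).
have -> : c%:A = b - f (a - c%:A) by rewrite linearB linearZ /= rmorph1 fa opprB addrC subrK.
by apply: nilpB => //; apply: rmorph_nilp.
Qed.

Lemma slice_top_smooth : formally_smooth (F := locus S) (G := Ehat k) slice_top.
Proof.
move=> A B f sf s y Ss [ty ny] e; have st := slice_coordP Ss; have [_ nt _] := st.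
set t := slice_coord s in st nt; pose q n := t (inord n) 0.
have [q0 n0 f0] := nilp_lift sf (nt (inord 0)).
have [q1 n1 f1] := nilp_lift sf (nt (inord 1)).
have [q2 n2 f2] := nilp_lift sf (nt (inord 2)).
(* The three metabelian coordinates are lifted freely; y prescribes the other eight. *)
pose t' := of_top q0 q1 q2 y.
have nt' : nilv t'.
  move=> i; rewrite mxE.
  case: i => [[|[|[|[|[|[|[|[|[|[|[|[]]]]]]]]]]]] iP] //=; do ?exact: ny;
    by apply: nilpZ; apply: ny.
have ft' : map_mx f t' = t.
  rewrite /t' map_of_top f0 f1 f2 (_ : bmap f y = top_part (pert t)) ?top_of //.
  by rewrite -top_part_fam; exact: e.
have st' := slice_pointP nt'; exists (slice_point t'); split; first by case: st'.
  apply: normalizes_inj (normalizes_map f st') _.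
  by rewrite ft'.
by rewrite /slice_top (slice_coordE st') top_part_fam of_topK.
Qed.

(** Being metabelian is invariant under the group, so it is tested on the normal form. The
    equivalence over every A makes the equality of loci scheme-theoretic. *)
Lemma zero_fiberP (A : artAlg k) (s : bilin A) :
  zero_fiber S slice_top s <-> metabelian_locus S s.
Proof.
split=> -[Ss hs]; split=> //; have [_ _ [h hh e]] := slice_coordP Ss.
  have hu := hatH_unit hh; rewrite -(actK s hu) e.
  apply: metabelian_act; first by rewrite unitmx_inv.
  move: hs; rewrite /slice_top top_part_fam => /(top_part_eq0 char0) ->.
  exact: metab_metabelian.
rewrite /slice_top top_part_fam; apply: metabelian_top => //.
by rewrite -e; apply: metabelian_act => //; apply: hatH_unit.
Qed.

End SliceCoordinates.

(** * The binary-pencil germ *)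

Section Pencil.
Variable k : fieldType.
Hypothesis char0 : [pchar k] =i pred0.
Variable S : subfunctor k.
Hypothesis hS : effective_slice S.

(* The relation between p and q under which pencil_motion p and fam (metab q) are
   intertwined by the gauge transformation. *)
Definition pencil_rel (A : artAlg k) (p q : 'cV[A]_3) :=
  [/\ p 0 0 * q 0 0 = p 0 0 - 2 * q 0 0, p 1 0 * q 0 0 = p 1 0 - 2 * q 1 0 &
      p 2 0 * q 0 0 = p 2 0 - q 2 0].

Definition metab3 (A : artAlg k) (q : 'cV[A]_3) : 'cV[A]_11 := metab (q 0 0) (q 1 0) (q 2 0).

(** The relations [pencil_rel] solved for q; 2 + p_0 is a unit because p_0 is nilpotent. *)
Definition pencil_q (A : artAlg k) (p : 'cV[A]_3) : 'cV[A]_3 :=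
  let q0 := p 0 0 / (2 + p 0 0) in
  \col_i [:: q0; halve (p 1 0 * (1 - q0)); p 2 0 * (1 - q0)]`_i.

Lemma col3_ext (R : Type) (p q : 'cV[R]_3) : p 0 0 = q 0 0 -> p 1 0 = q 1 0 ->
  p 2 0 = q 2 0 -> p = q.
Proof.
move=> e0 e1 e2; apply/colP=> i.
have : i \in [:: 0; 1; 2 : 'I_3] by case: i => [[|[|[|]]] ?].
by rewrite !inE => /or3P[] /eqP ->.
Qed.

Lemma nilv3 (A : artAlg k) (p : 'cV[A]_3) : nilp (p 0 0) -> nilp (p 1 0) ->
  nilp (p 2 0) -> nilv p.
Proof.
move=> n0 n1 n2 i.
have : i \in [:: 0; 1; 2 : 'I_3] by case: i => [[|[|[|]]] ?].
by rewrite !inE => /or3P[] /eqP ->.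
Qed.

Lemma two_nilp_unit (A : artAlg k) (x : A) : nilp x -> 2 + x \is a GRing.unit.
Proof. by move=> nx; apply: unit_nilp => //; apply: two_unit. Qed.

Lemma one_nilp_unit (A : artAlg k) (x : A) : nilp x -> 1 - x \is a GRing.unit.
Proof. by move=> nx; apply: unit_nilp; [exact: unitr1 | exact: nilpN]. Qed.

Lemma pencil_qP (A : artAlg k) (p : 'cV[A]_3) : nilv p ->
  pencil_rel p (pencil_q p) /\ nilv (pencil_q p).
Proof.
move=> np; have u := two_nilp_unit (np 0).
have nq0 : nilp (p 0 0 / (2 + p 0 0)) by rewrite mulrC; apply: nilpM.
split; last first.
  apply: nilv3; rewrite mxE //=.
    by rewrite /halve; apply: nilpZ; rewrite mulrC; apply: nilpM.
  by rewrite mulrC; apply: nilpM.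
rewrite /pencil_rel !mxE /= (halveK char0); set q0 := _ / _.
have e : q0 * (2 + p 0 0) = p 0 0 by rewrite divrK.
split; try ring.
by rewrite -{2}e; ring.
Qed.

Lemma pencil_rel_fun (A : artAlg k) (p q q' : 'cV[A]_3) : nilv p ->
  pencil_rel p q -> pencil_rel p q' -> q = q'.
Proof.
move=> np [e0 e1 e2] [f0 f1 f2]; have u := two_nilp_unit (np 0).
have two := two_unit char0 A.
have q0 : q 0 0 = q' 0 0.
  apply: (mulrI u); rewrite !mulrDl e0 f0; ring.
apply: col3_ext => //.
  apply: (mulrI two); apply: oppr_inj; apply: (addrI (p 1 0)).
  by rewrite -e1 -f1 q0.
by apply: oppr_inj; apply: (addrI (p 2 0)); rewrite -e2 -f2 q0.
Qed.

Lemma pencil_rel_inj (A : artAlg k) (p p' q : 'cV[A]_3) : nilv q ->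
  pencil_rel p q -> pencil_rel p' q -> p = p'.
Proof.
move=> nq [e0 e1 e2] [f0 f1 f2]; have u := one_nilp_unit (nq 0).
by apply: col3_ext; apply: (mulIr u); rewrite !mulrBr !mulr1 ?e0 ?e1 ?e2 ?f0 ?f1 ?f2; ring.
Qed.

Lemma pencil_rel_onto (A : artAlg k) (q : 'cV[A]_3) : nilv q ->
  exists2 p, nilv p & pencil_rel p q.
Proof.
move=> nq; have u := one_nilp_unit (nq 0); set v := (1 - q 0 0)^-1.
have uv : v * (1 - q 0 0) = 1 by rewrite mulVr.
exists (\col_i [:: v * 2 * q 0 0; v * 2 * q 1 0; v * q 2 0]`_i).
  by apply: nilv3; rewrite mxE /=; apply: nilpM; apply: nq.
have vq : v * q 0 0 = v - 1 by rewrite -uv; ring.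
by rewrite /pencil_rel !mxE /=; split; ring: vq.
Qed.

Lemma map_pencil_q (A B : artAlg k) (f : {lrmorphism A -> B}) (p : 'cV[A]_3) : nilv p ->
  map_mx f (pencil_q p) = pencil_q (map_mx f p).
Proof.
move=> np; have [[e0 e1 e2] _] := pencil_qP np.
have np' : nilv (map_mx f p) by move=> i; rewrite mxE; apply: rmorph_nilp.
apply: (pencil_rel_fun np') (proj1 (pencil_qP np')).
by split; rewrite ![map_mx _ _ _ _]mxE -rmorphM ?e0 ?e1 ?e2 rmorphB ?rmorphM ?rmorph_nat.
Qed.

Lemma map_metab3 (A B : artAlg k) (f : {lrmorphism A -> B}) (q : 'cV[A]_3) :
  map_mx f (metab3 q) = metab3 (map_mx f q).
Proof.
apply/colP=> i; rewrite !mxE.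
by case: i => [[|[|[|i]]] iP] //=; rewrite !nth_nil rmorph0.
Qed.

Lemma nilv_metab3 (A : artAlg k) (q : 'cV[A]_3) : nilv q -> nilv (metab3 q).
Proof.
move=> nq i; rewrite mxE; case: i => [[|[|[|i]]] iP] //=.
by rewrite nth_nil; apply: nilp0.
Qed.

Lemma gauge_hatH (A : artAlg k) (q : 'cV[A]_3) : nilv q ->
  hatH (1%:M + gauge (q 0 0) (q 1 0) (q 2 0)).
Proof.
move=> nq; apply: hatH_intro => [i j ne|i j].
  by rewrite mxE gauge_graded // addr0; apply: (grGL1 A).2.
by rewrite addrAC subrr add0r; apply: gauge_nilp.
Qed.

Definition classify (A : artAlg k) (p : 'cV[A]_3) : bilin A :=
  slice_point S (metab3 (pencil_q p)).

Lemma classifyP (A : artAlg k) (p : 'cV[A]_3) : nilv p ->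
  normalizes S (classify p) (metab3 (pencil_q p)).
Proof.
by move=> np; apply: slice_pointP => //; apply/nilv_metab3; case: (pencil_qP np).
Qed.

Lemma classify_map (A B : artAlg k) (f : {lrmorphism A -> B}) (p : 'cV[A]_3) : nilv p ->
  classify (map_mx f p) = bmap f (classify p).
Proof.
move=> np; rewrite /classify -map_pencil_q // -map_metab3.
by apply: slice_pointE => //; apply: normalizes_map => //; apply: classifyP.
Qed.

Lemma classify_classifying : classifying_map S classify.
Proof.
split; first split.
- by move=> A p np; case: (classifyP np).
- by move=> A B f p np; apply: classify_map.
move=> A p np; have [[e0 e1 e2] nq] := pencil_qP np.
have [_ _ [h hh e]] := classifyP np; have hg := gauge_hatH nq.
set g := _ + _ in hg; have gu := hatH_unit hg; have hu := hatH_unit hh.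
have eg : act g (pencil_motion p) = fam (metab3 (pencil_q p)).
  by apply/actP => //; apply: gauge_intertw.
exists (invmx g *m h); first by apply: hatH_mul => //; apply: hatH_inv.
by rewrite act_mul ?unitmx_inv // e -eg actK.
Qed.

(** On the zero fibre the slice coordinates reduce to q, and [pencil_rel] is a bijection between
    nilpotent p and nilpotent q. *)
Lemma classify_zero_fiber :
  isomorphism (F := Spf_series k 3) (G := locus (zero_fiber S (slice_top S))) classify.
Proof.
split; first split.
- move=> A p np; have st := classifyP np; split; first by case: st.
  by rewrite /slice_top (slice_coordE char0 hS st) top_part_fam (top_part_metab char0).
- by move=> A B f p np; apply: classify_map.
move=> A s [Ss s0]; have st := slice_coordP char0 hS Ss.
move: s0; rewrite /slice_top top_part_fam => /(top_part_eq0 char0) tE.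
have [_ nt _] := st; set t := slice_coord S s in st nt tE.
pose q : 'cV[A]_3 := \col_i t (inord i) 0.
have nq : nilv q by move=> i; rewrite mxE; apply: nt.
have tq : t = metab3 q by rewrite /metab3 !mxE.
have [p np pq] := pencil_rel_onto nq; have [pq' _] := pencil_qP np.
exists p; split; first split=> //.
  apply: (slice_pointE hS); rewrite -(pencil_rel_fun np pq pq') -tq.
  exact: st.
move=> p' [np' ep]; have st' := classifyP np'; rewrite ep in st'.
have eq : metab3 (pencil_q p') = metab3 q.
  by rewrite -tq; apply: (normalizes_fun char0 st' st).
have eqq : pencil_q p' = q.
  apply: col3_ext.
  - by have /colP/(_ (inord 0)) := eq; rewrite !mxE !inordK.
  - by have /colP/(_ (inord 1)) := eq; rewrite !mxE !inordK.
  - by have /colP/(_ (inord 2)) := eq; rewrite !mxE !inordK.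
by apply: (pencil_rel_inj nq pq); rewrite -eqq; case: (pencil_qP np').
Qed.

End Pencil.

(** * The differential and the tangent decomposition *)

Section Tangent.
Variable k : fieldType.
Hypothesis char0 : [pchar k] =i pred0.

Lemma top_part_is_linear : linear (@top_part k).
Proof.
move=> c b b'; rewrite top_partD; congr (_ + _).
by apply/ffunP=> p; rewrite [LHS]ffunE !bilinZE ffunE; case: ifP; rewrite ?scaler0.
Qed.
HB.instance Definition _ :=
  GRing.isLinear.Build k (bilin k) (bilin k) *:%R (@top_part k) top_part_is_linear.

Definition top_proj : 'Hom(bilin k, bilin k) := linfun (@top_part k).

Lemma top_proj_B2 b : b \in B2_0 -> top_proj b = 0.
Proof. by case/B2_0P=> f gf ->; rewrite lfunE /= top_part_ce1. Qed.

Lemma top_proj_Z2 : (top_proj @: Z2_0)%VS = E_top.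
Proof.
apply/eqP; rewrite eqEsubv; apply/andP; split; apply/subvP=> b.
  case/memv_imgP=> c /Z2_0P[gc _] ->; rewrite lfunE /=.
  by apply/E_topP/top_part_in.
move/E_topP=> tb; apply/memv_imgP; exists (pert (@of_top k k^o 0 0 0 b)).
  exact: pert_Z2.
by rewrite lfunE /= (@of_topK k char0 k^o).
Qed.

Lemma pert_metab_B2 (q0 q1 q2 : k) :
  pert (metab q0 q1 q2) + ce1 (gauge q0 q1 q2)
  = (2 * q0) *: psi0 + (2 * q1) *: psi1 + q2 *: psi2.
Proof.
apply/ffunP=> -[i j]; have := pert_metab q0 q1 q2 (bas i) (bas j).
rewrite !bval_bas !bilinDE !bilinZE => ->; set c := _ - _ - _.
by rewrite (_ : ce1 _ (i, j) = c) ?subrK // ffunE.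
Qed.

(** Each psi is a metabelian direction of the family plus a coboundary, both of which are cocycles
    without top part. *)
Lemma psi_Z2 (psi : bilin k) : psi \in [:: psi0; psi1; psi2] ->
  psi \in Z2_0 /\ top_proj psi = 0.
Proof.
have two : 2 != 0 :> k by rewrite (pcharf0P k).1.
pose X := (Z2_0 :&: lker top_proj)%VS.
suff XP q0 q1 q2 : (2 * q0) *: psi0 + (2 * q1) *: psi1 + q2 *: psi2 \in X.
  have XE (b : bilin k) : b \in X -> b \in Z2_0 /\ top_proj b = 0.
    by rewrite memv_cap memv_ker => /andP[-> /eqP].
  rewrite !inE => /or3P[] /eqP ->; apply: XE.
  - by have := XP 2^-1 0 0; rewrite divff // mulr0 !scale0r !addr0 scale1r.
  - by have := XP 0 2^-1 0; rewrite divff // mulr0 !scale0r add0r addr0 scale1r.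
  - by have := XP 0 0 1; rewrite mulr0 !scale0r !add0r scale1r.
have gg := @gauge_graded k q0 q1 q2; rewrite -pert_metab_B2 memv_cap.
rewrite memvD ?pert_Z2 ?ce1_Z2 //= memv_ker lfunE /= top_partD top_part_ce1 // addr0.
by rewrite (@top_part_metab k char0 k^o).
Qed.

(** A cocycle [pert] t + [ce1] f without top part has t metabelian, and [pert_metab_B2] trades that
    direction for a combination of the psi modulo B^2_0. *)
Lemma top_proj_ker : (Z2_0 :&: lker top_proj)%VS = P_B2.
Proof.
apply/eqP; rewrite eqEsubv; apply/andP; split; last first.
  rewrite subv_add; apply/andP; split.
    apply/span_subvP => b /psi_Z2[bZ b0].
    by rewrite memv_cap bZ memv_ker b0 /=.
  apply/subvP=> b bB; rewrite memv_cap memv_ker top_proj_B2 // eqxx andbT.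
  by case/B2_0P: bB => f gf ->; apply: ce1_Z2.
apply/subvP=> b; rewrite memv_cap memv_ker => /andP[/(spanning char0)[t [f [gf ->]]]].
rewrite lfunE /= top_partD top_part_ce1 // addr0 => /eqP/(top_part_pert_eq0 char0) ->.
set q0 := t _ _; set q1 := t _ _; set q2 := t _ _.
rewrite -[pert _](addrK (ce1 (gauge q0 q1 q2))) pert_metab_B2 -addrA.
apply: memv_add.
  by rewrite !memvD // memvZ // memv_span // !inE eqxx ?orbT.
apply/B2_0P; exists (f - gauge q0 q1 q2); last by rewrite linearB addrC.
by move=> i j ne; rewrite mxE gf // mxE gauge_graded // subr0.
Qed.

Lemma dim_E_top : \dim (E_top (k := k)) = 8%N.
Proof.
pose emb (v : 'cV[k]_8) : 'cV[k]_11 :=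
  \col_i (if (i < 3)%N then 0 else v (inord (i - 3)) 0).
pose th v := top_part (pert (emb v)).
have th_lin : linear th.
  move=> c u v; rewrite /th -linearP -linearP; congr (top_part (pert _)).
  by apply/colP=> i; rewrite !mxE; case: ifP => _; rewrite ?mulr0 ?addr0.
pose th' := GRing.isLinear.Build k _ _ _ th th_lin.
pose TH : {linear 'cV[k]_8 -> bilin k} := HB.pack th th'.
have ker0 : lker (linfun TH) = 0%VS.
  apply/eqP; rewrite -subv0; apply/subvP=> v; rewrite memv_ker lfunE /= memv0.
  move/eqP/(top_part_pert_eq0 char0)/colP => tE; apply/eqP/colP=> i.
  have iP : (i + 3 < 11)%N by rewrite (leq_add2r 3 i.+1 8).
  have := tE (inord (i + 3)); rewrite mxE [RHS]mxE inordK // ltnNge leq_addl /=.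
  by rewrite addnK inord_val nth_default ?leq_addl // => ->; rewrite mxE.
have -> : E_top = (linfun TH @: fullv)%VS.
  apply/eqP; rewrite eqEsubv; apply/andP; split; apply/subvP=> b; last first.
    case/memv_imgP=> v _ ->; rewrite lfunE; apply/E_topP/top_part_in.
    exact: of_terms_graded.
  move/E_topP=> tb; apply/memv_imgP; pose t := @of_top k k^o 0 0 0 b.
  exists (\col_i t (inord (i + 3)) 0); rewrite ?memvf // lfunE /= /th.
  rewrite (_ : emb _ = t) ?(@of_topK k char0 k^o) //.
  apply/colP=> i; rewrite mxE; case: ltnP => [i3|i3].
    by rewrite mxE; case: i i3 => [[|[|[|]]] iP].
  by rewrite mxE inordK ?subnK ?inord_val // ltn_subLR.
by rewrite limg_dim_eq ?ker0 ?capv0 // dimvf /dim /= muln1.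
Qed.

Variable S : subfunctor k.
Hypothesis hS : effective_slice S.

(** h is 1 up to nilpotents, and the generator of the dual numbers annihilates nilpotents. *)
Lemma act_eps (h : 'M[dual k]_14) (phi : bilin k) : hatH h ->
  act h (eps_part phi) = eps_part phi.
Proof.
move=> hh; have hu := hatH_unit hh; pose e := eps k.
pose c := liftb (dual k) phi.
have cE : eps_part phi = e *: c.
  apply/ffunP=> p; rewrite bilinZE /eps_part /c /liftb !ffunE; apply/colP=> l.
  by rewrite !mxE mulr_algr.
have he (y : dual k) : nilp y -> y * e = 0.
  by move=> ny; apply: nilpM_dual => //; apply: nilp_eps.
have [iJ _] := chain_ideal (chain0 (dual k)); have iN := nilp_ideal (dual k).
have h1 m (u : 'M[dual k]_(14, m)) : cong (@Defs.nilp (dual k)) (h *m u) u.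
  rewrite -[X in cong _ _ X]mul1mx; apply: cong_mul => //; last exact: cong_refl.
  exact: hatH_cong.
have xE m n (M N : 'M[dual k]_(m, n)) : cong (@Defs.nilp (dual k)) M N -> e *: M = e *: N.
  by move=> MN; apply: cong_eq0; apply: (congx he).
rewrite cE; apply/actP => //; apply: intertw_bas => i j.
rewrite bvalZf bilinZE -scalemxAr (xE _ _ _ _ (h1 _ _)); apply: xE.
apply: cong_sym => //; rewrite -bval_bas.
by apply: cong_bval => // p; apply: cong_refl.
Qed.

(** The top part of a first-order law is a multiple of the generator, so passing to the normal form
    leaves it unchanged by [act_eps]. *)
Lemma slice_top_tangent phi : tangent S phi ->
  slice_top S (first_order phi) = eps_part (top_proj phi).
Proof.
move=> Sphi; have [_ _ [h hh e]] := slice_coordP char0 hS Sphi.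
rewrite /slice_top -e -act_top_part; last by case: hh.
have -> : top_part (first_order phi) = eps_part (top_proj phi).
  rewrite /first_order top_partD top_part_mu add0r lfunE /=.
  apply/ffunP=> p; rewrite !ffunE; case: ifP => // _.
  by apply/colP=> l; rewrite !mxE scale0r.
exact: act_eps.
Qed.

Lemma eps_part_eq0 (phi : bilin k) : eps_part phi = 0 -> phi = 0.
Proof.
move=> e0; apply/ffunP=> p; rewrite [RHS]ffunE; apply/colP=> l; rewrite [RHS]mxE; apply: eps_inj.
by have /ffunP/(_ p)/colP/(_ l) := e0; rewrite !ffunE !mxE.
Qed.

Lemma eps_part0 : eps_part (0 : bilin k) = 0.
Proof. by apply/ffunP=> p; apply/colP=> l; rewrite !ffunE !mxE scale0r. Qed.

Lemma slice_top_tangent0 phi : tangent S phi ->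
  slice_top S (first_order phi) = 0 <-> top_proj phi = 0.
Proof.
move=> Sphi; rewrite slice_top_tangent //.
by split=> [/eps_part_eq0 //|->]; apply: eps_part0.
Qed.

(** The projection kills B^2_0, so it maps the tangent space U, of dimension 11, onto E_top, of
    dimension 8. M is its kernel on U and N is any complement. *)
Lemma tangent_decomposition : exists U M N : {vspace bilin k},
  [/\ forall phi, phi \in U <-> tangent S phi, (M + N)%VS = U, (M :&: N)%VS = 0%VS,
      forall phi, phi \in M <-> tangent S phi /\ top_proj phi = 0 &
      (top_proj @: N)%VS = E_top /\ (\dim M = 3%N /\ \dim N = 8%N)].
Proof.
have [U [UP UZ UB]] := slice_tangent hS; pose M := (U :&: lker top_proj)%VS.
have dU : \dim U = 11%N.
  apply/eqP; rewrite -(eqn_add2r (\dim (B2_0 (k := k)))) -dimv_disjoint_sum //.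
  by rewrite UZ dim_Z2 // addnC.
have imU : (top_proj @: U)%VS = E_top.
  rewrite -top_proj_Z2 -UZ limgD -[LHS]addv0; congr (_ + _)%VS; apply/esym/eqP.
  rewrite -subv0; apply/subvP=> _ /memv_imgP[b bB ->].
  by rewrite top_proj_B2 // mem0v.
have dM : \dim M = 3%N.
  have := limg_ker_dim top_proj U; rewrite imU dim_E_top dU => e.
  exact: (addIn (e : _ = 3 + 8)%N).
pose N := (U :\: M)%VS; have MU : (M <= U)%VS by apply: capvSl.
have MN : (M + N)%VS = U by rewrite addvC addv_diff; apply/addv_idPl.
have MN0 : (M :&: N)%VS = 0%VS by rewrite capvC capv_diff.
exists U, M, N; split=> //.
  move=> phi; rewrite memv_cap memv_ker; split=> [/andP[/UP ? /eqP]|[/UP -> ->]] //.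
  by rewrite eqxx.
split; last split => //.
  rewrite -imU -MN limgD -[LHS]add0v; congr (_ + _)%VS; apply/esym/eqP.
  rewrite -subv0; apply/subvP=> _ /memv_imgP[b /[swap] ->].
  by rewrite memv_cap memv_ker => /andP[_ /eqP ->]; rewrite mem0v.
have := dimv_disjoint_sum MN0; rewrite MN dU dM => e.
exact: (addnI (esym e : 3 + _ = 3 + 8)%N).
Qed.

End Tangent.

Unset Implicit Arguments.

Theorem theorem6p1 (k : fieldType) (char0 : [pchar k] =i pred0)
    (S : subfunctor k) (hS : effective_slice S) :
  (exists phi : forall A : artAlg k, 'cV[A]_11 -> bilin A,
     isomorphism (F := Spf_series k 11) (G := locus S) phi) /\
  stab_eff_V4 k /\
  exists Theta : forall A : artAlg k, bilin A -> bilin A,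
    [/\ morphism (F := locus S) (G := Ehat k) Theta,
        equivariant S Theta,
        formally_smooth (F := locus S) (G := Ehat k) Theta &
        relative_dimension S Theta 3] /\
    (forall (A : artAlg k) (b : bilin A),
       zero_fiber S Theta b <-> metabelian_locus S b) /\
    (exists cl : forall A : artAlg k, 'cV[A]_3 -> bilin A,
       classifying_map S cl /\
       isomorphism (F := Spf_series k 3) (G := locus (zero_fiber S Theta)) cl) /\
    (exists D : 'Hom(bilin k, bilin k),
       [/\ differential S Theta D,
           (D @: Z2_0)%VS = E_top,
           (Z2_0 :&: lker D)%VS = P_B2 &
           exists M N : {vspace bilin k},
             [/\ forall phi, phi \in (M + N)%VS <-> tangent S phi,
                 (M :&: N)%VS = 0%VS,
                 forall phi, phi \in M <-> tangent (metabelian_locus S) phi,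
                 (D @: N)%VS = E_top &
                 \dim M = 3%N /\ \dim N = 8%N]]) /\
    [/\ \dim (Z2_0 (k := k)) = (\dim (B2_0 (k := k)) + 11)%N,
        \dim (P_B2 (k := k)) = (\dim (B2_0 (k := k)) + 3)%N &
        \dim (E_top (k := k)) = 8%N].
Proof.
have [U [M [N [UP MN MN0 MP [imN [dM dN]]]]]] := tangent_decomposition char0 hS.
split; first by exists (slice_point S); apply: slice_Spf.
split; first exact: stab_eff_klein.
exists (slice_top S); split; [split|split; [|split; [|split; [|split]]]].
- exact: slice_top_morphism.
- exact: slice_top_equivariant.
- exact: slice_top_smooth.
- exists M => // phi; rewrite MP; split=> -[Sphi] /(slice_top_tangent0 char0 hS Sphi) //.
- by move=> A b; apply: zero_fiberP.
- exists (classify S); split; [exact: classify_classifying | exact: classify_zero_fiber].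
- exists (top_proj k); split; last 1 first.
  + exists M, N; split=> //; first by move=> phi; rewrite MN.
    move=> phi; rewrite MP; split=> [[Sphi]|mphi].
      move/(slice_top_tangent0 char0 hS Sphi) => t0.
      by apply/(zero_fiberP char0 hS); split.
    have [Sphi t0] := (zero_fiberP char0 hS (first_order phi)).2 mphi.
    by split=> //; apply/(slice_top_tangent0 char0 hS Sphi).
  + by split; [apply: slice_top_tangent | apply: top_proj_B2].
  + exact: top_proj_Z2.
  + exact: top_proj_ker.
- exact: dim_Z2.
(* Rank-nullity on Z^2_0, with the preimage of P as kernel and an image of dimension 8. *)
- have := limg_ker_dim (top_proj k) Z2_0.
  rewrite top_proj_ker // top_proj_Z2 // dim_E_top // dim_Z2 // => e.
  by apply: (@addIn 8); rewrite -addnA.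
- exact: dim_E_top.
Qed.
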